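(* For every $c\neq \frac{256}{47}$, the orbifold vertex algebra $\left(\mathcal{V}_c^{\otimes 2}\right)^{S_2}$ is strongly generated by $\omega$, $w_4$, $w_6$, $w_8$. For $c=\frac{256}{47}$, the orbifold $\left(\mathcal{V}_{256/47}^{\otimes 2}\right)^{S_2}$ is strongly generated by $\omega$, $w_4$, $w_6$, $w_8$, $w_{10}$.
   Context: $\mathcal{V}_c$ is the universal Virasoro vertex operator algebra of central charge $c$ (generated by a weight-2 vector with field $L(z)=\sum L(n)z^{-n-2}$, $[L(m),L(n)]=(m-n)L(m+n)+\frac{c}{12}(m^3-m)\delta_{m+n,0}$). In $\mathcal{V}_c^{\otimes 2}$, $\omega_i$ is the Virasoro vector of the $i$-th factor with modes $L_i(m)$, and $S_2$ acts by swapping the two tensor factors; $(\cdot)^{S_2}$ denotes the fixed-point subalgebra. Set $\omega=\omega_1+\omega_2$ and, for $k\geq 0$, $w_k=L_1(2-k)L_1(-2)\mathbb{1}+L_2(2-k)L_2(-2)\mathbb{1}$, a vector of conformal weight $k$. A vertex algebra is strongly generated by a set $S$ if it is spanned by normally ordered monomials in the fields of elements of $S$ and their derivatives. *)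

(* Defs.v *)
From HB Require Import structures.
From mathcomp Require Import all_boot all_order all_algebra.
From mathcomp Require Import finmap.
From mathcomp.multinomials Require Import monalg.
Set Implicit Arguments. Unset Strict Implicit. Unset Printing Implicit Defensive.
Import Order.TTheory GRing.Theory Num.Theory.
Local Open Scope ring_scope.

Section Virasoro.
Context (F : fieldType) (c : F).

(* A PBW key [:: k1; ...; kr] with k1 >= ... >= kr >= 2 stands for
   L(-k1) ... L(-kr) 1 ; these form a basis of the universal Virasoro VOA V_c. *)
Definition valid_key (s : seq nat) : bool := sorted geq s && all (fun k => 2 <= k)%N s.
Definition vkey := {s : seq nat | valid_key s}.

Definition V1 := {malg F[vkey]}.

Definition mk (s : seq nat) : V1 :=
  match @insub _ valid_key vkey s with Some k => << k >> | None => 0 end.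

Definition ext1 (f : vkey -> V1) (v : V1) : V1 := \sum_(x <- msupp v) v@_x *: f x.

(* creation: L(-k) (k >= 2) applied to the PBW monomial s (PBW straightening);
   fuel is a sufficient bound on recursion depth *)
Fixpoint ins (fuel k : nat) (s : seq nat) : V1 :=
  match fuel with
  | 0 => 0
  | f.+1 =>
    match s with
    | [::] => mk [:: k]
    | k1 :: s' =>
      if (k1 <= k)%N then mk (k :: s)
      else ext1 (fun t => ins f k1 (val t)) (ins f k s')
           + (k1 - k)%N%:R *: mk ((k + k1)%N :: s')
    end
  end.

Definition insL (k : nat) (s : seq nat) : V1 := ins ((k + sumn s).+1 ^ 2) k s.

(* L(m), m >= -1, applied to the PBW monomial s, via
   [L(m), L(-k)] = (m+k) L(m-k) + c/12 (m^3 - m) delta_{m,k} *)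
Fixpoint ann (s : seq nat) (m : int) {struct s} : V1 :=
  match s with
  | [::] => 0
  | k :: s' =>
    ext1 (fun t => insL k (val t)) (ann s' m)
    + (m + k%:Z)%:~R *: (if m - k%:Z <= -2 then insL `|m - k%:Z|%N s' else ann s' (m - k%:Z))
    + (if m == k%:Z then c / 12%:R * ((m%:~R : F) ^+ 3 - m%:~R) else 0) *: mk s'
  end.

Definition Lop (n : int) (v : V1) : V1 :=
  ext1 (fun x => if n <= -2 then insL `|n|%N (val x) else ann (val x) n) v.

Definition vac1 : V1 := mk [::].

Definition wt1 (v : V1) : nat := (\max_(x <- msupp v) sumn (val x))%N.

Definition binomz (p : int) (m : nat) : F :=
  (\prod_(i < m) ((p%:~R : F) - i%:R)) / (m`!)%:R.

(* modes of the field (d^m L)/m! : ((d^m L)/m!)_(p) = (-1)^m binom(p,m) L(p-m-1) *)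
Definition Amode (m : nat) (p : int) (w : V1) : V1 :=
  ((-1) ^+ m * binomz p m) *: Lop (p - m%:Z - 1) w.

(* n-th mode of the state with PBW key s, acting on v  (Y(a,z) = sum a_(n) z^{-n-1}).
   Since L(-k) b = ((d^{k-2} L)/(k-2)!)_(-1) b, this is the normally ordered
   product formula  (A_(-1) B)_(n) = sum_{j>=0} A_(-1-j) B_(n+j) + sum_{j>=0} B_(n-1-j) A_(j);
   the sums are truncated at a bound beyond which all terms vanish. *)
Fixpoint vmode (s : seq nat) (n : int) (v : V1) {struct s} : V1 :=
  match s with
  | [::] => if n == -1 then v else 0
  | k :: s' =>
    let m := (k - 2)%N in
    let T := (wt1 v + sumn s' + m + `|n| + 2)%N in
    \sum_(j < T) Amode m (-1 - j%:Z) (vmode s' (n + j%:Z) v)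
    + \sum_(j < T) vmode s' (n - 1 - j%:Z) (Amode m j%:Z v)
  end.

Definition umode (u : V1) (n : int) (v : V1) : V1 :=
  \sum_(x <- msupp u) u@_x *: vmode (val x) n v.

Definition V2 := {malg F[(vkey * vkey)%type]}.

Definition tens (a b : V1) : V2 :=
  \sum_(x <- msupp a) \sum_(y <- msupp b) (a@_x * b@_y) *: << (x, y) >>.

Definition on1 (f : V1 -> V1) (v : V2) : V2 :=
  \sum_(p <- msupp v) v@_p *: tens (f << p.1 >>) << p.2 >>.
Definition on2 (f : V1 -> V1) (v : V2) : V2 :=
  \sum_(p <- msupp v) v@_p *: tens << p.1 >> (f << p.2 >>).

Definition vac2 : V2 := tens vac1 vac1.

Definition swap2 (v : V2) : V2 := \sum_(p <- msupp v) v@_p *: << (p.2, p.1) >>.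

Definition L1 (n : int) := on1 (Lop n).
Definition L2 (n : int) := on2 (Lop n).

Definition omega : V2 := L1 (-2) vac2 + L2 (-2) vac2.
Definition w (k : nat) : V2 :=
  L1 (2 - k%:Z) (L1 (-2) vac2) + L2 (2 - k%:Z) (L2 (-2) vac2).

(* Every generator considered is symmetric of the form u (x) 1 + 1 (x) u, u in V_c:
   omega <-> u = L(-2)1, w_k <-> u = L(2-k)L(-2)1. *)
Definition uomega : V1 := Lop (-2) vac1.
Definition uw (k : nat) : V1 := Lop (2 - k%:Z) (Lop (-2) vac1).
Definition sym (u : V1) : V2 := tens u vac1 + tens vac1 u.

(* modes of the field Y(u (x) 1 + 1 (x) u, z) = Y(u,z) (x) 1 + 1 (x) Y(u,z) on V2 *)
Definition gmode (u : V1) (n : int) (v : V2) : V2 := on1 (umode u n) v + on2 (umode u n) v.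

(* normally ordered monomial :d^{i1} a1 ... d^{ir} ar: applied to the vacuum,
   using (d^i a)_(-1) = i! a_(-1-i) *)
Definition nomono (ms : seq (V1 * nat)) : V2 :=
  foldr (fun p acc => (p.2)`!%:R *: gmode p.1 (-1 - (p.2)%:Z) acc) vac2 ms.

Definition strongly_generated (gens : seq V1) : Prop :=
  forall v : V2, swap2 v = v ->
    exists ms : seq (F * seq (V1 * nat)),
      all (fun m => all (fun p => p.1 \in gens) m.2) ms /\
      v = \sum_(m <- ms) m.1 *: nomono m.2.

End Virasoro.

(* Main.v *)
(* Let S be the span of the normally ordered monomials in the given generators.  One shows by
   strong induction on N that the invariants of weight N lie in S.

   Once this is known below weight N, a symmetric field U of weight h < N is a combination of
   monomial fields, since by Dong's lemma and Goddard's uniqueness theorem it is determined by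
   U_(-1) 1; hence its modes map S into S.  Taking for U the field of omega and that of the
   symmetrization of L(-K)L(-l)1 gives three kinds of relations modulo S.  First, a word L(-k1)...L(-kr) moves from one tensor factor to the other with
   reversed order and sign (-1)^r, so that only Z = {x : x (x) 1 + 1 (x) x in S} matters and
   odd words reduce to shorter ones.  Second, products with L(-K)L(-l)1 reduce words of length
   at least four.  Third, L(-1)x is in Z, so all quadratic words are multiples of
   X0 = L(-(N-2))L(-2)1, which vanishes modulo Z for N odd and is in Z when w_N is a generator.

   The difference of two such products with the same quartic part is a multiple of X0 modulo
   Z, and this puts valA * X0 in Z for a scalar valA that equals 47c - 256 when N = 10.  A
   second pair gives a scalar valB, where
     3 valB - (N-10) valA = - c N(N-1)(N-7)(N-8)(N-10)(3N-17) / 160;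
   hence for N >= 12 one of the two scalars is nonzero (for c = 0 it is valA). *)
Require Import Defs.
From HB Require Import structures.
From mathcomp Require Import all_boot all_order all_algebra.
From mathcomp Require Import finmap.
From mathcomp.multinomials Require Import monalg.
From mathcomp Require Import zify ring.
From Stdlib Require Import FunctionalExtensionality IndefiniteDescription.
Set Implicit Arguments. Unset Strict Implicit. Unset Printing Implicit Defensive.
Import Order.TTheory GRing.Theory Num.Theory.
Local Open Scope ring_scope.

(** * Linear algebra *)

(** The definitions give operators by recursion with fuel and by truncated sums, so both the
    Virasoro relations and the properties of fields have to be recovered from them. The relations
    are proved on the PBW basis. Fields are arbitrary families of modes: they are built from the
    fields of the two Virasoro vectors by divided derivatives, linear combinations and normally
    ordered products, and compared through their values on the vacuum. Only the modes of the chosen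
    generators are matched with [umode], and only on basis vectors.

    The quartic words compared in the two pairs are a letter [K >= 2] followed by letters of total
    weight 7 or 8. Relations of this kind therefore start in weights 9 and 10 and say nothing in
    weights 4, 6, 8. In weight 10 the second pair degenerates, because [valB] has the factor
    [N - 10]; only [valA] is left, whence the value 256/47. In every larger even weight [valA] still
    vanishes for one value of [c], which depends on [N]; the second pair takes care of it. *)

Section TrivialExtension.
Context (F : fieldType) (V : lmodType F).

(** The square-zero extension of [F] by [V]: a commutative ring in which [V] is an ideal whose
    products vanish. *)
Definition trivext := (F * V)%type.
HB.instance Definition _ := GRing.Zmodule.on trivext.
Definition trivext_mul (x y : trivext) : trivext := (x.1 * y.1, x.1 *: y.2 + y.1 *: x.2).
Definition trivext_one : trivext := (1, 0).

Lemma trivext_mulC : commutative trivext_mul.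
Proof. by move=> [a v] [b w]; rewrite /trivext_mul /= mulrC addrC. Qed.
Lemma trivext_mulA : associative trivext_mul.
Proof.
move=> [a v] [b w] [d u]; rewrite /trivext_mul /= mulrA !scalerDr !scalerA addrA.
by rewrite [d * a]mulrC [d * b]mulrC.
Qed.
Lemma trivext_mul1 : left_id trivext_one trivext_mul.
Proof. by move=> [a v]; rewrite /trivext_mul /= mul1r scale1r scaler0 addr0. Qed.
Lemma trivext_mulDl : left_distributive trivext_mul +%R.
Proof.
move=> [a v] [b w] [d u]; rewrite /trivext_mul /= mulrDl scalerDl scalerDr.
by rewrite /GRing.add /= /add_pair /= addrACA.
Qed.
Lemma trivext_one_neq0 : trivext_one != 0 :> trivext.
Proof. by apply/eqP => -[] /eqP; rewrite oner_eq0. Qed.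
HB.instance Definition _ := GRing.Zmodule_isComNzRing.Build trivext
  trivext_mulA trivext_mulC trivext_mul1 trivext_mulDl trivext_one_neq0.

Definition vin (v : V) : trivext := (0, v).
Definition scin (a : F) : trivext := (a, 0).
Lemma vin_inj : injective vin. Proof. by move=> u v []. Qed.
Lemma vinD u v : vin (u + v) = vin u + vin v.
Proof. by rewrite /vin -[in LHS](addr0 0). Qed.
Lemma vin0 : vin 0 = 0. Proof. by []. Qed.
Lemma vinN u : vin (- u) = - vin u.
Proof. by rewrite /vin -[in LHS](oppr0). Qed.
Lemma vinMn u n : vin (u *+ n) = vin u *+ n.
Proof. by elim: n => // n IH; rewrite !mulrS vinD IH. Qed.
Lemma vinZ a u : vin (a *: u) = scin a * vin u.
Proof. by congr pair; rewrite ?mulr0 ?scale0r ?addr0. Qed.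
Lemma scin_is_monoid : monoid_morphism scin.
Proof. by split=> // a b; congr pair; rewrite /= !scaler0 addr0. Qed.
Lemma scin_is_additive : zmod_morphism scin.
Proof. by move=> a b; congr pair; rewrite /= subr0. Qed.
HB.instance Definition _ := GRing.isZmodMorphism.Build F trivext scin scin_is_additive.
HB.instance Definition _ := GRing.isMonoidMorphism.Build F trivext scin scin_is_monoid.
Definition vinE := (vinD, vin0, vinN, vinMn, vinZ).
End TrivialExtension.

(* Linear identities in a module become ring identities in the square-zero extension. *)
Ltac lmod := apply: vin_inj; rewrite ?vinE; ring.

Section LinearExtension.
Context (F : fieldType) (K : choiceType).

(** [ext1], [on1], [on2] and [swap2] unfold to sums of this form, so linearity is proved once here
    and transferred to them by conversion. *)
Definition lext (M : lmodType F) (f : K -> M) (v : {malg F[K]}) : M :=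
  \sum_(x <- msupp v) v@_x *: f x.

Lemma lextEw (M : lmodType F) (f : K -> M) v (d : {fset K}) :
  (msupp v `<=` d)%fset -> lext f v = \sum_(x <- d) v@_x *: f x.
Proof.
move=> le; rewrite /lext; apply: big_fset_incl => // x _ /mcoeff_outdom ->.
by rewrite scale0r.
Qed.

Lemma lext_is_linear (M : lmodType F) (f : K -> M) : linear (lext f).
Proof.
move=> a u v; pose d := (msupp u `|` msupp v)%fset.
have hu : (msupp u `<=` d)%fset by exact: fsubsetUl.
have hv : (msupp v `<=` d)%fset by exact: fsubsetUr.
have huv : (msupp (a *: u + v) `<=` d)%fset.
  apply: fsubset_trans (msuppD_le _ _) _; rewrite fsubUset hv andbT.
  exact: fsubset_trans (msuppZ_le _ _) hu.
rewrite (lextEw f hu) (lextEw f hv) (lextEw f huv) scaler_sumr -big_split /=.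
by apply: eq_bigr => x _; rewrite mcoeffD mcoeffZ scalerDl scalerA.
Qed.
HB.instance Definition _ (M : lmodType F) (f : K -> M) :=
  GRing.isLinear.Build F {malg F[K]} M *:%R (lext f) (lext_is_linear f).

Lemma lextU (M : lmodType F) (f : K -> M) k : lext f << k >> = f k.
Proof. by rewrite /lext msuppU oner_eq0 big_seq_fset1 mcoeffUU scale1r. Qed.

Lemma malgEZ (v : {malg F[K]}) : v = \sum_(x <- msupp v) v@_x *: << x >>.
Proof.
rewrite {1}[v]monalgE; apply: eq_bigr => x _.
by apply/malgP => k; rewrite mcoeffZ !mcoeffU mulrnAr mulr1.
Qed.

Lemma eq_lext (M : lmodType F) (f g : K -> M) v :
  {in msupp v, f =1 g} -> lext f v = lext g v.
Proof. by move=> h; apply: eq_big_seq => x /h ->. Qed.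

Lemma eq_lextD (M : lmodType F) (f g : K -> M) v w :
  {in msupp v, f =1 g} -> lext f v + w = lext g v + w.
Proof. by move=> /eq_lext ->. Qed.

Definition supported (P : pred K) (v : {malg F[K]}) := forall x, x \in msupp v -> P x.

Lemma supported0 P : supported P 0. Proof. by move=> x; rewrite msupp0. Qed.

Lemma supportedD P u v : supported P u -> supported P v -> supported P (u + v).
Proof.
move=> hu hv x /(fsubsetP (msuppD_le _ _)); rewrite inE => /orP[/hu|/hv] //.
Qed.

Lemma supportedZ P a v : supported P v -> supported P (a *: v).
Proof. by move=> hv x /(fsubsetP (msuppZ_le _ _)) /hv. Qed.

Lemma supportedU (P : pred K) k : P k -> supported P << k >>.
Proof. by move=> hk x; rewrite msuppU oner_eq0 inE => /eqP ->. Qed.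

Lemma supported_sum P (I : eqType) (r : seq I) (Q : pred I) (G : I -> {malg F[K]}) :
  (forall i, i \in r -> Q i -> supported P (G i)) -> supported P (\sum_(i <- r | Q i) G i).
Proof.
move=> h; rewrite big_seq_cond; elim/big_ind: _ => //.
- exact: supported0.
- by move=> x y; apply: supportedD.
- by move=> i /andP[]; apply: h.
Qed.

Lemma supportedW (P Q : pred K) v : (forall x, P x -> Q x) -> supported P v -> supported Q v.
Proof. by move=> h hv x /hv /h. Qed.

End LinearExtension.

Lemma supported_lext (F : fieldType) (K K' : choiceType) (P : pred K) (Q : pred K')
    (f : K -> {malg F[K']}) (v : {malg F[K]}) :
  supported P v -> (forall x, P x -> supported Q (f x)) -> supported Q (lext f v).
Proof.
move=> hv hf; apply: supported_sum => x xv _; apply: supportedZ; exact: hf (hv _ xv).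
Qed.

(** * The Virasoro relations on the PBW basis *)

Section VirasoroRelation.
Context (F : fieldType) (c : F).

Definition coc (m n : int) : F :=
  if m + n == 0 then c / 12%:R * ((m%:~R) ^+ 3 - m%:~R) else 0.

Lemma coc_anti m n : coc m n = - coc n m.
Proof.
rewrite /coc [n + m]addrC; case: eqP => [h|_]; last by rewrite oppr0.
have -> : n = - m by lia.
by rewrite rmorphN /=; ring.
Qed.

Definition vir_rel (V : lmodType F) (L : int -> V -> V) (m n : int) (v : V) :=
  L m (L n v) = L n (L m v) + (m - n)%:~R *: L (m + n) v + coc m n *: v.

Lemma vir_rel_sym (V : lmodType F) (L : int -> V -> V) m n v :
  vir_rel L m n v -> vir_rel L n m v.
Proof.
rewrite /vir_rel => ->; rewrite (coc_anti m n) [n + m]addrC -(opprB m n) rmorphN /=.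
by lmod.
Qed.

Lemma vir_rel_lin (V : lmodType F) (L : int -> {linear V -> V}) m n a u v :
  vir_rel L m n u -> vir_rel L m n v -> vir_rel L m n (a *: u + v).
Proof.
rewrite /vir_rel !linearP /= => -> ->.
by lmod.
Qed.

Lemma vir_rel_supp (K : choiceType) (L : int -> {linear {malg F[K]} -> {malg F[K]}}) m n v :
  (forall x, x \in msupp v -> vir_rel L m n << x >>) -> vir_rel L m n v.
Proof.
move=> h; rewrite [v]malgEZ big_seq; elim/big_rec: _ => [|x y xv hy].
  by rewrite /vir_rel !linear0 ?scaler0 ?addr0.
exact: vir_rel_lin (h x xv) hy.
Qed.

(* The Jacobi identity: the relations of [L m] and [L n] with [L q] carry their
   commutation relation over from [v] to [L q v]. *)
Lemma vir_rel_jacobi (V : lmodType F) (L : int -> {linear V -> V}) m n q v :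
  (forall m, vir_rel L m q v) -> (forall m n, vir_rel L m n v) ->
  vir_rel L m q (L n v) -> vir_rel L n q (L m v) -> vir_rel L m n (L q v).
Proof.
move=> hq h hm hn; rewrite /vir_rel (hq n) (hq m) !linearD !linearZ /=.
rewrite hm hn (hq (m + n)) (h m n) (h (m + q) n) (h m (n + q)) !linearD !linearZ /=.
rewrite (addrAC m q n) (addrA m n q).
(* The 2-cocycle identity of the Virasoro algebra: the noncentral terms cancel, and this is the
   remaining coefficient of [v]. *)
have E : (m - q)%:~R * coc (m + q) n + (n - q)%:~R * coc m (n + q)
         = (m - n)%:~R * coc (m + n) q.
  rewrite /coc (addrAC m q n) (addrA m n q); case: eqP => [e|_]; last by ring.
  have {e} -> : q = - (m + n) by lia.
  by ring.
apply/eqP; rewrite -subr_eq0; apply/eqP.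
transitivity (((m - q)%:~R * coc (m + q) n + (n - q)%:~R * coc m (n + q)
         - (m - n)%:~R * coc (m + n) q) *: v); last by rewrite E subrr scale0r.
by lmod.
Qed.
End VirasoroRelation.

(** * The operators [Lop]: independence of the fuel, commutation relations, weights *)

Section VirasoroModule.
Context (F : fieldType) (c : F).
Local Notation V1 := (V1 F).
Local Notation mk := (@mk F).
Local Notation ins := (@ins F).
Local Notation insL := (@insL F).

Lemma mkE (x : vkey) : mk (val x) = << x >>.
Proof. by rewrite /mk valK. Qed.

Lemma mkS s (h : valid_key s) : mk s = << Sub s h >>.
Proof. by rewrite /mk insubT. Qed.

Lemma mk0 s : ~~ valid_key s -> mk s = 0.
Proof. by move=> h; rewrite /mk insubN. Qed.

Lemma supported_mk (P : pred (seq nat)) s : P s -> supported (fun x : vkey => P (val x)) (mk s).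
Proof.
move=> hs; case: (boolP (valid_key s)) => h; last by rewrite mk0 //; exact: supported0.
by rewrite (mkS h); apply: supportedU; rewrite SubK.
Qed.

Definition below (m : nat) (s : seq nat) := all (fun i => i <= m)%N s.

Lemma valid_cons k s : valid_key (k :: s) = [&& (2 <= k)%N, below k s & valid_key s].
Proof.
rewrite /valid_key /= path_sortedE; last by move=> a b d h1 h2; exact: leq_trans h2 h1.
rewrite /below (eq_all (a2 := fun i => i <= k)%N) //.
by case: (2 <= k)%N; case: all; case: sorted; case: all.
Qed.

Lemma below_leq m n s : (m <= n)%N -> below m s -> below n s.
Proof. by move=> mn; apply: sub_all => i /leq_trans; apply. Qed.

Lemma insE f k s : ins f.+1 k s =
  match s with
  | [::] => mk [:: k]
  | k1 :: s' =>
    if (k1 <= k)%N then mk (k :: s)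
    else lext (fun t : vkey => ins f k1 (val t)) (ins f k s')
         + (k1 - k)%N%:R *: mk ((k + k1)%N :: s')
  end.
Proof. by []. Qed.

#[local] Opaque Defs.ins Defs.mk lext.

(** The invariant of the straightening recursion. A term of [L(-k) s] is no longer than [s], or it
    has one more letter and all its letters are bounded by the larger of [k] and the head of [s]. A
    term of the second kind accepts a letter at least as large in front without further
    straightening. *)
Definition ins_shape k s (x : seq nat) :=
  (size x <= size s)%N || ((size x <= (size s).+1)%N && below (maxn k (head 0%N s)) x).

(** Fuel above the length of the key is enough, although the recursion is nested. The outer call
    inserts [k1] into the terms of [L(-k) s]: those no longer than [s] fall under the induction on
    length, and the longer ones have letters at most [k1], so that a single step finishes. *)
Lemma ins_stable r f1 f2 k s : (size s <= r)%N -> valid_key s ->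
  (size s < f1)%N -> (size s < f2)%N ->
  ins f1 k s = ins f2 k s /\ supported (fun x : vkey => ins_shape k s (val x)) (ins f1 k s).
Proof.
have base g1 g2 j : (0 < g1)%N -> (0 < g2)%N -> ins g1 j [::] = ins g2 j [::] /\
    supported (fun x : vkey => ins_shape j [::] (val x)) (ins g1 j [::]).
  case: g1 => // g1 _; case: g2 => // g2 _; rewrite !insE; split; first by [].
  by apply: (@supported_mk (ins_shape j [::])); rewrite /ins_shape /= maxn0 leqnn.
elim: r f1 f2 k s => [|r IH] f1 f2 k [|k1 s] hr hv h1 h2.
- exact: base.
- by move: hr; rewrite ltn0.
- exact: base.
- case: f1 h1 => [|f1] h1; first by rewrite ltn0 in h1.
  case: f2 h2 => [|f2] h2; first by rewrite ltn0 in h2.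
  rewrite /= !ltnS in hr h1 h2.
  move: (hv); rewrite valid_cons => /and3P[k12 bs vs].
  rewrite !insE; case: leqP => hk.
    split; first by [].
    apply: (@supported_mk (ins_shape k (k1 :: s))).
    rewrite /ins_shape /= !leqnn /= (maxn_idPl hk) leqnn hk /=.
    by rewrite (below_leq hk bs) /= orbT.
  have [e sh] := IH f1 f2 k s hr vs h1 h2.
  have step f f' (t : vkey) : (size s < f)%N -> (size s < f')%N -> ins_shape k s (val t) ->
      ins f k1 (val t) = ins f' k1 (val t) /\
      supported (fun x : vkey => ins_shape k (k1 :: s) (val x)) (ins f k1 (val t)).
    move=> hf hf'; case/orP=> [st|/andP[st bt]].
      have [e1 sh1] := IH f f' k1 (val t) (leq_trans st hr) (valP t)
         (leq_ltn_trans st hf) (leq_ltn_trans st hf').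
      split; first exact: e1.
      apply: supportedW sh1 => x; rewrite /ins_shape /=.
      case/orP=> [h|/andP[h _]]; first by rewrite (leq_trans h) // ltnW.
      by rewrite (leq_trans h).
    have bt1 : below k1 (val t).
      apply: below_leq bt; rewrite geq_max (ltnW hk) /=.
      by case: (s) bs => //= a l /andP[].
    have top g : (0 < g)%N -> ins g k1 (val t) = mk (k1 :: val t).
      case: g => // g _; rewrite insE; move: bt1; case: (val t) => // a l /andP[ha _].
      by rewrite ha.
    rewrite !top; try by apply: leq_ltn_trans; [exact: leq0n|eassumption].
    split; first by [].
    apply: (@supported_mk (ins_shape k (k1 :: s))); rewrite /ins_shape /= !ltnS st.
    by rewrite (maxn_idPr (ltnW hk)) leqnn bt1 orbT.
  split.
    have -> : lext (fun t : vkey => ins f1 k1 (val t)) (ins f1 k s)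
            = lext (fun t : vkey => ins f2 k1 (val t)) (ins f1 k s); last by rewrite e.
    apply: eq_lext => t ht; exact: (proj1 (step f1 f2 t h1 h2 (sh _ ht))).
  apply: supportedD.
    apply: supported_lext sh _ => t ht; exact: (proj2 (step f1 f2 t h1 h2 ht)).
  apply: supportedZ; apply: (@supported_mk (ins_shape k (k1 :: s))).
  by rewrite /ins_shape /= leqnn.
Qed.

Lemma valid_size s : valid_key s -> (size s <= sumn s)%N.
Proof.
elim: s => //= k s IH; rewrite valid_cons => /and3P[k2 _ /IH h].
by rewrite -add1n leq_add // ltnW.
Qed.

Lemma insL_fuel f k s : valid_key s -> (size s < f)%N -> insL k s = ins f k s.
Proof.
move=> hv hf; apply: (proj1 (@ins_stable (size s) _ _ k s (leqnn _) hv _ hf)).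
have h := valid_size hv; rewrite -mulnn; nia.
Qed.

Lemma insLE k s : insL k s = ins ((k + sumn s).+1 ^ 2) k s. Proof. by []. Qed.

#[local] Opaque Defs.insL.

Lemma insL_shape k s : valid_key s ->
  supported (fun x : vkey => ins_shape k s (val x)) (insL k s).
Proof.
move=> hv; rewrite (insL_fuel k hv (leqnn _)).
exact: (proj2 (@ins_stable (size s) _ _ k s (leqnn _) hv (leqnn _) (leqnn _))).
Qed.

Lemma insL_top k s : valid_key s -> below k s -> insL k s = mk (k :: s).
Proof.
move=> hv; rewrite (insL_fuel k hv (leqnn _)).
by rewrite insE; case: s hv => // a l _ /andP[ha _]; rewrite ha.
Qed.

Lemma insL_straighten k k1 s : valid_key (k1 :: s) -> (k < k1)%N ->
  insL k (k1 :: s) = lext (fun t : vkey => insL k1 (val t)) (insL k s)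
                     + (k1 - k)%N%:R *: mk ((k + k1)%N :: s).
Proof.
move=> hv hk; move: (hv); rewrite valid_cons => /and3P[k12 bs vs].
rewrite (@insL_fuel (size s).+3 k _ hv) // insE ifN; last by rewrite -ltnNge.
rewrite -(@insL_fuel (size s).+2 k s vs); last by rewrite ltnS leqnSn.
apply: eq_lextD => t.
move=> /(insL_shape vs) ht; rewrite (@insL_fuel (size s).+2 _ _ (valP t)) // ltnS.
by case/orP: ht => [/leq_trans -> //|/andP[]].
Qed.

Lemma LopE n v : Lop c n v =
  lext (fun x : vkey => if n <= -2 then insL `|n|%N (val x) else ann c (val x) n) v.
Proof. by []. Qed.

Lemma Lop_is_linear n : linear (Lop c n). Proof. exact: lext_is_linear. Qed.
HB.instance Definition _ n :=
  GRing.isLinear.Build F V1 V1 *:%R (Lop c n) (Lop_is_linear n).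

Lemma Lop_mk n s : valid_key s ->
  Lop c n (mk s) = if n <= -2 then insL `|n|%N s else ann c s n.
Proof. by move=> h; rewrite (mkS h) LopE lextU SubK. Qed.

Lemma Lop_top k s : valid_key (k :: s) -> Lop c (- k%:Z) (mk s) = mk (k :: s).
Proof.
rewrite valid_cons => /and3P[k2 b vs]; rewrite Lop_mk // ifT; last by lia.
by rewrite (_ : `|- k%:Z|%N = k) ?insL_top //; lia.
Qed.

Lemma lext_insL k v : (2 <= k)%N -> lext (fun t : vkey => insL k (val t)) v = Lop c (- k%:Z) v.
Proof.
move=> k2; rewrite LopE; apply: eq_lext => t _.
rewrite ifT; last by lia.
by rewrite (_ : `|- k%:Z|%N = k) //; lia.
Qed.

Lemma ann_cons k s m : ann c (k :: s) m =
    lext (fun t : vkey => insL k (val t)) (ann c s m)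
    + (m + k%:Z)%:~R *: (if m - k%:Z <= -2 then insL `|m - k%:Z|%N s else ann c s (m - k%:Z))
    + (if m == k%:Z then c / 12%:R * ((m%:~R : F) ^+ 3 - m%:~R) else 0) *: mk s.
Proof. by []. Qed.

#[local] Opaque Defs.ann Defs.Lop.

Fact straighten_cancel (V : lmodType F) (x y : V) (n : nat) :
  x = x + n%:R *: y + (- n%:Z)%:~R *: y.
Proof. by lmod. Qed.

(** When [q] may stand in front of [s], the relation is the defining recursion itself: that of [ann]
    for [m >= -1], that of [ins] for [m = -k] with [2 <= k < q], and for [k > q] the recursion of
    [ins] with the two letters exchanged. *)
Lemma Lop_top_rel m q s : valid_key (q :: s) -> vir_rel c (Lop c) m (- q%:Z) (mk s).
Proof.
move=> vq; move: (vq); rewrite valid_cons => /and3P[q2 b vs].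
case: (lerP m (-2)) => hm; last first.
  have E1 : ann c s m = Lop c m (mk s) by rewrite (Lop_mk m vs) ifF //; lia.
  rewrite /vir_rel (Lop_top vq) (Lop_mk m vq) ifF; last by lia.
  rewrite ann_cons (lext_insL _ q2) -(Lop_mk (m - q%:Z) vs) E1.
  by rewrite opprK /coc subr_eq0.
have [k mk2 k2] : exists2 k : nat, m = - k%:Z & (2 <= k)%N.
  by exists `|m|%N; lia.
have cz : coc c m (- q%:Z) = 0.
  by rewrite /coc ifF //; lia.
rewrite {}mk2 in hm cz *.
rewrite /vir_rel (Lop_top vq) cz scale0r addr0.
case: (ltngtP k q) => kq.
- rewrite (Lop_mk _ vq) ifT; last by lia.
  rewrite (_ : `|- k%:Z|%N = k); last by lia.
  have E1 : insL k s = Lop c (- k%:Z) (mk s).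
    rewrite (Lop_mk _ vs) ifT; last by lia.
    by rewrite (_ : `|- k%:Z|%N = k); last by lia.
  rewrite (insL_straighten vq kq) (lext_insL _ q2) E1.
  have -> : - k%:Z - - q%:Z = (q - k)%N%:Z by lia.
  have -> : - k%:Z - q%:Z = - (k + q)%N%:Z by lia.
  rewrite (@Lop_top (k + q) s).
    by rewrite pmulrn.
  rewrite valid_cons vs andbT; apply/andP; split; first by lia.
  by apply: below_leq b; lia.
- have vk : valid_key (k :: q :: s).
    by rewrite valid_cons k2 vq /= (ltnW kq) (below_leq (ltnW kq) b).
  have vk' : valid_key (k :: s).
    by move: vk; rewrite !valid_cons /= => /and3P[_ /andP[_ ->] /and3P[_ _ ->]]; rewrite k2.
  rewrite (Lop_top vk) (Lop_top vk') (Lop_mk _ vk') ifT; last by lia.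
  rewrite (_ : `|- q%:Z|%N = q); last by lia.
  rewrite (insL_straighten vk' kq) (lext_insL _ k2) (insL_top vs b).
  rewrite (Lop_top vk).
  have -> : - k%:Z - - q%:Z = - (k - q)%N%:Z by lia.
  have -> : - k%:Z - q%:Z = - (q + k)%N%:Z by lia.
  rewrite (@Lop_top (q + k) s); last first.
    rewrite valid_cons vs andbT; apply/andP; split; first by lia.
    by apply: below_leq b; lia.
  move: (mk (k :: q :: s)) (mk ((q + k)%N :: s)) => X Y.
  exact: straighten_cancel.
- by rewrite kq (Lop_top vq) subrr scale0r addr0.
Qed.

Lemma vir_rel_supported m n v (P : pred vkey) :
  (forall x : vkey, P x -> vir_rel c (Lop c) m n << x >>) -> supported P v ->
  vir_rel c (Lop c) m n v.
Proof.
by move=> h hv; apply: (@vir_rel_supp _ c _ (fun n => Lop c n)) => x /hv /h.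
Qed.

(* Annihilators do not lengthen a monomial, and creation operators lengthen it by at
   most one; only the top-length part can have its head beyond the letters at hand. *)
Lemma supported_ann s (m : int) : valid_key s -> -1 <= m ->
  supported (fun x : vkey => (size (val x) <= size s)%N) (ann c s m).
Proof.
elim: s m => [|k s IH] m hv hm; first exact: supported0.
move: (hv); rewrite valid_cons => /and3P[k2 b vs].
have sz n (t : seq nat) : valid_key t -> (size t <= size s)%N ->
    supported (fun x : vkey => (size (val x) <= size (k :: s))%N) (insL n t).
  move=> vt ht; have := @insL_shape n t vt; apply: supportedW => x.
  rewrite /ins_shape /= => /orP[h|/andP[h _]]; apply: leq_trans h _.
    exact: leq_trans ht (leqnSn _).
  by rewrite ltnS.
rewrite ann_cons; apply: supportedD; first apply: supportedD.
- apply: supported_lext (IH m vs hm) _ => t ht; exact: sz (valP t) ht.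
- apply: supportedZ; case: ifP => h; first exact: sz.
  have h' : -1 <= m - k%:Z by lia.
  have := IH (m - k%:Z) vs h'; apply: supportedW => x hx.
  exact: leq_trans hx (leqnSn _).
- apply: supportedZ; apply: (@supported_mk (fun t => size t <= (size s).+1)%N).
  exact: leqnSn.
Qed.

Lemma Lop_vac (n : int) : -1 <= n -> Lop c n (mk [::]) = 0.
Proof. by move=> hn; rewrite Lop_mk // ifF //; lia. Qed.

Lemma Lop_vir_vac m n : vir_rel c (Lop c) m n (mk [::]).
Proof.
have neg a b : a <= -2 -> vir_rel c (Lop c) b a (mk [::]).
  move=> ha; have -> : a = - (`|a|%N)%:Z by lia.
  by apply: Lop_top_rel; rewrite valid_cons /= andbT; lia.
case: (lerP n (-2)) => hn; first exact: neg.
case: (lerP m (-2)) => hm; first by apply: vir_rel_sym; exact: neg.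
rewrite /vir_rel (@Lop_vac n) ?(@Lop_vac m) ?linear0; try lia.
have -> : coc c m n = 0.
  rewrite /coc; case: eqP => // e.
  have : (m == -1) || (m == 0) || (m == 1) by lia.
  by case/orP=> [/orP[]|] /eqP ->; ring.
rewrite add0r scale0r addr0; case: (lerP (-1) (m + n)) => h.
  by rewrite Lop_vac ?scaler0.
by have -> : m - n = 0; [lia|rewrite scale0r].
Qed.

(** The dichotomy that feeds the Jacobi argument: a term is short enough for the induction on
    length, or [q] may be put in front of it. *)
Lemma Lop_shape n q s : valid_key (q :: s) -> - q%:Z < n ->
  supported (fun x : vkey => (size (val x) <= size s)%N || below q (val x)) (Lop c n (mk s)).
Proof.
rewrite valid_cons => /and3P[q2 b vs] hn; rewrite (Lop_mk _ vs); case: ifP => h.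
  have := @insL_shape `|n|%N s vs; apply: supportedW => x.
  rewrite /ins_shape => /orP[-> //|/andP[_ bx]]; apply/orP; right.
  apply: below_leq bx; rewrite geq_max; apply/andP; split; first by lia.
  by case: (s) b => //= a l /andP[].
have h' : -1 <= n by lia.
by have := supported_ann vs h'; apply: supportedW => x ->.
Qed.

(** Induction on length. On a key [q :: s], an index at most [-q] is a letter that may go in front,
    and [Lop_top_rel] applies. For two larger indices the Jacobi identity carries the relation over
    from [s]; it asks for the relations with [L(-q)] on [L(n) s] and [L(m) s], which [Lop_shape]
    reduces to shorter keys or to [Lop_top_rel]. *)
Lemma Lop_vir_key r m n (x : vkey) : (size (val x) <= r)%N -> vir_rel c (Lop c) m n << x >>.
Proof.
elim: r m n x => [|r IH] m n x; rewrite -mkE.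
  by case: (val x) => // _; exact: Lop_vir_vac.
move: (valP x); case: (val x) => [|q s] vq hs; first exact: Lop_vir_vac.
move: (vq); rewrite valid_cons => /and3P[q2 b vs].
have big a b' : a <= - q%:Z -> vir_rel c (Lop c) b' a (mk (q :: s)).
  move=> ha; have -> : a = - (`|a|%N)%:Z by lia.
  apply: Lop_top_rel; rewrite valid_cons vq /= andbT.
  have hb : (q <= `|a|)%N by lia.
  by rewrite (below_leq hb b) hb andbT; lia.
case: (lerP n (- q%:Z)) => hn; first exact: big.
case: (lerP m (- q%:Z)) => hm; first by apply: vir_rel_sym; exact: big.
have IHs a b' : vir_rel c (Lop c) a b' (mk s).
  by rewrite (mkS vs); apply: IH; rewrite SubK.
have step a b' : - q%:Z < b' -> vir_rel c (Lop c) a (- q%:Z) (Lop c b' (mk s)).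
  move=> hb; apply: (vir_rel_supported _ (Lop_shape vq hb)) => y /orP[hy|by'].
    by apply: IH; exact: leq_trans hy hs.
  by rewrite -mkE; apply: Lop_top_rel; rewrite valid_cons q2 by' valP.
rewrite -(Lop_top vq); apply: (@vir_rel_jacobi _ c _ (fun n => Lop c n)).
- by move=> a; exact: Lop_top_rel.
- by move=> a b'; exact: IHs.
- exact: step.
- exact: step.
Qed.

Lemma Lop_vir m n v : vir_rel c (Lop c) m n v.
Proof.
apply: (@vir_rel_supp _ c _ (fun n => Lop c n)) => x _; exact: Lop_vir_key (leqnn _).
Qed.

Definition hw1 (N : int) (v : V1) := supported (fun x : vkey => (sumn (val x))%:Z == N) v.

Lemma hw1_ins f k s : supported (fun x : vkey => sumn (val x) == k + sumn s)%N (ins f k s).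
Proof.
elim: f k s => [|f IH] k s; first exact: supported0.
rewrite insE; case: s => [|k1 s].
  by apply: (@supported_mk (fun t => sumn t == k + sumn [::])%N).
case: ifP => h; first by apply: (@supported_mk (fun t => sumn t == k + sumn (k1 :: s))%N).
apply: supportedD.
  apply: supported_lext (IH k s) _ => t /eqP ht.
  have := IH k1 (val t); apply: supportedW => x /eqP ->; rewrite ht /=; lia.
apply: supportedZ; apply: (@supported_mk (fun t => sumn t == k + sumn (k1 :: s))%N).
by rewrite /=; lia.
Qed.

Lemma sumn_cons k s : sumn (k :: s) = (k + sumn s)%N. Proof. by []. Qed.

Lemma hw1_ann s (m : int) : valid_key s -> -1 <= m -> hw1 ((sumn s)%:Z - m) (ann c s m).
Proof.
elim: s m => [|k s IH] m hv hm; first exact: supported0.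
move: (hv); rewrite valid_cons => /and3P[k2 b vs].
have hins a t : hw1 (a + sumn t)%N (insL a t).
  rewrite /hw1 insLE; have := @hw1_ins ((a + sumn t).+1 ^ 2) a t; apply: supportedW => x /eqP ->.
  exact: eqxx.
rewrite ann_cons; apply: supportedD; first apply: supportedD.
- apply: supported_lext (IH m vs hm) _ => t /eqP ht.
  have := hins k (val t); apply: supportedW => x /eqP ->; rewrite sumn_cons !PoszD ht; apply/eqP; lia.
- apply: supportedZ; case: ifP => h.
    have := hins `|m - k%:Z|%N s; apply: supportedW => x /eqP ->; rewrite ?sumn_cons; lia.
  have h' : -1 <= m - k%:Z by lia.
  have := IH (m - k%:Z) vs h'; apply: supportedW => x /eqP ->; rewrite ?sumn_cons; lia.
- case: eqP => e; last by rewrite scale0r; exact: supported0.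
  apply: supportedZ; apply: (@supported_mk (fun t => (sumn t)%:Z == (sumn (k :: s))%:Z - m)).
  by rewrite e sumn_cons; lia.
Qed.

Lemma hw1_Lop N n v : hw1 N v -> hw1 (N - n) (Lop c n v).
Proof.
move=> hv; rewrite LopE; apply: supported_lext hv _ => t /eqP ht; case: ifP => h.
  rewrite insLE; have := @hw1_ins ((`|n| + sumn (val t)).+1 ^ 2)%N `|n|%N (val t).
  apply: supportedW => x /eqP ->; rewrite PoszD ht; apply/eqP; lia.
have h' : -1 <= n by lia.
by have := hw1_ann (valP t) h'; apply: supportedW => x /eqP ->; rewrite ht; apply/eqP; lia.
Qed.

Lemma hw1_neg N v : hw1 N v -> N < 0 -> v = 0.
Proof.
move=> hv hN; apply/malgP => x; rewrite mcoeff0; apply: mcoeff_outdom.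
by apply/negP => /hv /eqP; lia.
Qed.

End VirasoroModule.

(** * Locality, normally ordered products and uniqueness of fields *)

Section Fields.
Context (F : fieldType) (V : lmodType F).

(** Infinite mode sums that are finite on each vector are expressed by their partial sums. Finitely
    many such statements hold for a common cutoff, so identities are proved for finite sums. *)
Definition eventually (P : nat -> Prop) := exists T0, forall T, (T0 <= T)%N -> P T.

Lemma eventuallyI P Q : eventually P -> eventually Q -> eventually (fun T => P T /\ Q T).
Proof.
move=> [a ha] [b hb]; exists (maxn a b) => T; rewrite geq_max => /andP[h1 h2].
by split; [exact: ha | exact: hb].
Qed.

Lemma eventuallyW (P Q : nat -> Prop) : (forall T, P T -> Q T) -> eventually P -> eventually Q.
Proof. by move=> h [a ha]; exists a => T /ha /h. Qed.

Lemma eventually_inst P : eventually P -> exists T, P T.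
Proof. by move=> [a ha]; exists a; exact: ha. Qed.

Lemma eventually_all P : (forall T, P T) -> eventually P.
Proof. by move=> h; exists 0%N => T _. Qed.

Definition field := int -> V -> V.

Definition flinear (A : field) := forall n, linear (A n).
Definition truncated (A : field) := forall v, exists n0 : int, forall n, n0 <= n -> A n v = 0.

Section Lin.
Context (A : field) (hA : flinear A).
Lemma fieldD n u v : A n (u + v) = A n u + A n v.
Proof. by have := hA n 1 u v; rewrite !scale1r. Qed.
Lemma field0 n : A n 0 = 0.
Proof. by apply: (addrI (A n 0)); rewrite -fieldD !addr0. Qed.
Lemma fieldZ n a v : A n (a *: v) = a *: A n v.
Proof. by have := hA n a v 0; rewrite field0 !addr0. Qed.
Lemma fieldN n v : A n (- v) = - A n v.
Proof. by rewrite -scaleN1r fieldZ scaleN1r. Qed.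
Lemma fieldB n u v : A n (u - v) = A n u - A n v.
Proof. by rewrite fieldD fieldN. Qed.
Lemma field_sum n (I : Type) (r : seq I) P (E : I -> V) :
  A n (\sum_(i <- r | P i) E i) = \sum_(i <- r | P i) A n (E i).
Proof. by elim/big_rec2: _ => [|i x y _ <-]; rewrite ?field0 ?fieldD. Qed.
End Lin.

(* The coefficients of [(x - y) h(x, y)], where [h(x, y) = \sum h m n x^(-m-1) y^(-n-1)]. *)
Definition dif (h : int -> int -> V) : int -> int -> V :=
  fun m n => h (m + 1) n - h m (n + 1).

Definition comm2 (A B : field) v : int -> int -> V :=
  fun m n => A m (B n v) - B n (A m v).

Definition local (A B : field) :=
  exists N, forall v m n, iter N dif (comm2 A B v) m n = 0.

Lemma fext2 (f g : int -> int -> V) : (forall m n, f m n = g m n) -> f = g.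
Proof. by move=> h; do 2! apply: functional_extensionality => ?; exact: h. Qed.

Lemma fext3 (f g : int -> int -> int -> V) : (forall m n p, f m n p = g m n p) -> f = g.
Proof. by move=> h; do 3! apply: functional_extensionality => ?; exact: h. Qed.

Lemma iter_dif0 N h : (forall m n, h m n = 0) -> forall m n, iter N dif h m n = 0.
Proof. by elim: N => //= N IH hh m n; rewrite /dif !(IH hh) subrr. Qed.

Lemma iter_dif_leq N M h : (N <= M)%N -> (forall m n, iter N dif h m n = 0) ->
  forall m n, iter M dif h m n = 0.
Proof.
by move=> NM h0; rewrite -(subnK NM) iterD; exact: iter_dif0.
Qed.

Lemma iter_dif_lin N a h g m n :
  iter N dif (fun m n => a *: h m n + g m n) m n = a *: iter N dif h m n + iter N dif g m n.
Proof. by elim: N m n => //= N IH m n; rewrite /dif !IH; lmod. Qed.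

Lemma iter_dif_swap N h m n :
  iter N dif (fun m n => h n m) m n = (-1) ^+ N *: iter N dif h n m.
Proof.
elim: N m n => [|N IH] m n /=; first by rewrite expr0 scale1r.
by rewrite /dif !IH exprS; lmod.
Qed.

(** The Leibniz rule for [(x - y)^N] and a derivative in [x]. One power of [x - y] is lost, hence
    the order [N + 1] in [local_der]. *)
Lemma iter_dif_mul N h m n :
  iter N dif (fun m n => m%:~R *: h m n) m n
  = m%:~R *: iter N dif h m n + N%:R *: iter N.-1 dif h (m + 1) n.
Proof.
elim: N m n => [|N IH] m n /=; first by rewrite scale0r addr0.
rewrite /dif !IH; case: N {IH} => [|N] /=; first by lmod.
rewrite /dif; lmod.
Qed.

Lemma iter_dif_shift N h m n :
  iter N dif (fun m n => h (m - 1) n) m n = iter N dif h (m - 1) n.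
Proof. by elim: N m n => //= N IH m n; rewrite /dif !IH addrAC. Qed.

Lemma local_sym A B : local A B -> local B A.
Proof.
move=> [N hN]; exists N => v m n.
have -> : comm2 B A v = (fun m n => -1 *: (fun m n => comm2 A B v n m) m n + 0).
  by apply: fext2 => p q; rewrite /comm2 /= scaleN1r addr0 opprB.
rewrite iter_dif_lin iter_dif_swap hN !scaler0 add0r; exact: iter_dif0.
Qed.

Definition flin a (A B : field) : field := fun n v => a *: A n v + B n v.
Definition fzero : field := fun _ _ => 0.
Definition fid : field := fun n v => if n == -1 then v else 0.

Lemma local_lin a A B C : flinear C -> local A C -> local B C -> local (flin a A B) C.
Proof.
move=> hC [N hN] [M hM]; exists (maxn N M) => v m n.
have -> : comm2 (flin a A B) C v = (fun m n => a *: comm2 A C v m n + comm2 B C v m n).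
  by apply: fext2 => p q; rewrite /comm2 /flin fieldD // fieldZ //; lmod.
rewrite iter_dif_lin (iter_dif_leq (leq_maxl _ _) (hN v)).
by rewrite (iter_dif_leq (leq_maxr _ _) (hM v)) scaler0 addr0.
Qed.

Lemma local0 C : flinear C -> local fzero C.
Proof. by move=> hC; exists 0%N => v m n; rewrite /= /comm2 /fzero field0 // subrr. Qed.

Lemma local_id C : flinear C -> local fid C.
Proof.
move=> hC; exists 0%N => v m n; rewrite /= /comm2 /fid.
by case: ifP => _; rewrite ?field0 // subrr.
Qed.

Definition fder (A : field) : field := fun n v => (- n)%:~R *: A (n - 1) v.

Lemma local_der A B : flinear B -> local A B -> local (fder A) B.
Proof.
move=> hB [N hN]; exists N.+1 => v m n.
have -> : comm2 (fder A) B v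
  = (fun m n => -1 *: (fun m n => m%:~R *: (fun m n => comm2 A B v (m - 1) n) m n) m n + 0).
  by apply: fext2 => p q; rewrite /comm2 /fder fieldZ //; lmod.
rewrite iter_dif_lin iter_dif_mul !(@iter_dif_shift _ (comm2 A B v)) (hN v).
rewrite (iter_dif_leq (leqnSn _) (hN v)) !scaler0 addr0 scaler0 add0r.
exact: iter_dif0.
Qed.

(** * Dong's lemma in three formal variables *)

Section Dong.

(** The indices [p], [q], [n] belong to the variables [x], [y], [z] of three fields [A(x)], [B(y)],
    [J(z)]; the operators are multiplications by [x - y], [x - z], [y - z]. *)
Definition dxy (f : int -> int -> int -> V) := fun p q n => f (p + 1) q n - f p (q + 1) n.
Definition dxz (f : int -> int -> int -> V) := fun p q n => f (p + 1) q n - f p q (n + 1).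
Definition dyz (f : int -> int -> int -> V) := fun p q n => f p (q + 1) n - f p q (n + 1).

Lemma dxyzC f : dxy (dxz f) = dxz (dxy f).
Proof. by apply: fext3 => p q n; rewrite /dxy /dxz; lmod. Qed.
Lemma dxyyzC f : dxy (dyz f) = dyz (dxy f).
Proof. by apply: fext3 => p q n; rewrite /dxy /dyz; lmod. Qed.
Lemma dxzyzC f : dxz (dyz f) = dyz (dxz f).
Proof. by apply: fext3 => p q n; rewrite /dxz /dyz; lmod. Qed.

Lemma iterC (T : Type) (f g : T -> T) a b x : (forall x, f (g x) = g (f x)) ->
  iter a f (iter b g x) = iter b g (iter a f x).
Proof.
move=> h; elim: a x => //= a IH x; rewrite IH.
by elim: b (iter a f x) {IH} => //= b IH' y; rewrite h IH'.
Qed.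

Definition dmon a b k f := iter a dxz (iter b dxy (iter k dyz f)).

Lemma dmonS a b k f : dmon a b k.+1 f = (fun p q n => dmon a.+1 b k f p q n - dmon a b.+1 k f p q n).
Proof.
set R := RHS; rewrite /dmon iterSr.
have lin D b' : (forall f1 f2, D (fun p q n => f1 p q n - f2 p q n) = (fun p q n => D f1 p q n - D f2 p q n)) ->
   forall f1 f2 : int -> int -> int -> V, iter b' D (fun p q n => f1 p q n - f2 p q n) =
     (fun p q n => iter b' D f1 p q n - iter b' D f2 p q n).
  by move=> hD; elim: b' => //= b' IH f1 f2; rewrite IH hD.
have -> : dyz f = (fun p q n => dxz f p q n - dxy f p q n).
  by apply: fext3 => p q n; rewrite /dxz /dxy /dyz; lmod.
rewrite (lin dyz); last by move=> f1 f2; apply: fext3 => p q n; rewrite /dyz; lmod.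
rewrite (lin dxy) ?(lin dxz); try by move=> f1 f2; apply: fext3 => p q n; rewrite /dxy /dxz; lmod.
have e1 : iter k dyz (dxz f) = dxz (iter k dyz f).
  by apply: (iterC k 1 f) => x; rewrite dxzyzC.
have e2 : iter k dyz (dxy f) = dxy (iter k dyz f).
  by apply: (iterC k 1 f) => x; rewrite dxyyzC.
have e3 : iter b dxy (dxz (iter k dyz f)) = dxz (iter b dxy (iter k dyz f)).
  by apply: (iterC b 1 (iter k dyz f)) => x; rewrite dxyzC.
by rewrite e1 e2 e3 /R /dmon !iterSr.
Qed.

(** The truncated normally ordered product, with [f] in the place of [A(x)B(y)] and [g] in that of
    [B(y)A(x)]. It amounts to a residue in [x] against the two expansions of [1/(x - y)]. *)
Definition rsum T (f g : int -> int -> int -> V) (q n : int) : V :=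
  \sum_(j < T) f (-1 - j%:Z) (q + j%:Z) n + \sum_(j < T) g j%:Z (q - 1 - j%:Z) n.

Definition rzero f g := forall q n, eventually (fun T => rsum T f g q n = 0).

Definition finq (f : int -> int -> int -> V) :=
  forall n, exists q0 : int, forall p q, q0 <= q -> f p q n = 0.
Definition finp (f : int -> int -> int -> V) :=
  forall n, exists p0 : int, forall p q, p0 <= p -> f p q n = 0.

Lemma fin_dmon a b k f : (finq f -> finq (dmon a b k f)) /\ (finp f -> finp (dmon a b k f)).
Proof.
have H (D : (int -> int -> int -> V) -> int -> int -> int -> V) :
    (forall f (p q n : int), f (p + 1) q n = 0 -> f p (q + 1) n = 0 -> f p q (n + 1) = 0 ->
       f p q n = 0 -> D f p q n = 0) -> forall f i,
    (finq f -> finq (iter i D f)) /\ (finp f -> finp (iter i D f)).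
  move=> hD {}f; elim=> //= i [IHq IHp]; split.
    move=> /IHq h n; have [q1 h1] := h n; have [q2 h2] := h (n + 1).
    exists (Num.max q1 q2) => p q; rewrite ge_max => /andP[hq1 hq2].
    by apply: hD; [apply: h1|apply: h1|apply: h2|apply: h1]; lia.
  move=> /IHp h n; have [q1 h1] := h n; have [q2 h2] := h (n + 1).
  exists (Num.max q1 q2) => p q; rewrite ge_max => /andP[hq1 hq2].
  by apply: hD; [apply: h1|apply: h1|apply: h2|apply: h1]; lia.
have Hxy := H dxy; have Hxz := H dxz; have Hyz := H dyz.
have {}Hxy := Hxy (fun f p q n e1 e2 _ _ => etrans (congr2 (fun x y => x - y) e1 e2) (subrr 0)).
have {}Hxz := Hxz (fun f p q n e1 _ e2 _ => etrans (congr2 (fun x y => x - y) e1 e2) (subrr 0)).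
have {}Hyz := Hyz (fun f p q n _ e1 e2 _ => etrans (congr2 (fun x y => x - y) e1 e2) (subrr 0)).
rewrite /dmon; split=> h.
  by apply: (proj1 (Hxz _ _)); apply: (proj1 (Hxy _ _)); apply: (proj1 (Hyz _ _)).
by apply: (proj2 (Hxz _ _)); apply: (proj2 (Hxy _ _)); apply: (proj2 (Hyz _ _)).
Qed.

(** The factor [x - y] cancels the kernel [1/(x - y)]: both sums telescope, the far ends vanish by
    truncation, and [f 0 q n - g 0 q n] is left. *)
Lemma rzero_dxy f g : finq f -> finp g -> (forall q n, f 0 q n = g 0 q n) ->
  rzero (dxy f) (dxy g).
Proof.
move=> hf hg e q n; have [q0 h0] := hf n; have [p0 h1] := hg n.
exists (`|q0| + `|q| + `|p0|)%N => T hT; rewrite /rsum /dxy.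
have -> : \sum_(j < T) (f (-1 - j%:Z + 1) (q + j%:Z) n - f (-1 - j%:Z) (q + j%:Z + 1) n)
        = f 0 q n - f (- T%:Z) (q + T%:Z) n.
  elim: T {hT} => [|T IH]; first by rewrite big_ord0 addr0 oppr0 subrr.
  rewrite big_ord_recr /= IH.
  have -> : -1 - T%:Z + 1 = - T%:Z by lia.
  have -> : -1 - T%:Z = - T.+1%:Z by lia.
  have -> : q + T%:Z + 1 = q + T.+1%:Z by lia.
  by lmod.
have -> : \sum_(j < T) (g (j%:Z + 1) (q - 1 - j%:Z) n - g j%:Z (q - 1 - j%:Z + 1) n)
        = g T%:Z (q - T%:Z) n - g 0 q n.
  elim: T {hT} => [|T IH]; first by rewrite big_ord0 subr0 subrr.
  rewrite big_ord_recr /= IH.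
  have -> : q - 1 - T%:Z + 1 = q - T%:Z by lia.
  have -> : T%:Z + 1 = T.+1%:Z by lia.
  have -> : q - 1 - T%:Z = q - T.+1%:Z by lia.
  by lmod.
rewrite (h0 (- T%:Z) (q + T%:Z)) ?(h1 T%:Z (q - T%:Z)) ?e; try lia.
by lmod.
Qed.

Lemma dxy_eq (f g f' g' : int -> int -> int -> V) N b : (N <= b)%N ->
  iter N dxy f = iter N dxy g -> iter b dxy f = iter b dxy g.
Proof. by move=> h; rewrite -(subnK h) !iterD => ->. Qed.

Lemma iter_zero (D : (int -> int -> int -> V) -> int -> int -> int -> V) a N f :
  (D (fun _ _ _ => 0) = fun _ _ _ => 0) -> (N <= a)%N ->
  iter N D f = (fun _ _ _ => 0) -> iter a D f = (fun _ _ _ => 0).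
Proof. by move=> hD h; rewrite -(subnK h) iterD => ->; elim: (a - N)%N => //= i ->. Qed.

(* [y - z = (x - z) - (x - y)], so a monomial of large degree in these three differences
   either contains [(x - z)^N (y - z)^N], which kills [f] and [g], or it contains
   [(x - y)^(N + 1)], which the telescoping of [rzero_dxy] takes care of. *)
Lemma rzero_dmon N f g : finq f -> finp g ->
  iter N dxy f = iter N dxy g ->
  dmon N 0 N f = (fun _ _ _ => 0) -> dmon N 0 N g = (fun _ _ _ => 0) ->
  forall a b k, (N <= k)%N -> (3 * N <= k + a + b)%N -> rzero (dmon a b k f) (dmon a b k g).
Proof.
move=> hf hg e zf zg a b k hk; rewrite -(subnK hk).
elim: (k - N)%N a b => [|i IH] a b h.
  rewrite add0n in h *; case: (leqP N a) => ha.
    have z f' : dmon N 0 N f' = (fun _ _ _ => 0) -> dmon a b N f' = (fun _ _ _ => 0).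
      move=> z; rewrite /dmon (iterC a b _ (fun x => esym (dxyzC x))).
      rewrite (iter_zero (D := dxz) _ ha z).
        elim: (b) => //= j ->; apply: fext3 => p q n; exact: subrr.
      by apply: fext3 => p q n; exact: subrr.
    rewrite (z f) // (z g) // => q n; apply: eventually_all => T.
    by rewrite /rsum !big1 ?addr0.
  case: b h => [|b] h; first by lia.
  have comm f' : dmon a b.+1 N f' = dxy (dmon a b N f').
    rewrite /dmon iterS; exact: (iterC a 1 _ (fun x => esym (dxyzC x))).
  rewrite !comm; apply: rzero_dxy.
  - exact: (proj1 (fin_dmon _ _ _ _)).
  - exact: (proj2 (fin_dmon _ _ _ _)).
  move=> q n; suff -> : dmon a b N f = dmon a b N g by [].
  rewrite /dmon (iterC b N f dxyyzC) (iterC b N g dxyyzC).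
  by rewrite (@dxy_eq f g f g N b _ e) //; lia.
rewrite addSn in h *; rewrite !dmonS => q n.
have h1 : (3 * N <= i + N + a.+1 + b)%N by lia.
have h2 : (3 * N <= i + N + a + b.+1)%N by lia.
apply: eventuallyW (eventuallyI (IH _ _ h1 q n) (IH _ _ h2 q n)) => T [e1 e2].
by rewrite -[RHS](subrr 0) -{1}e1 -e2 /rsum !sumrB; lmod.
Qed.

(** The residue in [x] commutes with multiplication by [y - z], so powers of [y - z] on the families
    become powers of [dif] on the product field. *)
Lemma rsum_dyz T k f g q n :
  rsum T (iter k dyz f) (iter k dyz g) q n = iter k dif (rsum T f g) q n.
Proof.
elim: k q n => //= k IH q n; rewrite /dif -!IH /rsum /dyz !sumrB.
have -> : \sum_(j < T) iter k dyz f (-1 - j%:Z) (q + j%:Z + 1) n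
        = \sum_(j < T) iter k dyz f (-1 - j%:Z) (q + 1 + j%:Z) n.
  by apply: eq_bigr => j _; rewrite addrAC.
have -> : \sum_(j < T) iter k dyz g j%:Z (q - 1 - j%:Z + 1) n
        = \sum_(j < T) iter k dyz g j%:Z (q + 1 - 1 - j%:Z) n.
  by apply: eq_bigr => j _; congr (iter _ _ _ _ _ _); lia.
by lmod.
Qed.

Lemma iter_dif_eventually N (h : int -> int -> V) (hT : nat -> int -> int -> V) m n :
  (forall m n, eventually (fun T => h m n = hT T m n)) ->
  eventually (fun T => iter N dif h m n = iter N dif (hT T) m n).
Proof.
move=> e; elim: N m n => //= N IH m n.
apply: eventuallyW (eventuallyI (IH (m + 1) n) (IH m (n + 1))) => T [e1 e2].
by rewrite /dif e1 e2.
Qed.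

Lemma iter_dxy N f p q n : iter N dxy f p q n = iter N dif (fun p q => f p q n) p q.
Proof. by elim: N p q => //= N IH p q; rewrite /dxy /dif -!IH. Qed.
Lemma iter_dxz N f p q n : iter N dxz f p q n = iter N dif (fun p n => f p q n) p n.
Proof. by elim: N p n => //= N IH p n; rewrite /dxz /dif -!IH. Qed.
Lemma iter_dyz N f p q n : iter N dyz f p q n = iter N dif (f p) q n.
Proof. by elim: N q n => //= N IH q n; rewrite /dyz /dif -!IH. Qed.

Lemma dmonD a b k f g :
  dmon a b k (fun p q n => f p q n + g p q n) = (fun p q n => dmon a b k f p q n + dmon a b k g p q n).
Proof.
have lin D i : (forall f g, D (fun p q n => f p q n + g p q n) = (fun p q n => D f p q n + D g p q n)) ->
    forall f g : int -> int -> int -> V, iter i D (fun p q n => f p q n + g p q n)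
    = (fun p q n => iter i D f p q n + iter i D g p q n).
  by move=> hD; elim: i => //= i IH f' g'; rewrite IH hD.
rewrite /dmon (lin dyz); last by move=> *; apply: fext3 => p q n; rewrite /dyz; lmod.
rewrite (lin dxy); last by move=> *; apply: fext3 => p q n; rewrite /dxy; lmod.
by rewrite (lin dxz) //; move=> *; apply: fext3 => p q n; rewrite /dxz; lmod.
Qed.

Lemma dmon_yz0 N f : iter N dyz f = (fun _ _ _ => 0) -> dmon N 0 N f = (fun _ _ _ => 0).
Proof.
move=> h; rewrite /dmon /= h; elim: N {h} => //= N ->.
by apply: fext3 => p q n; exact: subrr.
Qed.

Lemma dmon_xz0 N f : iter N dxz f = (fun _ _ _ => 0) -> dmon N 0 N f = (fun _ _ _ => 0).
Proof.
move=> h; rewrite /dmon /= (iterC N N f dxzyzC) h; elim: N {h} => //= N ->.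
by apply: fext3 => p q n; exact: subrr.
Qed.

End Dong.

Lemma iter_dif_field N (A : field) (k : int) h m n : flinear A ->
  iter N dif (fun m n => A k (h m n)) m n = A k (iter N dif h m n).
Proof. by move=> lA; elim: N m n => //= N IH m n; rewrite /dif !IH fieldB. Qed.

(* On each vector both sums of the normally ordered product are finite. *)
Definition is_nop (A B C : field) := forall n v,
  eventually (fun T => C n v = \sum_(j < T) A (-1 - j%:Z) (B (n + j%:Z) v)
                             + \sum_(j < T) B (n - 1 - j%:Z) (A j%:Z v)).

(** Let [f] be the commutator of [A(x)B(y)] with [J(z)], and [g] that of [B(y)A(x)], and let [N]
    bound the three orders of locality. By the Leibniz rule [(x - z)^N (y - z)^N] kills both, and
    [(x - y)^N] kills [f - g], a commutator with that of [A] and [B]. Then [(y - z)^(3N)] kills the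
    residue by [rzero_dmon]. *)
Lemma dong A B C J : flinear A -> flinear B -> flinear J -> truncated A -> truncated B ->
  is_nop A B C -> local A B -> local A J -> local B J -> local C J.
Proof.
move=> lA lB lJ tA tB nC [N1 h1] [N2 h2] [N3 h3].
pose N := maxn N1 (maxn N2 N3); exists (3 * N)%N => v m n.
have {}h1 v' := iter_dif_leq (leq_maxl N1 (maxn N2 N3) : (N1 <= N)%N) (h1 v').
have N2N : (N2 <= N)%N by rewrite /N; lia.
have N3N : (N3 <= N)%N by rewrite /N; lia.
have {N2N}h2 v' := iter_dif_leq N2N (h2 v').
have {N3N}h3 v' := iter_dif_leq N3N (h3 v').
pose f p q n := A p (B q (J n v)) - J n (A p (B q v)).
pose g p q n := B q (A p (J n v)) - J n (B q (A p v)).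
have fq (X Y : field) : truncated Y -> flinear X -> flinear J ->
    forall n, exists q0 : int, forall p q, q0 <= q -> X p (Y q (J n v)) - J n (X p (Y q v)) = 0.
  move=> tY lX _ k; have [q1 e1] := tY (J k v); have [q2 e2] := tY v.
  exists (Num.max q1 q2) => p q; rewrite ge_max => /andP[hq1 hq2].
  by rewrite e1 // e2 // (field0 lX) (field0 lJ) subrr.
have hf : finq f by move=> k; have := fq A B tB lA lJ k.
have hg : finp g.
  by move=> k; have [q0 h0] := fq B A tA lB lJ k; exists q0 => p q hp; exact: h0.
have key (X Y : field) : flinear X ->
    (forall p q n, X p (Y q (J n v)) - J n (X p (Y q v))
       = X p (comm2 Y J v q n) + comm2 X J (Y q v) p n).
  by move=> lX p q k; rewrite /comm2 fieldB //; lmod.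
have zf : dmon N 0 N f = (fun _ _ _ => 0).
  rewrite (_ : f = (fun p q n => A p (comm2 B J v q n) + comm2 A J (B q v) p n)).
    rewrite dmonD dmon_yz0; last first.
      by apply: fext3 => p q k; rewrite iter_dyz iter_dif_field // h3 (field0 lA).
    rewrite dmon_xz0; last by apply: fext3 => p q k; rewrite iter_dxz h2.
    by apply: fext3 => p q k; rewrite addr0.
  by apply: fext3 => p q k; apply: key.
have zg : dmon N 0 N g = (fun _ _ _ => 0).
  rewrite (_ : g = (fun p q n => comm2 B J (A p v) q n + B q (comm2 A J v p n))).
    rewrite dmonD dmon_yz0; last first.
      by apply: fext3 => p q k; rewrite iter_dyz h3.
    rewrite dmon_xz0; last first.
      by apply: fext3 => p q k; rewrite iter_dxz iter_dif_field // h2 (field0 lB).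
    by apply: fext3 => p q k; rewrite addr0.
  by apply: fext3 => p q k; rewrite addrC; apply: key.
have efg : iter N dxy f = iter N dxy g.
  apply: fext3 => p q k; apply/eqP; rewrite -subr_eq0 !iter_dxy.
  rewrite -[X in _ - X]scale1r -scaleNr addrC -iter_dif_lin.
  rewrite (_ : (fun _ _ => _) = (fun p q => -1 *: J k (comm2 A B v p q) + comm2 A B (J k v) p q)).
    by rewrite iter_dif_lin iter_dif_field // !h1 (field0 lJ) scaler0 addr0.
  by apply: fext2 => a b; rewrite /f /g /comm2 fieldB //; lmod.
have main := rzero_dmon hf hg efg zf zg (a := 0) (b := 0) (k := (3 * N)%N).
have {main} : rzero (dmon 0 0 (3 * N) f) (dmon 0 0 (3 * N) g) by apply: main; lia.
rewrite /dmon /= => /(_ m n) h.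
have e : eventually (fun T => iter (3 * N) dif (comm2 C J v) m n = iter (3 * N) dif (rsum T f g) m n).
  apply: iter_dif_eventually => p q.
  apply: eventuallyW (eventuallyI (nC p (J q v)) (nC p v)) => T [e1 e2].
  rewrite /comm2 e1 e2 fieldD // !field_sum // /rsum /f /g !sumrB; lmod.
have [T [e1 e2]] := eventually_inst (eventuallyI h e).
by rewrite e2 -rsum_dyz e1.
Qed.

(** * Translation covariance and existence of normally ordered products *)

Section Derivation.
Context (T : V -> V) (lT : linear T).

(* [ [T, A(z)] = A'(z) ] *)
Definition covariant (A : field) := forall n v, T (A n v) = A n (T v) - n%:~R *: A (n - 1) v.

Lemma der_covariant A : covariant A -> covariant (fder A).
Proof.
move=> h n v; rewrite /fder (fieldZ (fun _ => lT) 0) h.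
have -> : - (n - 1) = 1 - n by lia.
by lmod.
Qed.

(** Applying [T] termwise and shifting the index gives the expected formula for partial sums up to
    one boundary term with factor [S] in each of the two sums; truncation makes both vanish for
    large [S]. *)
Lemma nop_covariant A B C : flinear A -> flinear B -> truncated A -> truncated B ->
  covariant A -> covariant B -> is_nop A B C -> covariant C.
Proof.
move=> lA lB tA tB cA cB nC n v.
have [b hb] := tB v; have [a ha] := tA v.
have lTf : flinear (fun _ : int => T) by move=> _; exact: lT.
have ev : eventually (fun S => B (n - 1 + S%:Z) v = 0 /\ A (S%:Z - 1) v = 0).
  exists (`|a| + `|b| + `|n| + 2)%N => S hS; rewrite hb ?ha //; lia.
have := eventuallyI ev (eventuallyI (nC n (T v)) (eventuallyI (nC n v) (nC (n - 1) v))).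
move=> /eventually_inst [S [[z1 z2] [-> [-> ->]]]].
rewrite (fieldD lTf 0) !(field_sum lTf 0).
have e1 : \sum_(j < S) T (A (-1 - j%:Z) (B (n + j%:Z) v)) =
    \sum_(j < S) A (-1 - j%:Z) (B (n + j%:Z) (T v))
    - n%:~R *: (\sum_(j < S) A (-1 - j%:Z) (B (n - 1 + j%:Z) v))
    + S%:R *: A (-1 - S%:Z) (B (n - 1 + S%:Z) v).
  elim: S {z1 z2} => [|S IH]; first by rewrite !big_ord0; lmod.
  rewrite !big_ord_recr /= IH cA cB fieldB // fieldZ //.
  have -> : n + S%:Z - 1 = n - 1 + S%:Z by lia.
  have -> : -1 - S%:Z - 1 = -1 - S.+1%:Z by lia.
  have -> : n - 1 + S.+1%:Z = n + S%:Z by lia.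
  by lmod.
have e2 : \sum_(j < S) T (B (n - 1 - j%:Z) (A j%:Z v)) =
    \sum_(j < S) B (n - 1 - j%:Z) (A j%:Z (T v))
    - n%:~R *: (\sum_(j < S) B (n - 1 - 1 - j%:Z) (A j%:Z v))
    + S%:R *: B (n - 1 - S%:Z) (A (S%:Z - 1) v).
  elim: S {z1 z2 e1} => [|S IH]; first by rewrite !big_ord0; lmod.
  rewrite !big_ord_recr /= IH cB cA fieldB // fieldZ //.
  have -> : n - 1 - S%:Z - 1 = n - 1 - S.+1%:Z by lia.
  have -> : n - 1 - 1 - S%:Z = n - 1 - S.+1%:Z by lia.
  have -> : S.+1%:Z - 1 = S%:Z by lia.
  by lmod.
by rewrite e1 e2 z1 z2 (field0 lA) (field0 lB); lmod.
Qed.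
End Derivation.

(** Only finitely many [A j v] with [j >= 0] are nonzero, so one bound serves all the vectors to
    which [B] is applied in the second sum. *)
Lemma nop_truncated A B C : flinear B -> truncated A -> truncated B ->
  flinear A -> is_nop A B C -> truncated C.
Proof.
move=> lB tA tB lA nC v; have [b hb] := tB v; have [a ha] := tA v.
have [m hm] : exists m : int, forall j : nat, j%:Z < a -> forall n, m <= n -> B n (A j%:Z v) = 0.
  have [K aK] : exists K : nat, a <= K%:Z by exists `|a|%N; lia.
  have [m hm] : exists m : int, forall j : nat, (j < K)%N -> forall n, m <= n -> B n (A j%:Z v) = 0.
    elim: K {aK} => [|K [m hm]]; first by exists 0.
    have [m' hm'] := tB (A K%:Z v); exists (Num.max m m') => j; rewrite ltnS leq_eqVlt.
    move=> /orP[/eqP -> | hj] n; rewrite ge_max => /andP[h1 h2]; [exact: hm' | exact: hm].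
  by exists m => j hj; apply: hm; lia.
exists (Num.max b (m + `|a| + 1)) => n; rewrite ge_max => /andP[h1 h2].
have [S ->] := eventually_inst (nC n v); rewrite !big1 ?addr0 // => j _.
  case: (ltrP (j%:Z) a) => hj; last by rewrite (ha j%:Z hj) (field0 lB).
  by apply: hm => //; lia.
by rewrite hb ?(field0 lA) //; lia.
Qed.

Lemma sum_lin (S : nat) a (f g h : nat -> V) : (forall j, f j = a *: g j + h j) ->
  \sum_(j < S) f j = a *: (\sum_(j < S) g j) + \sum_(j < S) h j.
Proof. by move=> e; rewrite scaler_sumr -big_split; apply: eq_bigr => j _; exact: e. Qed.

Lemma nop_linear A B C : flinear A -> flinear B -> is_nop A B C -> flinear C.
Proof.
move=> lA lB nC n a u v.
have := eventuallyI (nC n (a *: u + v)) (eventuallyI (nC n u) (nC n v)).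
move=> /eventually_inst [S [-> [-> ->]]].
rewrite (@sum_lin S a (fun j => A (-1 - j%:Z) (B (n + j%:Z) (a *: u + v)))
  (fun j => A (-1 - j%:Z) (B (n + j%:Z) u)) (fun j => A (-1 - j%:Z) (B (n + j%:Z) v))).
  rewrite (@sum_lin S a (fun j => B (n - 1 - j%:Z) (A j%:Z (a *: u + v)))
    (fun j => B (n - 1 - j%:Z) (A j%:Z u)) (fun j => B (n - 1 - j%:Z) (A j%:Z v))).
    by lmod.
  by move=> j; rewrite lA lB.
by move=> j; rewrite lB lA.
Qed.

Lemma eventually_sum (f : nat -> V) : (exists K, forall j, (K <= j)%N -> f j = 0) ->
  exists x, eventually (fun T => \sum_(j < T) f j = x).
Proof.
move=> [K hK]; exists (\sum_(j < K) f j); exists K => T hT.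
elim: T hT => [|T IH]; first by rewrite leqn0 => /eqP ->.
rewrite leq_eqVlt => /orP[/eqP -> // | hT]; rewrite ltnS in hT.
by rewrite big_ord_recr /= IH // hK // addr0.
Qed.

(** The cutoff after which the sums are constant depends on [n] and [v], so the limit is selected by
    indefinite description. *)
Lemma nop_exists A B : flinear A -> flinear B -> truncated A -> truncated B ->
  exists C, is_nop A B C.
Proof.
move=> lA lB tA tB.
have h (p : int * V) : exists x, eventually (fun T => x
   = \sum_(j < T) A (-1 - j%:Z) (B (p.1 + j%:Z) p.2) + \sum_(j < T) B (p.1 - 1 - j%:Z) (A j%:Z p.2)).
  case: p => n v /=; have [b hb] := tB v; have [a ha] := tA v.
  have [|x hx] := @eventually_sum (fun j => A (-1 - j%:Z) (B (n + j%:Z) v)).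
    by exists (`|b| + `|n|)%N => j hj; rewrite hb ?(field0 lA) //; lia.
  have [|y hy] := @eventually_sum (fun j => B (n - 1 - j%:Z) (A j%:Z v)).
    by exists `|a|%N => j hj; rewrite ha ?(field0 lB) //; lia.
  by exists (x + y); apply: eventuallyW (eventuallyI hx hy) => T [-> ->].
exists (fun n v => proj1_sig (constructive_indefinite_description _ (h (n, v)))) => n v.
by case: constructive_indefinite_description.
Qed.

Lemma nop_creative A B C vac : flinear A -> flinear B -> (forall n, 0 <= n -> A n vac = 0) ->
  (forall n, 0 <= n -> B n vac = 0) -> is_nop A B C ->
  (forall n, 0 <= n -> C n vac = 0) /\ C (-1) vac = A (-1) (B (-1) vac).
Proof.
move=> lA lB zA zB nC; split=> [n hn|].
  have [S ->] := eventually_inst (nC n vac); rewrite !big1 ?addr0 // => j _.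
    by rewrite zA ?(field0 lB).
  by rewrite zB ?(field0 lA) //; lia.
have [S0 h] := nC (-1) vac; rewrite (h S0.+1) // big_ord_recl /= ?subr0 ?addr0 !big1 ?addr0 // => j _.
  by rewrite zA ?(field0 lB).
by rewrite zB ?(field0 lA) //; lia.
Qed.

Lemma pnatr_neq0 (ch : [pchar F] =i pred0) n : n.+1%:R != 0 :> F.
Proof. by have [h _] := pcharf0P F; rewrite h. Qed.

(** Covariance expresses [(j + 1) D (-2 - j) vac] through [D (-1 - j) vac], so in characteristic 0
    all modes of [D] kill the vacuum. If they kill [v], locality says that a power of [x - y] kills
    [D(x) J(y) v], and this power can be cancelled because [J(y) v] is truncated. *)
Lemma goddard_uniqueness (I : Type) (J : I -> field) (vac : V) (T : V -> V) (D : field) :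
  [pchar F] =i pred0 ->
  (forall i, truncated (J i)) ->
  (forall P : V -> Prop, P vac -> (forall a u v, P u -> P v -> P (a *: u + v)) ->
      (forall i n v, P v -> P (J i n v)) -> forall v, P v) ->
  T vac = 0 -> linear T -> (forall i, flinear (J i)) -> flinear D -> covariant T D ->
  (forall i, local D (J i)) ->
  (forall n, 0 <= n -> D n vac = 0) -> D (-1) vac = 0 -> forall n v, D n v = 0.
Proof.
move=> ch tJ ind Tv lT lJ lD cD locD zD zD1 n v; move: v n.
apply: ind => [n|a u v hu hv n|i m v hv n].
- case: (lerP 0 n) => hn; first exact: zD.
  have -> : n = -1 - (`|n| - 1)%N%:Z by lia.
  elim: (`|n| - 1)%N => [|j IH]; first by rewrite subr0.
  have lTf : flinear (fun _ : int => T) by move=> _; exact: lT.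
  have := cD (-1 - j%:Z) vac; rewrite IH Tv (field0 lTf 0) (field0 lD) sub0r => /esym /eqP.
  rewrite oppr_eq0 scaler_eq0 => /orP[|/eqP].
    have -> : -1 - j%:Z = - j.+1%:Z by lia.
    by rewrite rmorphN oppr_eq0 /= -pmulrn (negPf (pnatr_neq0 ch j)).
  by have -> : -1 - j%:Z - 1 = -1 - j.+1%:Z by lia.
- by rewrite lD hu hv scaler0 addr0.
have [N hN] := locD i; have [m0 hm0] := tJ i v.
(* A family killed by [x - y] is constant along [p + q = const]; moving far enough in [q] gives
   0. *)
have dif_inj h k : (forall p q : int, k <= q -> h p q = 0 :> V) ->
    (forall p q, iter N dif h p q = 0) -> forall p q, h p q = 0.
  elim: (N) h => [|M IHM] h h0 hM p q; first exact: hM.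
  have d0 : forall p q, dif h p q = 0.
    apply: IHM => [p' q' hq|p' q']; last by rewrite -iterSr.
    by rewrite /dif !h0 ?subrr //; lia.
  have shift r p' q' : h p' q' = h (p' - r%:Z) (q' + r%:Z).
    elim: r p' q' => [|r IHr] p' q'; first by rewrite subr0 addr0.
    have /eqP := d0 (p' - 1) q'; rewrite /dif subr_eq0 subrK => /eqP ->.
    by rewrite IHr; congr h; lia.
  by rewrite (shift `|k - q|%N) h0 //; lia.
pose h p q := D p (J i q v).
apply: (dif_inj h m0) => [p q hq|p q]; first by rewrite /h hm0 // (field0 lD).
rewrite -(hN v p q); congr (iter N dif _ p q); apply: fext2 => a b.
by rewrite /h /comm2 hv (field0 (lJ i)) subr0.
Qed.

End Fields.

(** * Vectors generated by a family of symmetric fields *)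

Section Generation.
Context (F : fieldType) (charF0 : [pchar F] =i pred0) (V : lmodType F).
Local Notation field := (field V).

(** The divided derivative of order [k]. Scaling is written with [flin] and [fzero], so that the
    closure properties of linear combinations apply. *)
Fixpoint dpow k (A : field) : field :=
  if k is k'.+1 then flin (k%:R^-1) (fder (dpow k' A)) (@fzero F V) else A.

Lemma binomzS n k : binomz F n k.+1 = k.+1%:R^-1 * n%:~R * binomz F (n - 1) k.
Proof.
rewrite /binomz big_ord_recl factS natrM invfM subr0.
have -> : \prod_(i < k) (n%:~R - (lift ord0 i)%:R) = \prod_(i < k) ((n - 1)%:~R - i%:R) :> F.
  by apply: eq_bigr => i _; rewrite lift0; ring.
by ring.
Qed.

Lemma dpowE k A n v : dpow k A n v = ((-1) ^+ k * binomz F n k) *: A (n - k%:Z) v.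
Proof.
elim: k n => [|k IH] n.
  by rewrite /= /binomz big_ord0 fact0 invr1 !mulr1 expr0 subr0 scale1r.
rewrite /= /flin /fder /fzero IH addr0 binomzS !scalerA exprS.
have -> : n - 1 - k%:Z = n - k.+1%:Z by lia.
congr (_ *: _); ring.
Qed.

Context (vac : V) (T : V -> V) (lT : linear T) (Tvac : T vac = 0).
Context (I : Type) (J : I -> field).
Context (lJ : forall i, flinear (J i)) (tJ : forall i, truncated (J i)).
Context (indJ : forall P : V -> Prop, P vac -> (forall a u v, P u -> P v -> P (a *: u + v)) ->
      (forall i n v, P v -> P (J i n v)) -> forall v, P v).
Context (W : int -> V -> Prop).
Context (W0 : forall N, W N 0) (Wlin : forall N a u v, W N u -> W N v -> W N (a *: u + v))
  (Wneg : forall N v, W N v -> N < 0 -> v = 0) (Wvac : W 0 vac).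

(** This record stands in for the state-field correspondence: by Goddard uniqueness such a field is
    determined by [A (-1) vac]. [W N v] reads: [v] has weight [N]. *)
Record vfield (h : int) (A : field) : Prop := VField {
  vf_linear : flinear A;
  vf_trunc : truncated A;
  vf_cov : covariant T A;
  vf_creat : forall n, 0 <= n -> A n vac = 0;
  vf_local : forall i, local A (J i);
  vf_weight : forall N n v, W N v -> W (N + h - n - 1) (A n v) }.

Lemma vfield_lin h a A B : vfield h A -> vfield h B -> vfield h (flin a A B).
Proof.
move=> [lA tA cA zA locA wA] [lB tB cB zB locB wB].
split=> [n b u v|v|n v|n hn|i|N n v hv]; rewrite /flin.
- by rewrite lA lB; lmod.
- have [n1 h1] := tA v; have [n2 h2] := tB v; exists (Num.max n1 n2) => n.
  by rewrite ge_max => /andP[? ?]; rewrite h1 // h2 // scaler0 addr0.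
- have lTf : flinear (fun _ : int => T) by move=> _; exact: lT.
  by rewrite (fieldD lTf 0) (fieldZ lTf 0) cA cB; lmod.
- by rewrite zA // zB // scaler0 addr0.
- exact: local_lin.
- by apply: Wlin; [exact: wA | exact: wB].
Qed.

Lemma vfield0 h : vfield h (@fzero F V).
Proof.
split=> [n b u v|v|n v|n hn|i|N n v hv]; rewrite /fzero ?scaler0 ?addr0 //.
- by exists 0.
- have lTf : flinear (fun _ : int => T) by move=> _; exact: lT.
  by rewrite (field0 lTf 0) subr0.
- exact: local0.
Qed.

Lemma vfield_id : vfield 0 (@fid F V).
Proof.
split=> [n b u v|v|n v|n hn|i|N n v hv]; rewrite /fid.
- by case: ifP; rewrite ?scaler0 ?addr0.
- by exists 0 => n hn; rewrite ifF //; lia.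
- have lTf : flinear (fun _ : int => T) by move=> _; exact: lT.
  have [->|->|[h1 h2]] : [\/ n = -1, n = 0 | (n == -1) = false /\ (n - 1 == -1) = false].
    have := erefl (n == -1); case: {2}(n == -1) => [/eqP ->|h1]; first by constructor 1.
    have := erefl (n == 0); case: {2}(n == 0) => [/eqP ->|h2]; first by constructor 2.
    by constructor 3; split=> //; lia.
  + by rewrite /= scaler0 subr0.
  + by rewrite /= (field0 lTf 0) scale0r subr0.
  + by rewrite h1 h2 (field0 lTf 0) scaler0 subr0.
- by rewrite ifF //; lia.
- exact: local_id.
- by case: eqP => [->|_] //; rewrite (_ : N + 0 - -1 - 1 = N) //; lia.
Qed.

Lemma vfield_der h A : vfield h A -> vfield (h + 1) (fder A).
Proof.
move=> [lA tA cA zA locA wA]; split=> [n b u v|v|n v|n hn|i|N n v hv].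
- by rewrite /fder lA; lmod.
- by have [n1 h1] := tA v; exists (n1 + 1) => n hn; rewrite /fder h1 ?scaler0 //; lia.
- exact: der_covariant.
- rewrite /fder; case: (eqVneq n 0) => [->|h0]; first by rewrite scale0r.
  by rewrite zA ?scaler0 //; lia.
- exact: local_der.
- rewrite /fder -[X in W _ X]addr0; apply: Wlin => //.
  by have := wA N (n - 1) v hv; rewrite (_ : N + h - (n - 1) - 1 = N + (h + 1) - n - 1) //; lia.
Qed.

Lemma vfield_dpow h k A : vfield h A -> vfield (h + k%:Z) (dpow k A).
Proof.
move=> hA; elim: k => [|k IH]; first by rewrite addr0.
rewrite -addn1 PoszD addrA addn1 /=; apply: vfield_lin; last exact: vfield0.
exact: vfield_der.
Qed.

Lemma W_sum N (S : nat) (f : nat -> V) : (forall j, W N (f j)) -> W N (\sum_(j < S) f j).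
Proof.
move=> h; elim/big_rec: _ => // j x _ hx; rewrite -[f j]scale1r.
exact: Wlin.
Qed.

Lemma vfield_nop h1 h2 A B C : vfield h1 A -> vfield h2 B -> local A B -> is_nop A B C ->
  vfield (h1 + h2) C.
Proof.
move=> [lA tA cA zA locA wA] [lB tB cB zB locB wB] lAB nC.
split.
- exact: nop_linear nC.
- exact: nop_truncated nC.
- exact: nop_covariant nC.
- exact: (proj1 (nop_creative lA lB zA zB nC)).
- by move=> i; apply: (dong lA lB (lJ i) tA tB nC).
- move=> N n v hv; have [S ->] := eventually_inst (nC n v).
  rewrite -[X in W _ (X + _)]scale1r; apply: Wlin.
    apply: (@W_sum _ S (fun j => A (-1 - j%:Z) (B (n + j%:Z) v))) => j.
    have := wA _ (-1 - j%:Z) _ (wB _ (n + j%:Z) _ hv).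
    by rewrite (_ : _ - 1 = N + (h1 + h2) - n - 1) //; lia.
  apply: (@W_sum _ S (fun j => B (n - 1 - j%:Z) (A j%:Z v))) => j.
  have := wB _ (n - 1 - j%:Z) _ (wA _ j%:Z _ hv).
  by rewrite (_ : _ - 1 = N + (h1 + h2) - n - 1) //; lia.
Qed.

Lemma local_dpow k A B : flinear B -> local A B -> local (dpow k A) B.
Proof.
move=> lB h; elim: k => //= k IH; apply: local_lin => //; last exact: local0.
exact: local_der.
Qed.

Context (s : V -> V) (ls : linear s) (svac : s vac = vac).
Let lsf : flinear (fun _ : int => s). Proof. by move=> _; exact: ls. Qed.

Definition fsym (A : field) := forall n v, s (A n v) = A n (s v).

Lemma fsym_lin a A B : fsym A -> fsym B -> fsym (flin a A B).
Proof. by move=> hA hB n v; rewrite /flin (fieldD lsf 0) (fieldZ lsf 0) hA hB. Qed.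

Lemma fsym0 : fsym (@fzero F V).
Proof. by move=> n v; rewrite /fzero (field0 lsf 0). Qed.

Lemma fsym_id : fsym (@fid F V).
Proof. by move=> n v; rewrite /fid; case: ifP; rewrite ?(field0 lsf 0). Qed.

Lemma fsym_dpow k A : fsym A -> fsym (dpow k A).
Proof.
move=> hA; elim: k => //= k IH; apply: fsym_lin; last exact: fsym0.
by move=> n v; rewrite /fder (fieldZ lsf 0) IH.
Qed.

Lemma fsym_nop A B C : fsym A -> fsym B -> is_nop A B C -> fsym C.
Proof.
move=> hA hB nC n v.
have [S [-> ->]] := eventually_inst (eventuallyI (nC n v) (nC n (s v))).
rewrite (fieldD lsf 0) !(field_sum lsf 0); congr (_ + _); apply: eq_bigr => j _.
  by rewrite hA hB.
by rewrite hB hA.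
Qed.

Context (G : Type) (g : G -> field) (wt : G -> nat) (wt_gt0 : forall x, (0 < wt x)%N).
Context (hg : forall x, vfield (wt x) (g x)) (sg : forall x, fsym (g x))
  (locg : forall x y, local (g x) (g y)).

(** The span of the normally ordered monomials, graded by weight. The mode [-1-k] is, up to the
    factor [k!], the mode [-1] of the [k]-th derivative. *)
Inductive gspan : nat -> V -> Prop :=
| gspan_vac : gspan 0 vac
| gspan0 N : gspan N 0
| gspan_lin N a u v : gspan N u -> gspan N v -> gspan N (a *: u + v)
| gspan_mode x k N v : gspan N v -> gspan (N + wt x + k) (g x (-1 - k%:Z) v).

(** The fields of the vectors in [gspan], with the same weights. Products are recorded by [is_nop],
    so any realization of the product is allowed. *)
Inductive mfield : nat -> field -> Prop :=
| mfield_id : mfield 0 (@fid F V)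
| mfield0 N : mfield N (@fzero F V)
| mfield_lin N a A B : mfield N A -> mfield N B -> mfield N (flin a A B)
| mfield_step x k N B C : mfield N B -> is_nop (dpow k (g x)) B C ->
    mfield (N + wt x + k) C.

(** Locality with the generators is carried along because the next normally ordered product, and
    Dong's lemma for it, require it. *)
Lemma mfieldP N A : mfield N A -> [/\ vfield N A, fsym A & forall x, local A (g x)].
Proof.
elim=> {N A} [|N|N a A B _ [vA sA lA] _ [vB sB lB]|x k N B C _ [vB sB lB] nC].
- split; [exact: vfield_id | exact: fsym_id | move=> x; apply: local_id].
  exact: vf_linear (hg x).
- split; [exact: vfield0 | exact: fsym0 | move=> x; apply: local0].
  exact: vf_linear (hg x).
- split; [exact: vfield_lin | exact: fsym_lin | move=> x; apply: local_lin => //].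
  exact: vf_linear (hg x).
have vd := vfield_dpow k (hg x).
have lAB : local (dpow k (g x)) B.
  by apply: local_dpow; [exact: vf_linear vB | apply: local_sym].
split.
- by have := vfield_nop vd vB lAB nC; rewrite (_ : _ + N%:Z = (N + wt x + k)%N) //; lia.
- by apply: fsym_nop nC => //; exact: fsym_dpow.
- move=> y; apply: (dong _ _ _ _ _ nC) => //.
  + exact: vf_linear vd.
  + exact: vf_linear vB.
  + exact: vf_linear (hg y).
  + exact: vf_trunc vd.
  + exact: vf_trunc vB.
  + by apply: local_dpow => //; exact: vf_linear (hg y).
Qed.

Lemma binomzN1 k : (-1) ^+ k * binomz F (-1) k = 1.
Proof.
rewrite /binomz mulrA.
have -> : (-1) ^+ k * \prod_(i < k) ((-1)%:~R - i%:R) = k`!%:R :> F.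
  elim: k => [|k IH]; first by rewrite big_ord0 mulr1.
  rewrite big_ord_recr /= exprS factS natrM -IH /=; ring.
rewrite divff //; have := pnatr_neq0 charF0 k`!.-1.
by rewrite prednK // fact_gt0.
Qed.

Lemma gspan_mfield N v : gspan N v -> exists2 A, mfield N A & A (-1) vac = v.
Proof.
elim=> {N v} [|N|N a u v _ [A hA <-] _ [B hB <-]|x k N v _ [B hB <-]].
- by exists (@fid F V); [exact: mfield_id|].
- by exists (@fzero F V); [exact: mfield0|].
- by exists (flin a A B); [exact: mfield_lin|].
have [vB _ _] := mfieldP hB; have vd := vfield_dpow k (hg x).
have [C nC] := nop_exists (vf_linear vd) (vf_linear vB) (vf_trunc vd) (vf_trunc vB).
exists C; first exact: mfield_step nC.
rewrite (proj2 (nop_creative (vf_linear vd) (vf_linear vB) (vf_creat vd) (vf_creat vB) nC)).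
by rewrite dpowE binomzN1 scale1r.
Qed.

Lemma gspan_sum N (S : nat) (f : nat -> V) :
  (forall j, gspan N (f j)) -> gspan N (\sum_(j < S) f j).
Proof.
move=> h; elim/big_rec: _ => [|j x _ hx]; first exact: gspan0.
rewrite -[f j]scale1r; exact: gspan_lin.
Qed.

Section Step.
Context (N : nat).
Hypothesis IHN : forall (M : nat) v, (M < N)%N -> W M v -> s v = v -> gspan M v.

(** Expand the outermost product. In the first sum the inner vector has weight below [N], since a
    creation mode of positive weight follows; it is generated by hypothesis, and the outer modes
    preserve the span. In the second sum the mode of the generator acts first, its result is an
    invariant of weight below [N], and the induction on the monomial applies. *)
Lemma mfield_mode h B : mfield h B -> forall (n k : nat) v, (n < N)%N ->
  (h + k + n)%N = N -> W n v -> s v = v -> gspan N (B (-1 - k%:Z) v).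
Proof.
elim=> {h B} [|h|h a A B _ IHA _ IHB|x k0 h B C hB IHB nC] n k v nN e wv sv.
(* Here [h = 0], and [n < N] forces [k > 0]: this mode of the identity field is 0. *)
- rewrite /fid ifF; first exact: gspan0.
  by lia.
- exact: gspan0.
- by apply: gspan_lin; [exact: (IHA n k v) | exact: (IHB n k v)].
have [vB sB _] := mfieldP hB; have vd := vfield_dpow k0 (hg x).
have sd := fsym_dpow k0 (sg x); have wx := wt_gt0 x.
have [S ->] := eventually_inst (nC (-1 - k%:Z) v).
rewrite -[X in gspan _ (X + _)]scale1r; apply: gspan_lin.
  apply: (@gspan_sum _ S (fun j => dpow k0 (g x) (-1 - j%:Z) (B (-1 - k%:Z + j%:Z) v))) => j.
  have := vf_weight vB (-1 - k%:Z + j%:Z) wv; set u := B _ v => wu.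
  have su : s u = u by rewrite /u sB sv.
  case: (ltnP (n + h + k) j) => hj.
    rewrite (Wneg wu); last by lia.
    by rewrite (field0 (vf_linear vd)); exact: gspan0.
  have gu : gspan (n + h + k - j) u.
    apply: IHN => //; first by lia.
    by move: wu; rewrite (_ : _ - 1 = (n + h + k - j)%N%:Z) //; lia.
  rewrite dpowE -[_ *: _]addr0; apply: gspan_lin; last exact: gspan0.
  have := gspan_mode x (k0 + j) gu.
  rewrite (_ : (n + h + k - j + wt x + (k0 + j))%N = N); last by lia.
  by rewrite (_ : -1 - (k0 + j)%N%:Z = -1 - j%:Z - k0%:Z) //; lia.
apply: (@gspan_sum _ S (fun j => B (-1 - k%:Z - 1 - j%:Z) (dpow k0 (g x) j%:Z v))) => j.
have := vf_weight vd j%:Z wv; set u := dpow _ _ _ v => wu.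
have su : s u = u by rewrite /u sd sv.
case: (ltnP (n + wt x + k0) j.+1) => hj.
  rewrite (Wneg wu); last by lia.
  by rewrite (field0 (vf_linear vB)); exact: gspan0.
rewrite (_ : -1 - k%:Z - 1 - j%:Z = -1 - (k + 1 + j)%N%:Z); last by lia.
apply: (IHB (n + wt x + k0 - j.+1)%N) => //; try lia.
by move: wu; rewrite (_ : _ - 1 = (n + wt x + k0 - j.+1)%N%:Z) //; lia.
Qed.

(* If all invariants of weight below [N] are generated, then so is every product of two of
   them: [U] is determined by the vector [U (-1) vac], hence is a sum of monomial fields. *)
Lemma generated_mode (h : nat) U : (0 < h < N)%N -> vfield h U -> fsym U ->
  forall (n k : nat) v, (h + k + n)%N = N -> W n v -> s v = v -> gspan N (U (-1 - k%:Z) v).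
Proof.
move=> /andP[h0 hN] vU sU n k v e wv sv.
have : gspan h (U (-1) vac).
  apply: IHN => //; last by rewrite sU svac.
  by have := vf_weight vU (-1) Wvac; rewrite (_ : _ - 1 = h%:Z) //; lia.
move=> /gspan_mfield [A mA eA]; have [vA _ _] := mfieldP mA.
have vD := vfield_lin (-1) vA vU.
have z : forall n v, flin (-1) A U n v = 0.
  apply: (goddard_uniqueness charF0 tJ indJ Tvac lT lJ (vf_linear vD) (vf_cov vD) (vf_local vD) (vf_creat vD)).
  by rewrite /flin eA scaleN1r addNr.
have -> : U (-1 - k%:Z) v = A (-1 - k%:Z) v.
  have := z (-1 - k%:Z) v; rewrite /flin scaleN1r addrC => /eqP.
  by rewrite subr_eq0 => /eqP.
apply: (mfield_mode mA (n := n)) => //; lia.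
Qed.
End Step.
End Generation.

(** * Reduction of words modulo the generated invariants *)

Section Binomials.
Context (F : fieldType) (charF0 : [pchar F] =i pred0).

Lemma natF_neq0 n : (n.+1%:R == 0 :> F) = false.
Proof. exact: negbTE (pnatr_neq0 charF0 n). Qed.

(** The binomials [C(x + t, t)] and [C(x, t)] as polynomials in [x]. For numeral [t] they unfold,
    which lets [field] treat coefficients that depend on the weight. *)
Fixpoint rising (x : F) t : F := if t is t'.+1 then rising x t' * (x + t%:R) / t%:R else 1.
Fixpoint falling (x : F) t : F := if t is t'.+1 then falling x t' * (x - t'%:R) / t%:R else 1.

Lemma bin_rising m t : 'C(m + t, m)%:R = rising m%:R t.
Proof.
elim: t => [|t IH]; first by rewrite addn0 binn.
have n0 : t.+1%:R != 0 :> F by rewrite natF_neq0.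
apply: (mulIf n0); rewrite /= divfK // -IH -natrD -!natrM; congr _%:R.
have := mul_bin_diag (m + t).+1 t.
have -> : 'C(m + t.+1, m) = 'C((m + t).+1, t.+1).
  by rewrite -bin_sub; [congr 'C(_, _); lia | lia].
have -> : 'C(m + t, m) = 'C(m + t, t) by rewrite -bin_sub; [congr 'C(_, _); lia | lia].
by rewrite addnS => /= h; rewrite mulnC -h mulnC.
Qed.

Lemma bin_falling m t : 'C(m, t)%:R = falling m%:R t.
Proof.
elim: t => [|t IH]; first by rewrite bin0.
have n0 : t.+1%:R != 0 :> F by rewrite natF_neq0.
apply: (mulIf n0); rewrite /= divfK // -IH -natrM mulnC mul_bin_left natrM mulrC.
case: (leqP t m) => h; first by rewrite natrB.
by rewrite bin_small // !mul0r.
Qed.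

End Binomials.

Section Reduction.
Context (F : fieldType) (charF0 : [pchar F] =i pred0) (c : F) (X : lmodType F).
Context (L : int -> X -> X) (vac : X) (lL : forall n, linear (L n)).
Context (virL : forall m n v, vir_rel c L m n v) (Lvac : forall n : int, -1 <= n -> L n vac = 0).

Let LD n u v : L n (u + v) = L n u + L n v. Proof. exact: (fieldD lL). Qed.
Let LZ n a v : L n (a *: v) = a *: L n v. Proof. exact: (fieldZ lL). Qed.
Let L0 n : L n 0 = 0. Proof. exact: (field0 lL). Qed.
Let LB n u v : L n (u - v) = L n u - L n v. Proof. exact: (fieldB lL). Qed.

Definition word (ks : seq nat) := foldr (fun k v => L (- k%:Z) v) vac ks.
Definition letters (ks : seq nat) := all (fun k => 2 <= k)%N ks.

Lemma coc_neg (k l : nat) : (0 < k)%N -> coc c (- k%:Z) (- l%:Z) = 0.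
Proof. by move=> k0; rewrite /coc ifF //; lia. Qed.

Lemma L_swap (k l : nat) v : (0 < k)%N ->
  L (- k%:Z) (L (- l%:Z) v) = L (- l%:Z) (L (- k%:Z) v) + (l%:R - k%:R) *: L (- (k + l)%N%:Z) v.
Proof.
move=> k0; rewrite (virL (- k%:Z) (- l%:Z)) coc_neg // scale0r addr0.
have -> : - k%:Z + - l%:Z = - (k + l)%N%:Z by lia.
by congr (_ + _ *: _); ring.
Qed.

Lemma L_pass (m k : nat) v : L m%:Z (L (- k%:Z) v) =
  L (- k%:Z) (L m%:Z v) + (m%:R + k%:R) *: L (m%:Z - k%:Z) v
  + (if m == k then c / 12%:R * (m%:R ^+ 3 - m%:R) else 0) *: v.
Proof.
rewrite (virL m%:Z (- k%:Z)); congr (_ + _ *: _ + _ *: _); first by ring.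
by rewrite /coc subr_eq0 eqz_nat; case: ifP => // _; congr (_ * _); ring.
Qed.

(** The span of the words of weight [N] and length at most [r], encoded by its induction
    principle. *)
Definition fil (N : int) (r : nat) (x : X) := forall P : X -> Prop, P 0 ->
  (forall a u v, P u -> P v -> P (a *: u + v)) ->
  (forall ks, letters ks -> (size ks <= r)%N -> (sumn ks)%:Z = N -> P (word ks)) -> P x.

Lemma fil0 N r : fil N r 0. Proof. by move=> P. Qed.
Lemma fil_lin N r a u v : fil N r u -> fil N r v -> fil N r (a *: u + v).
Proof. by move=> hu hv P h0 hl hw; apply: (hl); [exact: (hu P h0 hl hw) | exact: (hv P h0 hl hw)]. Qed.
Lemma filD N r u v : fil N r u -> fil N r v -> fil N r (u + v).
Proof. by move=> hu hv; rewrite -[u]scale1r; exact: fil_lin. Qed.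
Lemma filZ N r a u : fil N r u -> fil N r (a *: u).
Proof. by move=> hu; rewrite -[_ *: _]addr0; apply: fil_lin => //; exact: fil0. Qed.
Lemma fil_word ks : letters ks -> fil (sumn ks)%:Z (size ks) (word ks).
Proof. by move=> h P h0 hl hw; exact: hw. Qed.
Lemma fil_leq N r r' x : (r <= r')%N -> fil N r x -> fil N r' x.
Proof.
by move=> rr hx P h0 hl hw; apply: hx => // ks h1 h2 h3; apply: hw => //; exact: leq_trans rr.
Qed.
Lemma fil_sum N r (S : nat) (f : nat -> X) :
  (forall t, fil N r (f t)) -> fil N r (\sum_(t < S) f t).
Proof. by move=> h; elim/big_rec: _ => [|t x _ hx]; [exact: fil0 | exact: filD]. Qed.

Lemma fil_lmap N r M r' (f : X -> X) x : linear f -> fil N r x ->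
  (forall ks, letters ks -> (size ks <= r)%N -> (sumn ks)%:Z = N -> fil M r' (f (word ks))) ->
  fil M r' (f x).
Proof.
move=> lf hx h; apply: (hx (fun x => fil M r' (f x))) => // [|a u v hu hv].
  have := lf (-1) 0 0; rewrite scaler0 addr0 scaleN1r addNr => ->; exact: fil0.
by rewrite lf; exact: fil_lin.
Qed.

Lemma fil_create N r k x : (2 <= k)%N -> fil N r x -> fil (N + k%:Z) r.+1 (L (- k%:Z) x).
Proof.
move=> k2 hx; apply: (fil_lmap (lL _) hx) => ks lk sk wk.
have -> : N + k%:Z = (sumn (k :: ks))%:Z by rewrite /= -wk; lia.
by apply: fil_leq (@fil_word (k :: ks) _) => //=; rewrite k2.
Qed.

Lemma fil_annih N r (m : int) x : -1 <= m -> fil N r x -> fil (N - m) r (L m x).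
Proof.
move=> hm hx; apply: (fil_lmap (lL _) hx) => ks lk sk <- {hx}.
elim: ks r m hm lk sk => [|k ks IH] r m hm /=; first by rewrite Lvac //; move=> *; exact: fil0.
move=> /andP[k2 lk]; case: r => // r sk.
rewrite (virL m (- k%:Z)); apply: filD; first apply: filD.
- have := fil_create k2 (IH _ _ hm lk sk).
  by rewrite (_ : (sumn ks)%:Z - m + k%:Z = (k + sumn ks)%N%:Z - m) //; lia.
- apply: filZ; case: (lerP (m - k%:Z) (-2)) => h.
    have -> : m + - k%:Z = - (`|m - k%:Z|%N)%:Z by lia.
    have k2' : (2 <= `|m - k%:Z|)%N by lia.
    have := fil_create k2' (@fil_word ks lk).
    rewrite (_ : (sumn ks)%:Z + _ = (k + sumn ks)%N%:Z - m); last by lia.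
    exact: fil_leq.
  have h' : -1 <= m - k%:Z by lia.
  have := IH r _ h' lk sk; rewrite (_ : _ - _ = (k + sumn ks)%N%:Z - m); last by lia.
  exact: fil_leq.
- rewrite /coc; case: eqP => e; last by rewrite scale0r; exact: fil0.
  apply: filZ; have := @fil_word ks lk.
  rewrite (_ : (sumn ks)%:Z = (k + sumn ks)%N%:Z - m); last by lia.
  by apply: fil_leq; lia.
Qed.

Lemma word_rcons k ks : (2 <= k)%N -> letters ks ->
  fil (k + sumn ks)%N (size ks) (L (- k%:Z) (word ks) - word (rcons ks k)).
Proof.
move=> k2; elim: ks => [|l ks IH] /=; first by move=> _; rewrite subrr; exact: fil0.
move=> /andP[l2 lk]; rewrite L_swap; last by lia.
rewrite addrAC -LB; apply: filD.
  have := fil_create l2 (IH lk).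
  by rewrite (_ : (k + sumn ks)%N%:Z + l%:Z = (k + (l + sumn ks))%N) //; lia.
apply: filZ; have kl : (2 <= k + l)%N by lia.
have := fil_create kl (@fil_word ks lk).
by rewrite (_ : (sumn ks)%:Z + (k + l)%N%:Z = (k + (l + sumn ks))%N) //; lia.
Qed.

(** Commutators shorten words, so order is irrelevant modulo shorter words. Reversal is the case
    that meets the antipode relation. *)
Lemma word_rev ks : letters ks -> fil (sumn ks)%:Z (size ks).-1 (word ks - word (rev ks)).
Proof.
elim: ks => [|k ks IH] /=; first by move=> _; rewrite subrr; exact: fil0.
move=> /andP[k2 lk]; rewrite rev_cons.
have lr : letters (rev ks) by rewrite /letters all_rev.
have := word_rcons k2 lr; rewrite size_rev sumn_rev => h1.
have -> : L (- k%:Z) (word ks) - word (rcons (rev ks) k) = L (- k%:Z) (word ks - word (rev ks))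
   + (L (- k%:Z) (word (rev ks)) - word (rcons (rev ks) k)) by rewrite LB; lmod.
apply: filD; last by rewrite PoszD in h1 *.
case: ks {h1} IH lk lr => [|l ks] IH lk lr; first by rewrite /rev /= subrr L0; exact: fil0.
have := fil_create k2 (IH lk).
by rewrite (_ : (sumn (l :: ks))%:Z + k%:Z = (k + sumn (l :: ks))%N) //; lia.
Qed.

(** The two summands come from the two sums of the normally ordered product of the divided
    derivatives of orders [a] and [b], collected by the right-hand mode [L(t - 1)]. *)
Definition kap (a b t : nat) : F :=
  (-1) ^+ b * 'C(b + t, b)%:R * 'C(a + b + 1 + t, a)%:R
  + (-1) ^+ a * 'C(a + t, a)%:R * 'C(a + b + 1 + t, b)%:R.

(* The mode of [L(-2-a)L(-2-b)1] with index [-1] applied to [v]; the terms with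
   [t >= M] vanish when [v] has weight at most [M - 2]. *)
Definition xop (a b M : nat) (v : X) : X :=
  L (- (a.+2)%:Z) (L (- (b.+2)%:Z) v)
  + \sum_(t < M) kap a b t *: L (- (a + b + 3 + t)%N%:Z) (L (t%:Z - 1) v).

Lemma fil_xop N r a b M v : fil N r v ->
  fil (N + (a + b + 4)%N%:Z) r.+1 (xop a b M v - L (- (a.+2)%:Z) (L (- (b.+2)%:Z) v)).
Proof.
move=> hv; rewrite /xop addrAC subrr add0r.
apply: (@fil_sum _ _ M (fun t => kap a b t *: L (- (a + b + 3 + t)%N%:Z) (L (t%:Z - 1) v))) => t.
have t1 : -1 <= t%:Z - 1 by lia.
have k2 : (2 <= a + b + 3 + t)%N by lia.
apply: filZ; have := fil_create k2 (fil_annih t1 hv).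
by rewrite (_ : _ + _ = N + (a + b + 4)%N%:Z) //; lia.
Qed.

(** * Consequences of the three kinds of relations in a fixed weight *)

Section Relations.
(* [Z x] abstracts the statement that [x (x) 1 + 1 (x) x] is in the span of the monomials. *)
Context (N : nat) (Z : X -> Prop).
Context (Zlin : forall a u v, Z u -> Z v -> Z (a *: u + v)) (Z00 : Z 0).
Context (Ztrans : forall ks, letters ks -> (sumn ks).+1 = N -> Z (L (-1) (word ks))).
Context (Zanti : forall ks, letters ks -> sumn ks = N ->
  Z (word ks - (-1) ^+ size ks *: word (rev ks))).
Context (Zprod : forall a b M ks, letters ks -> (a + b + 4 + sumn ks)%N = N -> (0 < sumn ks)%N ->
  (sumn ks + 2 <= M)%N ->
  Z (xop a b M (word ks) + L (- (b.+2)%:Z) (L (- (a.+2)%:Z) (word ks)))).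
Context (N_gt0 : (0 < N)%N).

Let ZD u v : Z u -> Z v -> Z (u + v).
Proof. by move=> hu hv; rewrite -[u]scale1r; exact: Zlin. Qed.
Let ZZ a u : Z u -> Z (a *: u).
Proof. by move=> hu; rewrite -[_ *: _]addr0; apply: Zlin. Qed.
Let ZB u v : Z u -> Z v -> Z (u - v).
Proof. by move=> hu hv; rewrite -scaleN1r addrC; exact: Zlin. Qed.
Let Zunit a u : a != 0 -> Z (a *: u) -> Z u.
Proof. by move=> a0 /(ZZ a^-1); rewrite scalerA mulVf // scale1r. Qed.
Let Zhalf u : Z (2%:R *: u) -> Z u.
Proof. by apply: Zunit; rewrite (natF_neq0 charF0). Qed.

Lemma Z_fil r x : (forall ks, letters ks -> (size ks <= r)%N -> sumn ks = N -> Z (word ks)) ->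
  fil N%:Z r x -> Z x.
Proof. by move=> h hx; apply: (hx Z) => // ks lk sk [wk]; exact: h. Qed.

Definition X0 := word [:: (N - 2)%N; 2%N].

Lemma Z_letter k : (2 <= k)%N -> k = N -> Z (word [:: k]).
Proof.
move=> k2 kN; have := @Zanti [:: k]; rewrite /letters /= k2 addn0 => /(_ isT kN).
rewrite expr1 scaleN1r opprK => h; apply: Zhalf.
by rewrite scaler_nat mulr2n.
Qed.

(** The relation [L(-1) L(-i) L(-k) 1] in [Z] reads [(i - 1) [i+1; k] + (k - 1) [i; k+1] = 0] modulo
    [Z]. This recursion, started at [k = 2], has the signed binomials as solution. *)
Lemma Z_quad (k i : nat) : (2 <= k)%N -> (2 <= i)%N -> (i + k)%N = N ->
  Z (word [:: i; k] - ((-1) ^+ k * 'C(N - 4, k - 2)%:R) *: X0).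
Proof.
move=> k2; rewrite -(subnK k2); elim: (k - 2)%N i => [|j IH] i i2 e.
  have -> : X0 = word [:: i; 2%N] by rewrite /X0; congr (word [:: _; _]); lia.
  by rewrite /= bin0 expr2 mulrNN !mulr1 scale1r subrr.
have lk : letters [:: i; (j + 2)%N] by rewrite /letters /= i2; lia.
have := Ztrans lk; rewrite /= addn0 => h.
have {}h : Z (L (-1) (L (- i%:Z) (L (- (j + 2)%N%:Z) vac))) by apply: h; lia.
have i3 : (2 <= i.+1)%N by lia.
have := IH i.+1 i3; rewrite (_ : i.+1 + (j + 2) = i + (j.+1 + 2))%N; last by lia.
move=> /(_ e); rewrite /= => h1.
have E : L (-1) (L (- i%:Z) (L (- (j + 2)%N%:Z) vac)) =
   (i%:R - 1) *: L (- i.+1%:Z) (L (- (j + 2)%N%:Z) vac)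
   + (j.+1)%:R *: L (- i%:Z) (L (- (j.+1 + 2)%N%:Z) vac).
  rewrite (L_swap (k := 1)) // (L_swap (k := 1)) // Lvac // L0 add0r LZ add1n.
  rewrite (_ : ((j + 2).+1 = j.+1 + 2)%N); last by lia.
  rewrite [LHS]addrC; congr (_ + _ *: _).
  by rewrite natrD; ring.
have := ZB h (ZZ (i%:R - 1) h1); rewrite E => {}h1.
have jn : (j.+1)%:R != 0 :> F by rewrite (natF_neq0 charF0).
apply: (Zunit jn).
suff -> : j.+1%:R *: (L (- i%:Z) (L (- (j.+1 + 2)%N%:Z) vac)
     - ((-1) ^+ (j.+1 + 2) * 'C(N - 4, j.+1 + 2 - 2)%:R) *: X0)
   = (i%:R - 1) *: L (- i.+1%:Z) (L (- (j + 2)%N%:Z) vac)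
      + j.+1%:R *: L (- i%:Z) (L (- (j.+1 + 2)%N%:Z) vac)
      - (i%:R - 1) *: (L (- i.+1%:Z) (L (- (j + 2)%N%:Z) vac)
        - ((-1) ^+ (j + 2) * 'C(N - 4, j + 2 - 2)%:R) *: X0) by [].
have B : j.+1%:R * 'C(N - 4, j.+1)%:R = (i%:R - 1) * 'C(N - 4, j)%:R :> F.
  have i1 : i%:R - 1 = (i - 1)%N%:R :> F by rewrite natrB //; lia.
  rewrite i1 -!natrM mul_bin_left; congr (_ * _)%:R; lia.
rewrite !addnK !exprD exprS scalerBr scalerA.
have -> : j.+1%:R * (-1 * (-1) ^+ j * (-1) ^+ 2 * 'C(N - 4, j.+1)%:R)
   = - ((-1) ^+ j * (-1) ^+ 2) * (j.+1%:R * 'C(N - 4, j.+1)%:R) :> F by ring.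
by rewrite B; lmod.
Qed.

(** For odd [N], [Z_quad] gives [[2; N-2]] the value [-X0]; but it differs from [X0] by a multiple
    of a single letter, which is in [Z]. So [2 X0] is in [Z]. *)
Lemma Z_odd : odd N -> (4 <= N)%N -> Z X0.
Proof.
move=> oN N4; have h2 : (2 <= N - 2)%N by lia.
have e : (2 + (N - 2))%N = N by lia.
have := Z_quad h2 (leqnn 2) e.
rewrite (_ : N - 2 - 2 = N - 4)%N; last by lia.
rewrite binn mulr1 -signr_odd oddB; last by lia.
rewrite oN expr1 scaleN1r opprK /= => h.
have h1 : Z (L (- N%:Z) vac) by apply: (@Z_letter N) => //; lia.
have := ZB h (ZZ ((N - 2)%N%:R - 2%:R) h1); rewrite (L_swap (k := 2)) // e => {}h.
by apply: Zhalf; rewrite scaler_nat mulr2n; move: h; rewrite /X0 /= addrAC addrK.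
Qed.

(** Induction on length. For odd length, the word plus its reverse is in [Z], and the reverse equals
    the word modulo shorter ones. For even length at least 4, both terms of [Zprod] equal the word
    modulo shorter ones. Either way twice the word is reached; length 2 is [Z_quad]. *)
Lemma Z_words r : (((4 <= N)%N && ~~ odd N) -> Z X0) ->
  forall ks, letters ks -> (size ks <= r)%N -> sumn ks = N -> Z (word ks).
Proof.
move=> hX; have {}hX : (4 <= N)%N -> Z X0.
  move=> N4; case: (boolP (odd N)) => oN; first exact: Z_odd.
  by apply: hX; rewrite N4.
elim: r => [|r IH] ks lk sk wk.
  by case: ks lk sk wk => // _ _ e; move: N_gt0; rewrite -e.
case: (ltnP (size ks) r.+1) => sr; first exact: IH.
have {sr}sk : size ks = r.+1 by lia.
case: (boolP (odd r.+1)) => od.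
  have h1 := Zanti lk wk; rewrite sk -signr_odd od expr1 scaleN1r opprK in h1.
  have h2 : Z (word ks - word (rev ks)).
    by apply: (Z_fil IH); have := word_rev lk; rewrite sk wk.
  by apply: Zhalf; rewrite scaler_nat mulr2n; have := ZD h1 h2; rewrite addrACA addrN addr0.
case: ks lk sk wk => [|k1 [|k2 ks]] // lk sk wk; first by move: od; rewrite -sk.
move: (lk); rewrite /letters /= => /and3P[k12 k22 lk'].
case: ks lk sk wk lk' => [|k3 ks] lk sk wk lk'.
  rewrite /= addn0 in wk; have := Z_quad k22 k12 wk; set a := _ * _ => h.
  have h4 : (4 <= N)%N by lia.
  by rewrite -[X in Z X](subrK (a *: X0)); apply: ZD => //; apply: ZZ; exact: hX.
set v := k3 :: ks in lk sk wk lk' *.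
have v0 : (0 < sumn v)%N by move: lk'; rewrite /v /letters /= => /andP[]; lia.
have wN : ((k1 - 2) + (k2 - 2) + 4 + sumn v)%N = N by move: wk; rewrite /=; lia.
have := Zprod lk' wN v0 (leqnn _).
have e1 : (k1 - 2).+2 = k1 by lia.
have e2 : (k2 - 2).+2 = k2 by lia.
have f1 := @fil_xop _ _ (k1 - 2)%N (k2 - 2)%N (sumn v + 2)%N _ (@fil_word v lk').
rewrite e1 e2 in f1 *.
rewrite (_ : (sumn v)%:Z + _ = N%:Z) in f1; last by lia.
have sz : (size v).+1 = r by move: sk => /= [].
rewrite sz in f1; have {}f1 := Z_fil IH f1.
rewrite (L_swap (k := k2)); last by lia.
have f2 : Z (L (- (k2 + k1)%N%:Z) (word v)).
  apply: (IH ((k2 + k1)%N :: v)).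
    + by apply/andP; split; [lia | exact: lk'].
    + by rewrite /= -/(size v) sz.
    + by move: wk => /=; lia.
move=> h; have := ZB h (ZD f1 (ZZ (k1%:R - k2%:R) f2)).
set x := xop _ _ _ _; set y := L _ (L _ _); set z := L _ _ => {}h.
apply: Zhalf; rewrite scaler_nat mulr2n; change (Z (y + y)).
by rewrite (_ : y + y = x + (y + (k1%:R - k2%:R) *: z) - (x - y + (k1%:R - k2%:R) *: z)) //; lmod.
Qed.

(** A relation and not a function, since [X0] may itself lie in [Z]: a value found for an element of
    [Z] is exactly a relation for [X0]. *)
Definition ev (x : X) (a : F) := Z (x - a *: X0).

Lemma ev_lin k x y a b : ev x a -> ev y b -> ev (k *: x + y) (k * a + b).
Proof.
rewrite /ev => hx hy; have := Zlin k hx hy.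
by rewrite (_ : k *: (x - a *: X0) + _ = k *: x + y - (k * a + b) *: X0) //; lmod.
Qed.
Lemma ev0 : ev 0 0. Proof. by rewrite /ev scale0r subr0. Qed.
Lemma evD x y a b : ev x a -> ev y b -> ev (x + y) (a + b).
Proof. by move=> hx hy; have := ev_lin 1 hx hy; rewrite scale1r mul1r. Qed.
Lemma evZ k x a : ev x a -> ev (k *: x) (k * a).
Proof. by move=> hx; have := ev_lin k hx ev0; rewrite !addr0. Qed.
Lemma ev_Z x : Z x -> ev x 0.
Proof. by rewrite /ev scale0r subr0. Qed.
Lemma ev_Zeq x a : Z x -> ev x a -> Z (a *: X0).
Proof. by move=> hx h; have := ZB hx h; rewrite opprB addrC subrK. Qed.

(** * Values of quadratic and cubic words in even weight, and the two relations for [X0] *)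

Context (N_even : ~~ odd N) (N_ge4 : (4 <= N)%N).

Definition qv (s : nat) : F := (-1) ^+ s * 'C(N - 4, s - 2)%:R.
Definition cub (A b d : nat) : F :=
  ((d%:R - b%:R) * qv (b + d) + (d%:R - A%:R) * qv b + (b%:R - A%:R) * qv d) / 2%:R.

Lemma ev_quadr (A s : nat) : (2 <= A)%N -> (2 <= s)%N -> (A + s)%N = N -> ev (word [:: A; s]) (qv s).
Proof. by move=> A2 s2 e; exact: Z_quad. Qed.

(** For even [N] the sign and the binomial of [Z_quad] are invariant under [s -> N - s], so both
    orders of the letters have the same value. *)
Lemma ev_quadl (A s : nat) : (2 <= A)%N -> (2 <= s)%N -> (A + s)%N = N -> ev (word [:: s; A]) (qv s).
Proof.
move=> A2 s2 e; rewrite addnC in e; have := Z_quad A2 s2 e.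
suff -> : (-1) ^+ A * 'C(N - 4, A - 2)%:R = qv s by [].
rewrite /qv; congr (_ * _%:R).
  by rewrite -[LHS]signr_odd -[RHS]signr_odd; move: N_even; rewrite -e oddD; case: odd; case: odd.
by rewrite -bin_sub; [congr 'C(_, _); lia | lia].
Qed.

Lemma ev_letter : ev (word [:: N]) 0.
Proof. by apply: ev_Z; apply: Z_letter => //; lia. Qed.

(** The antipode puts the word plus its reverse in [Z]; the word minus its reverse consists of three
    commutators, which are quadratic. Half the sum gives the value. *)
Lemma ev_cub A b d : (2 <= A)%N -> (2 <= b)%N -> (2 <= d)%N -> (A + b + d)%N = N ->
  ev (word [:: A; b; d]) (cub A b d).
Proof.
move=> A2 b2 d2 e.
have lk : letters [:: A; b; d] by rewrite /letters /= A2 b2 d2.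
have eN : sumn [:: A; b; d] = N by rewrite /= -e; lia.
have := Zanti lk eN; rewrite /= -[(-1) ^+ 3]signr_odd expr1 scaleN1r opprK => h1.
have h2 : ev (word [:: (b + d)%N; A]) (qv (b + d)) by apply: ev_quadl; lia.
have h3 : ev (word [:: b; (A + d)%N]) (qv b) by apply: ev_quadl; lia.
have h4 : ev (word [:: (A + b)%N; d]) (qv d) by apply: ev_quadr; lia.
have E : word [:: A; b; d] = word [:: d; b; A] + (d%:R - b%:R) *: word [:: (b + d)%N; A]
    + (d%:R - A%:R) *: word [:: b; (A + d)%N] + (b%:R - A%:R) *: word [:: (A + b)%N; d].
  have A0 : (0 < A)%N by lia.
  have b0 : (0 < b)%N by lia.
  by rewrite /= (@L_swap A b) // (@L_swap A d) // LD LZ (@L_swap b d).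
have := evZ (2%:R^-1) (evD (evD (evD (ev_Z h1) (evZ (d%:R - b%:R) h2)) (evZ (d%:R - A%:R) h3))
   (evZ (b%:R - A%:R) h4)).
have n2 : 2%:R != 0 :> F by rewrite (natF_neq0 charF0).
rewrite add0r mulrC -/(cub A b d).
suff -> : 2%:R^-1 *: (word [:: A; b; d] + word (rev [:: A; b; d]) +
   (d%:R - b%:R) *: word [:: (b + d)%N; A] + (d%:R - A%:R) *: word [:: b; (A + d)%N] +
   (b%:R - A%:R) *: word [:: (A + b)%N; d]) = word [:: A; b; d] by [].
apply: (scalerI n2); rewrite scalerA divff // scale1r.
rewrite {2}E -[rev _]/([:: d; b; A]) {1}E.
by move: (word _) (word _) (word _) (word _) => w1 w2 w3 w4; lmod.
Qed.

Lemma L_pass_lt (m k : nat) v : (m < k)%N -> L m%:Z (L (- k%:Z) v) =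
  L (- k%:Z) (L m%:Z v) + (m + k)%N%:R *: L (- (k - m)%N%:Z) v.
Proof.
move=> mk; rewrite L_pass ifF; last by lia.
by rewrite scale0r addr0 natrD (_ : m%:Z - k%:Z = - (k - m)%N%:Z) //; lia.
Qed.
Lemma L_pass_gt (m k : nat) v : (k < m)%N -> L m%:Z (L (- k%:Z) v) =
  L (- k%:Z) (L m%:Z v) + (m + k)%N%:R *: L (m - k)%N%:Z v.
Proof.
move=> mk; rewrite L_pass ifF; last by lia.
by rewrite scale0r addr0 natrD (_ : m%:Z - k%:Z = (m - k)%N%:Z) //; lia.
Qed.
Lemma L_pass_eq (m : nat) v : L m%:Z (L (- m%:Z) v) =
  L (- m%:Z) (L m%:Z v) + (m + m)%N%:R *: L 0%:Z v + (c / 12%:R * (m%:R ^+ 3 - m%:R)) *: v.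
Proof. by rewrite L_pass eqxx subrr natrD. Qed.
Lemma L_vac (m : nat) : L m%:Z vac = 0. Proof. by apply: Lvac; lia. Qed.

Lemma L1_vac : L (- 1%:Z) vac = 0. Proof. exact: Lvac. Qed.

Lemma L2_table : [/\ L 0%:Z (L (-2) vac) = 2%:R *: L (-2) vac, L 1%:Z (L (-2) vac) = 0,
  L 2%:Z (L (-2) vac) = (c / 2%:R) *: vac & forall m, L m.+3%:Z (L (-2) vac) = 0].
Proof.
split.
- by rewrite (@L_pass_lt 0 2) // L_vac L0 add0r.
- by rewrite (@L_pass_lt 1 2) // L_vac L0 add0r Lvac ?scaler0.
- rewrite (@L_pass_eq 2) !L_vac L0 scaler0 !add0r; congr (_ *: _).
  by field; rewrite ?(natF_neq0 charF0) ?oner_neq0.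
- by move=> m; rewrite (@L_pass_gt _ 2) // L_vac L0 add0r L_vac scaler0.
Qed.

(** In terms of [d = c / 12] the identities of the following tables have integer coefficients and
    are within reach of [lmod]. *)
Lemma c_twelfth : exists d, [/\ c / 12%:R = d, c / 2%:R = 6%:R * d & c = 12%:R * d].
Proof. by exists (c / 12%:R); split=> //; field; rewrite ?(natF_neq0 charF0) ?oner_neq0. Qed.

(** The vectors [L(t - 1) w] that enter [xop]: as [w] has weight 5, they stop at [L(5)], that is
    [t < 7]. The next two tables serve the same purpose in weights 4 and 6. *)
Lemma table32 : let w := word [:: 3; 2] in
  [/\ L (-1) w = 2%:R *: word [:: 4; 2] + word [:: 3; 3] /\ L 0%:Z w = 5%:R *: w,
      L 1%:Z w = 4%:R *: word [:: 2; 2], L 2%:Z w = (5%:R + c / 2%:R) *: word [:: 3],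
      L 3%:Z w = (12%:R + 2%:R * c) *: word [:: 2] & L 4%:Z w = 0 /\ L 5%:Z w = (4%:R * c) *: vac].
Proof.
have [t0 t1 t2 t3] := L2_table; have [d [c12 c2 cE]] := c_twelfth.
rewrite /=; split; first split.
- by rewrite (@L_swap 1 3) // (@L_swap 1 2) // L1_vac L0 add0r LZ; rewrite ?c12 ?c2 ?cE; lmod.
- by rewrite L_pass_lt // t0 LZ; rewrite ?c12 ?c2 ?cE; lmod.
- by rewrite L_pass_lt // t1 L0; rewrite ?c12 ?c2 ?cE; lmod.
- rewrite L_pass_lt // t2 LZ (_ : - (3 - 2)%N%:Z = - 1%:Z) //.
  by rewrite (@L_swap 1 2) // L1_vac L0; rewrite ?c12 ?c2 ?cE; lmod.
- by rewrite L_pass_eq t3 t0 L0; rewrite ?c12 ?c2 ?cE; lmod.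
split.
- by rewrite L_pass_gt // t3 t1 L0 scaler0 addr0.
- by rewrite L_pass_gt // t3 t2 L0; rewrite ?c12 ?c2 ?cE; lmod.
Qed.

Lemma table22 : let w := word [:: 2; 2] in
  [/\ L (-1) w = word [:: 3; 2] + word [:: 2; 3] /\ L 0%:Z w = 4%:R *: w,
      L 1%:Z w = 3%:R *: word [:: 3], L 2%:Z w = (8%:R + c) *: word [:: 2],
      L 3%:Z w = 0 & L 4%:Z w = (3%:R * c) *: vac].
Proof.
have [t0 t1 t2 t3] := L2_table; have [d [c12 c2 cE]] := c_twelfth.
rewrite /=; split; first split.
- by rewrite (@L_swap 1 2) // (@L_swap 1 2) // L1_vac L0 add0r LZ; rewrite ?c12 ?c2 ?cE; lmod.
- by rewrite L_pass_lt // t0 LZ; rewrite ?c12 ?c2 ?cE; lmod.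
- rewrite L_pass_lt // t1 L0 (_ : - (2 - 1)%N%:Z = - 1%:Z) //.
  by rewrite (@L_swap 1 2) // L1_vac L0; rewrite ?c12 ?c2 ?cE; lmod.
- by rewrite (L_pass_eq 2) t2 t0 LZ; rewrite ?c12 ?c2 ?cE; lmod.
- by rewrite L_pass_gt // t3 t1 L0; rewrite ?c12 ?c2 ?cE; lmod.
- by rewrite L_pass_gt // t3 t2 L0; rewrite ?c12 ?c2 ?cE; lmod.
Qed.

Lemma table42 : let w := word [:: 4; 2] in
  [/\ L (-1) w = 3%:R *: word [:: 5; 2] + word [:: 4; 3] /\ L 0%:Z w = 6%:R *: w,
      L 1%:Z w = 5%:R *: word [:: 3; 2],
      L 2%:Z w = 6%:R *: word [:: 2; 2] + (c / 2%:R) *: word [:: 4],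
      L 3%:Z w = 7%:R *: word [:: 3] /\ L 4%:Z w = (16%:R + 5%:R * c) *: word [:: 2] &
      L 5%:Z w = 0 /\ L 6%:Z w = (5%:R * c) *: vac].
Proof.
have [t0 t1 t2 t3] := L2_table; have [d [c12 c2 cE]] := c_twelfth.
rewrite /=; split; first split.
- by rewrite (@L_swap 1 4) // (@L_swap 1 2) // L1_vac L0 add0r LZ; rewrite ?c12 ?c2 ?cE; lmod.
- by rewrite L_pass_lt // t0 LZ; rewrite ?c12 ?c2 ?cE; lmod.
- by rewrite L_pass_lt // t1 L0; rewrite ?c12 ?c2 ?cE; lmod.
- by rewrite L_pass_lt // t2 LZ; rewrite ?c12 ?c2 ?cE; lmod.
- split.
    rewrite L_pass_lt // t3 L0 (_ : - (4 - 3)%N%:Z = - 1%:Z) //.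
    by rewrite (@L_swap 1 2) // L1_vac L0; rewrite ?c12 ?c2 ?cE; lmod.
  by rewrite L_pass_eq t3 t0 L0; rewrite ?c12 ?c2 ?cE; lmod.
- split.
    by rewrite L_pass_gt // t3 t1 L0; rewrite ?c12 ?c2 ?cE; lmod.
  by rewrite L_pass_gt // t3 t2 L0; rewrite ?c12 ?c2 ?cE; lmod.
Qed.
Lemma ev_corr a b M w (vals : nat -> F) :
  (forall t, (t < M)%N -> ev (L (- (a + b + 3 + t)%N%:Z) (L (t%:Z - 1) w)) (vals t)) ->
  ev (\sum_(t < M) kap a b t *: L (- (a + b + 3 + t)%N%:Z) (L (t%:Z - 1) w))
     (\sum_(t < M) kap a b t * vals t).
Proof.
elim: M => [|M IH] h; first by rewrite !big_ord0; exact: ev0.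
rewrite !big_ord_recr /=; apply: evD; last by apply: evZ; apply: h.
by apply: IH => t tM; apply: h; exact: ltnW.
Qed.

Lemma ev_single A : A = N -> ev (L (- A%:Z) vac) 0.
Proof. by move=> ->; exact: ev_letter. Qed.

Lemma ev_corr32 a b : (a + b + 9)%N = N ->
  ev (xop a b 7 (word [:: 3; 2]) - L (- (a.+2)%:Z) (L (- (b.+2)%:Z) (word [:: 3; 2])))
   (\sum_(t < 7) kap a b t * nth 0 [:: 2%:R * cub (a + b + 3) 4 2 + cub (a + b + 3) 3 3;
      5%:R * cub (a + b + 4) 3 2; 4%:R * cub (a + b + 5) 2 2; (5%:R + c / 2%:R) * qv 3;
      (12%:R + 2%:R * c) * qv 2; 0; 0] t).
Proof.
move=> e; rewrite /xop addrAC subrr add0r.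
have [[t0 t1] t2 t3 t4 [t5 t6]] := table32.
apply: (@ev_corr _ _ 7 _ (nth 0 _)).
case=> [|[|[|[|[|[|[|//]]]]]]] _; rewrite ?subr0.
- rewrite (_ : 0%:Z - 1 = -1) // t0 LD LZ addn0; apply: evD; first apply: evZ; apply: ev_cub => //; lia.
- rewrite (_ : 1%:Z - 1 = 0%:Z) // t1 LZ (_ : (_ + 1 = a + b + 4)%N); last by lia.
  by apply: evZ; apply: ev_cub => //; lia.
- rewrite (_ : 2%:Z - 1 = 1%:Z) // t2 LZ (_ : (_ + 2 = a + b + 5)%N); last by lia.
  by apply: evZ; apply: ev_cub => //; lia.
- rewrite (_ : 3%:Z - 1 = 2%:Z) // t3 LZ; apply: evZ; apply: ev_quadr => //; lia.
- rewrite (_ : 4%:Z - 1 = 3%:Z) // t4 LZ; apply: evZ; apply: ev_quadr => //; lia.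
- rewrite (_ : 5%:Z - 1 = 4%:Z) // t5 L0; exact: ev0.
(* The vacuum component leaves the single letter [N], of value 0; this explains the last 0 in the
   list. *)
- rewrite (_ : 6%:Z - 1 = 5%:Z) // t6 LZ -[nth _ _ _](mulr0 (4%:R * c)); apply: evZ.
  by apply: ev_single; lia.
Qed.

Lemma ev_corr22 a b : (a + b + 8)%N = N ->
  ev (xop a b 6 (word [:: 2; 2]) - L (- (a.+2)%:Z) (L (- (b.+2)%:Z) (word [:: 2; 2])))
   (\sum_(t < 6) kap a b t * nth 0 [:: cub (a + b + 3) 3 2 + cub (a + b + 3) 2 3;
      4%:R * cub (a + b + 4) 2 2; 3%:R * qv 3; (8%:R + c) * qv 2; 0; 0] t).
Proof.
move=> e; rewrite /xop addrAC subrr add0r.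
have [[t0 t1] t2 t3 t4 t5] := table22.
apply: (@ev_corr _ _ 6 _ (nth 0 _)).
case=> [|[|[|[|[|[|//]]]]]] _; rewrite ?subr0.
- rewrite (_ : 0%:Z - 1 = -1) // t0 LD addn0; apply: evD; apply: ev_cub => //; lia.
- rewrite (_ : 1%:Z - 1 = 0%:Z) // t1 LZ (_ : (_ + 1 = a + b + 4)%N); last by lia.
  by apply: evZ; apply: ev_cub => //; lia.
- rewrite (_ : 2%:Z - 1 = 1%:Z) // t2 LZ; apply: evZ; apply: ev_quadr => //; lia.
- rewrite (_ : 3%:Z - 1 = 2%:Z) // t3 LZ; apply: evZ; apply: ev_quadr => //; lia.
- rewrite (_ : 4%:Z - 1 = 3%:Z) // t4 L0; exact: ev0.
- rewrite (_ : 5%:Z - 1 = 4%:Z) // t5 LZ -[nth _ _ _](mulr0 (3%:R * c)); apply: evZ.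
  by apply: ev_single; lia.
Qed.

Lemma ev_corr42 a b : (a + b + 10)%N = N ->
  ev (xop a b 8 (word [:: 4; 2]) - L (- (a.+2)%:Z) (L (- (b.+2)%:Z) (word [:: 4; 2])))
   (\sum_(t < 8) kap a b t * nth 0 [:: 3%:R * cub (a + b + 3) 5 2 + cub (a + b + 3) 4 3;
      6%:R * cub (a + b + 4) 4 2; 5%:R * cub (a + b + 5) 3 2;
      6%:R * cub (a + b + 6) 2 2 + (c / 2%:R) * qv 4; 7%:R * qv 3;
      (16%:R + 5%:R * c) * qv 2; 0; 0] t).
Proof.
move=> e; rewrite /xop addrAC subrr add0r.
have [[t0 t1] t2 t3 [t4 t5] [t6 t7]] := table42.
apply: (@ev_corr _ _ 8 _ (nth 0 _)).
case=> [|[|[|[|[|[|[|[|//]]]]]]]] _; rewrite ?subr0.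
- rewrite (_ : 0%:Z - 1 = -1) // t0 LD LZ addn0; apply: evD; first apply: evZ; apply: ev_cub => //; lia.
- rewrite (_ : 1%:Z - 1 = 0%:Z) // t1 LZ (_ : (_ + 1 = a + b + 4)%N); last by lia.
  by apply: evZ; apply: ev_cub => //; lia.
- rewrite (_ : 2%:Z - 1 = 1%:Z) // t2 LZ (_ : (_ + 2 = a + b + 5)%N); last by lia.
  by apply: evZ; apply: ev_cub => //; lia.
- rewrite (_ : 3%:Z - 1 = 2%:Z) // t3 LD !LZ (_ : (_ + 3 = a + b + 6)%N); last by lia.
  by apply: evD; apply: evZ; [apply: ev_cub => //; lia | apply: ev_quadr => //; lia].
- rewrite (_ : 4%:Z - 1 = 3%:Z) // t4 LZ; apply: evZ; apply: ev_quadr => //; lia.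
- rewrite (_ : 5%:Z - 1 = 4%:Z) // t5 LZ; apply: evZ; apply: ev_quadr => //; lia.
- rewrite (_ : 6%:Z - 1 = 5%:Z) // t6 L0; exact: ev0.
- rewrite (_ : 7%:Z - 1 = 6%:Z) // t7 LZ -[nth _ _ _](mulr0 (5%:R * c)); apply: evZ.
  by apply: ev_single; lia.
Qed.

Definition sum32 a b : F := \sum_(t < 7) kap a b t * nth 0
  [:: 2%:R * cub (a + b + 3) 4 2 + cub (a + b + 3) 3 3;
      5%:R * cub (a + b + 4) 3 2; 4%:R * cub (a + b + 5) 2 2; (5%:R + c / 2%:R) * qv 3;
      (12%:R + 2%:R * c) * qv 2; 0; 0] t.
Definition sum22 a b : F := \sum_(t < 6) kap a b t * nth 0
  [:: cub (a + b + 3) 3 2 + cub (a + b + 3) 2 3;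
      4%:R * cub (a + b + 4) 2 2; 3%:R * qv 3; (8%:R + c) * qv 2; 0; 0] t.
Definition sum42 a b : F := \sum_(t < 8) kap a b t * nth 0
  [:: 3%:R * cub (a + b + 3) 5 2 + cub (a + b + 3) 4 3;
      6%:R * cub (a + b + 4) 4 2; 5%:R * cub (a + b + 5) 3 2;
      6%:R * cub (a + b + 6) 2 2 + (c / 2%:R) * qv 4; 7%:R * qv 3;
      (16%:R + 5%:R * c) * qv 2; 0; 0] t.

(** The two sums are the corrections of the two [xop]; the cubic terms arise on sorting the quartic
    words into [L(-K)L(-3)L(-2)L(-2)1]. Each product contains its quartic word twice, in [xop] and
    in the term moved by the antipode, hence the factor 2. In [valB] the commutator of [L(-2)] and
    [L(-4)] doubles it to 4. *)
Definition valA a : F := sum32 a 0 - sum22 a 1 + 2%:R * cub a.+2 5 2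
  + a%:R * cub (a + 4) 3 2 - (a%:R - 1) * cub (a + 5) 2 2.
Definition valB a : F := sum42 a 0 - sum22 a 2 + 4%:R * cub a.+2 6 2
  + a%:R * cub (a + 4) 4 2 - (a%:R - 2%:R) * cub (a + 6) 2 2.

(* With [K = a + 2]: compare [L(-K)L(-2)1] applied to [L(-3)L(-2)1] with [L(-K)L(-3)1]
   applied to [L(-2)L(-2)1]; the terms of length four are equal up to shorter words. *)
Lemma relA a : (a + 9)%N = N -> Z (valA a *: X0).
Proof.
move=> e; set K := a.+2.
have z1 := @Zprod a 0 7 [:: 3%N; 2%N] isT; have z2 := @Zprod a 1 6 [:: 2%N; 2%N] isT.
have {z1}z1 : Z (xop a 0 7 (word [:: 3; 2]) + L (- 2%:Z) (L (- K%:Z) (word [:: 3; 2]))).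
  by apply: z1 => //=; lia.
have {z2}z2 : Z (xop a 1 6 (word [:: 2; 2]) + L (- 3%:Z) (L (- K%:Z) (word [:: 2; 2]))).
  by apply: z2 => //=; lia.
have h1 : ev (xop a 0 7 (word [:: 3; 2]) - L (- K%:Z) (L (- 2%:Z) (word [:: 3; 2]))) (sum32 a 0).
  by apply: (@ev_corr32 a 0); lia.
have h2 : ev (xop a 1 6 (word [:: 2; 2]) - L (- K%:Z) (L (- 3%:Z) (word [:: 2; 2]))) (sum22 a 1).
  by apply: (@ev_corr22 a 1); lia.
have h3 : ev (word [:: K; 5; 2]) (cub K 5 2) by apply: ev_cub => //; lia.
have h4 : ev (word [:: (a + 4)%N; 3; 2]) (cub (a + 4) 3 2) by apply: ev_cub => //; lia.
have h5 : ev (word [:: (a + 5)%N; 2; 2]) (cub (a + 5) 2 2) by apply: ev_cub => //; lia.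
apply: (ev_Zeq (ZB z1 z2)); rewrite /valA.
have K0 : (0 < K)%N by [].
have e1 : L (- 2%:Z) (L (- K%:Z) (word [:: 3; 2])) =
   L (- K%:Z) (L (- 2%:Z) (word [:: 3; 2])) + a%:R *: word [:: (a + 4)%N; 3; 2].
  rewrite (@L_swap 2 K) // (_ : (2 + K = a + 4)%N); last by rewrite /K; lia.
  by congr (_ + _ *: _); rewrite /K; ring.
have e2 : L (- 3%:Z) (L (- K%:Z) (word [:: 2; 2])) =
   L (- K%:Z) (L (- 3%:Z) (word [:: 2; 2])) + (a%:R - 1) *: word [:: (a + 5)%N; 2; 2].
  rewrite (@L_swap 3 K) // (_ : (3 + K = a + 5)%N); last by rewrite /K; lia.
  by congr (_ + _ *: _); rewrite /K; ring.
have e3 : L (- K%:Z) (L (- 2%:Z) (word [:: 3; 2])) =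
   L (- K%:Z) (L (- 3%:Z) (word [:: 2; 2])) + word [:: K; 5; 2].
  by rewrite /= (@L_swap 2 3) // LD (_ : 3%:R - 2%:R = 1) ?scale1r //; ring.
have := evD (evD (evD (evD h1 (evZ (-1) h2)) (evZ 2%:R h3)) (evZ a%:R h4)) (evZ (-(a%:R - 1)) h5).
rewrite e1 e2 e3 !mulN1r !mulNr.
set x1 := xop a 0 7 _; set x2 := xop a 1 6 _.
set y := L (- K%:Z) (L (- 3%:Z) (word [:: 2; 2])).
set u1 := word [:: K; 5; 2]; set u2 := word [:: (a + 4)%N; 3; 2]; set u3 := word [:: (a + 5)%N; 2; 2].
move: x1 x2 y u1 u2 u3 {z1 z2 h1 h2 h3 h4 h5 e1 e2 e3} => x1 x2 y u1 u2 u3.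
by rewrite (_ : _ + _ *: u2 + - _ *: u3 =
  x1 + (y + u1 + a%:R *: u2) - (x2 + (y + (a%:R - 1) *: u3))) //; lmod.
Qed.

(* As [relA], for [L(-K)L(-2)1] on [L(-4)L(-2)1] and [L(-K)L(-4)1] on [L(-2)L(-2)1]. *)
Lemma relB a : (a + 10)%N = N -> Z (valB a *: X0).
Proof.
move=> e; set K := a.+2.
have z1 := @Zprod a 0 8 [:: 4%N; 2%N] isT; have z2 := @Zprod a 2 6 [:: 2%N; 2%N] isT.
have {z1}z1 : Z (xop a 0 8 (word [:: 4; 2]) + L (- 2%:Z) (L (- K%:Z) (word [:: 4; 2]))).
  by apply: z1 => //=; lia.
have {z2}z2 : Z (xop a 2 6 (word [:: 2; 2]) + L (- 4%:Z) (L (- K%:Z) (word [:: 2; 2]))).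
  by apply: z2 => //=; lia.
have h1 : ev (xop a 0 8 (word [:: 4; 2]) - L (- K%:Z) (L (- 2%:Z) (word [:: 4; 2]))) (sum42 a 0).
  by apply: (@ev_corr42 a 0); lia.
have h2 : ev (xop a 2 6 (word [:: 2; 2]) - L (- K%:Z) (L (- 4%:Z) (word [:: 2; 2]))) (sum22 a 2).
  by apply: (@ev_corr22 a 2); lia.
have h3 : ev (word [:: K; 6; 2]) (cub K 6 2) by apply: ev_cub => //; lia.
have h4 : ev (word [:: (a + 4)%N; 4; 2]) (cub (a + 4) 4 2) by apply: ev_cub => //; lia.
have h5 : ev (word [:: (a + 6)%N; 2; 2]) (cub (a + 6) 2 2) by apply: ev_cub => //; lia.
apply: (ev_Zeq (ZB z1 z2)); rewrite /valB.
have K0 : (0 < K)%N by [].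
have e1 : L (- 2%:Z) (L (- K%:Z) (word [:: 4; 2])) =
   L (- K%:Z) (L (- 2%:Z) (word [:: 4; 2])) + a%:R *: word [:: (a + 4)%N; 4; 2].
  rewrite (@L_swap 2 K) // (_ : (2 + K = a + 4)%N); last by rewrite /K; lia.
  by congr (_ + _ *: _); rewrite /K; ring.
have e2 : L (- 4%:Z) (L (- K%:Z) (word [:: 2; 2])) =
   L (- K%:Z) (L (- 4%:Z) (word [:: 2; 2])) + (a%:R - 2%:R) *: word [:: (a + 6)%N; 2; 2].
  rewrite (@L_swap 4 K) // (_ : (4 + K = a + 6)%N); last by rewrite /K; lia.
  by congr (_ + _ *: _); rewrite /K; ring.
have e3 : L (- K%:Z) (L (- 2%:Z) (word [:: 4; 2])) =
   L (- K%:Z) (L (- 4%:Z) (word [:: 2; 2])) + 2%:R *: word [:: K; 6; 2].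
  by rewrite /= (@L_swap 2 4) // LD LZ (_ : 4%:R - 2%:R = 2%:R) //; ring.
have := evD (evD (evD (evD h1 (evZ (-1) h2)) (evZ 4%:R h3)) (evZ a%:R h4)) (evZ (-(a%:R - 2%:R)) h5).
rewrite e1 e2 e3 !mulN1r !mulNr.
set x1 := xop a 0 8 _; set x2 := xop a 2 6 _.
set y := L (- K%:Z) (L (- 4%:Z) (word [:: 2; 2])).
set u1 := word [:: K; 6; 2]; set u2 := word [:: (a + 4)%N; 4; 2]; set u3 := word [:: (a + 6)%N; 2; 2].
move: x1 x2 y u1 u2 u3 {z1 z2 h1 h2 h3 h4 h5 e1 e2 e3} => x1 x2 y u1 u2 u3.
by rewrite (_ : _ + _ *: u2 + - _ *: u3 =
  x1 + (y + 2%:R *: u1 + a%:R *: u2) - (x2 + (y + (a%:R - 2%:R) *: u3))) //; lmod.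
Qed.

Lemma sgn_odd a : odd a -> (-1) ^+ a = -1 :> F.
Proof. by move=> o; rewrite -signr_odd o expr1. Qed.
Lemma sgn_even a : ~~ odd a -> (-1) ^+ a = 1 :> F.
Proof. by move=> o; rewrite -signr_odd (negPf o) expr0. Qed.

(** For the values of [b] in use, [kap] becomes a polynomial in [a] for each numeral [t], apart from
    the sign. *)
Lemma kap0 a t : kap a 0 t = rising a%:R t.+1 + (-1) ^+ a * rising a%:R t.
Proof.
have e1 : (a + 0 + 1 + t = a + t.+1)%N by lia.
by rewrite /kap !bin0 expr0 !mul1r mulr1 -!(bin_rising charF0) e1.
Qed.
Lemma kap1 a t : kap a 1 t = - t.+1%:R * rising a%:R t.+2 + (-1) ^+ a * rising a%:R t * (a%:R + t%:R + 2%:R).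
Proof.
have e1 : (a + 1 + 1 + t = a + t.+2)%N by lia.
have e2 : (a + t + 2 = a + t.+2)%N by lia.
by rewrite /kap !bin1 expr1 -!(bin_rising charF0) mulN1r -!natrD e1 e2 add1n.
Qed.
Lemma kap2 a t : kap a 2 t = falling (t%:R + 2%:R) 2 * rising a%:R t.+3
  + (-1) ^+ a * rising a%:R t * falling (a%:R + t%:R + 3%:R) 2.
Proof.
have e1 : (a + 2 + 1 + t = a + t.+3)%N by lia.
have e2 : (a + t + 3 = a + t.+3)%N by lia.
by rewrite /kap sqrrN expr1n mul1r -!(bin_rising charF0) -!natrD -!(bin_falling charF0) e1 e2 (addnC 2 t).
Qed.

Lemma qvE m s : (m + 4)%N = N -> qv s = (-1) ^+ s * falling m%:R (s - 2).
Proof. by move=> e; rewrite /qv (bin_falling charF0) (_ : N - 4 = m)%N //; lia. Qed.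

(** Evenness of [N] fixes the sign [(-1)^a], and the sums have a fixed number of terms, so this is a
    polynomial identity in [a] and [c] with rational coefficients. *)
Lemma valA_eq a : (a + 9)%N = N -> valA a =
  c * (N%:R * (N%:R - 6%:R) * (N%:R - 7%:R) * (N%:R - 8%:R) * (7%:R * N%:R - 23%:R)) / 240%:R
  - N%:R * (N%:R - 2%:R) * (N%:R - 4%:R) * (N%:R - 6%:R) * (N%:R - 8%:R) / 15%:R.
Proof.
move=> e; have oa : odd a by move: N_even; rewrite -e oddD; case: odd.
have em : ((a + 5) + 4)%N = N by rewrite -e; lia.
rewrite /valA /sum32 /sum22 !big_ord_recr !big_ord0 /= !kap0 !kap1 (sgn_odd oa) /cub !(qvE _ em).
rewrite -e /=.
by field; rewrite ?(natF_neq0 charF0) ?oner_neq0.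
Qed.

Lemma valB_eq a : (a + 10)%N = N -> 3%:R * valB a =
  (N%:R - 10%:R) * (c * (N%:R * (N%:R - 6%:R) * (N%:R - 7%:R) * (N%:R - 8%:R) * (7%:R * N%:R - 23%:R)) / 240%:R
  - N%:R * (N%:R - 2%:R) * (N%:R - 4%:R) * (N%:R - 6%:R) * (N%:R - 8%:R) / 15%:R)
  - c * (N%:R * (N%:R - 1) * (N%:R - 7%:R) * (N%:R - 8%:R) * (N%:R - 10%:R) * (3%:R * N%:R - 17%:R)) / 160%:R.
Proof.
move=> e; have ea : ~~ odd a by move: N_even; rewrite -e oddD; case: odd.
have em : ((a + 6) + 4)%N = N by rewrite -e; lia.
rewrite /valB /sum42 /sum22 !big_ord_recr !big_ord0 /= !kap0 !kap2 (sgn_even ea) /cub !(qvE _ em).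
rewrite -e /=.
by field; rewrite ?(natF_neq0 charF0) ?oner_neq0.
Qed.

Lemma Z_X0_10 : N = 10%N -> c != 256%:R / 47%:R -> Z X0.
Proof.
move=> e hc; have e1 : (1 + 9)%N = N by rewrite e.
apply: (Zunit _ (relA e1)); rewrite (valA_eq e1) e.
have -> : c * (10%:R * (10%:R - 6%:R) * (10%:R - 7%:R) * (10%:R - 8%:R) * (7%:R * 10%:R - 23%:R)) / 240%:R -
  10%:R * (10%:R - 2%:R) * (10%:R - 4%:R) * (10%:R - 6%:R) * (10%:R - 8%:R) / 15%:R
  = 47%:R * (c - 256%:R / 47%:R) by field; rewrite ?(natF_neq0 charF0) ?oner_neq0.
by rewrite mulf_neq0 ?subr_eq0 // (natF_neq0 charF0).
Qed.

(** For given [N], [valA] is affine in [c] and has one root, which is not 0. For [c] nonzero the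
    combination with [valB] leaves [c] times factors that stay nonzero for [N >= 12]. *)
Lemma Z_X0_12 : (12 <= N)%N -> Z X0.
Proof.
move=> N12; have e1 : (N - 9 + 9)%N = N by lia.
have e2 : (N - 10 + 10)%N = N by lia.
have zA := relA e1; have zB := relB e2.
(* Every linear factor is written as a successor, which is nonzero in characteristic 0. *)
have sub k : (k < N)%N -> exists j, N%:R - k%:R = j.+1%:R :> F.
  by move=> kN; exists (N - k.+1)%N; rewrite -natrB; [congr _%:R; lia | lia].
have [j1 h1] := sub 1%N ltac:(lia); have [j2 h2] := sub 2%N ltac:(lia).
have [j4 h4] := sub 4%N ltac:(lia); have [j6 h6] := sub 6%N ltac:(lia).
have [j7 h7] := sub 7%N ltac:(lia); have [j8 h8] := sub 8%N ltac:(lia).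
have [j10 h10] := sub 10%N ltac:(lia).
have [j17 h17] : exists j, 3%:R * N%:R - 17%:R = j.+1%:R :> F.
  by exists (3 * N - 18)%N; rewrite -natrM -natrB; [congr _%:R; lia | lia].
have hN : N%:R != 0 :> F by have := (natF_neq0 charF0) N.-1; rewrite prednK // => ->.
have := valA_eq e1; have := valB_eq e2; case: (eqVneq c 0) => [-> _ vA|c0 vB vA].
  apply: (Zunit _ zA); rewrite vA mul0r mul0r sub0r oppr_eq0.
  by rewrite h2 h4 h6 h8 !mulf_neq0 ?invr_eq0 ?(natF_neq0 charF0).
have := Zlin (3%:R) zB (ZZ (- (N%:R - 10%:R)) zA); rewrite !scalerA -scalerDl.
rewrite vB vA mulNr addrAC subrr add0r; apply: Zunit; rewrite oppr_eq0.
by rewrite h1 h7 h8 h10 h17 !mulf_neq0 ?invr_eq0 ?(natF_neq0 charF0).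
Qed.

End Relations.
End Reduction.

(** * The orbifold of the tensor square *)

Section ModeOfQuadratic.
Context (F : fieldType) (charF0 : [pchar F] =i pred0) (X : lmodType F).
Context (L : int -> X -> X) (lL : forall n, linear (L n)).

Lemma binomz_falling p m : binomz F p m = falling p%:~R m.
Proof.
elim: m => [|m IH]; first by rewrite /binomz big_ord0 fact0 divr1.
rewrite /= -IH /binomz big_ord_recr factS natrM invfM /=; ring.
Qed.

Lemma binomz_nat (n k : nat) : binomz F n%:Z k = 'C(n, k)%:R.
Proof. by rewrite binomz_falling (bin_falling charF0). Qed.

Lemma binomz_neg (j a : nat) : (-1) ^+ a * binomz F (-1 - j%:Z) a = 'C(a + j, a)%:R.
Proof.
rewrite binomz_falling addnC -bin_sub ?leq_addl // addnK (bin_rising charF0).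
elim: a => [|a IH] /=; first by rewrite mulr1.
by rewrite -IH exprS; ring.
Qed.

Definition omega_field : field X := fun n => L (n - 1).

Lemma sum_tail p T (f : nat -> X) : (forall j, (0 < j <= p)%N -> f j = 0) ->
  \sum_(j < p.+1 + T) f j = f 0%N + \sum_(t < T) f (p.+1 + t)%N.
Proof.
move=> h; rewrite big_split_ord /= big_ord_recl /= big1 ?addr0 // => j _.
by apply: h; have := ltn_ord j; rewrite /= /bump /=; lia.
Qed.

Lemma sum_head p T (f : nat -> X) : (forall j, (j < p)%N -> f j = 0) ->
  \sum_(j < p + T) f j = \sum_(t < T) f (p + t)%N.
Proof. by move=> h; rewrite big_split_ord /= big1 ?add0r // => j _; exact: h. Qed.

(** The binomials [C(j - 1, b)] for [0 < j <= b] and [C(j, a)] for [j < a] vanish. The term [j = 0]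
    of the first sum is the leading product; the substitutions [j = b + 1 + t] and [j = a + t] turn
    the rest into multiples of the same vectors. *)
Lemma xop_nop a b M u : (forall t : nat, (M <= t)%N -> L (t%:Z - 1) u = 0) ->
  eventually (fun T =>
    \sum_(j < T) dpow a omega_field (-1 - j%:Z) (dpow b omega_field (-1 + j%:Z) u)
    + \sum_(j < T) dpow b omega_field (-1 - 1 - j%:Z) (dpow a omega_field j%:Z u)
    = xop L a b M u).
Proof.
move=> hM; exists (a + b + M).+1 => T hT.
have lO : flinear omega_field by move=> n; exact: lL.
pose f t := L (- (a + b + 3 + t)%N%:Z) (L (t%:Z - 1) u).
have cut S (k : nat -> F) : (M <= S)%N -> \sum_(t < S) k t *: f t = \sum_(t < M) k t *: f t.
  move=> MS; rewrite -(subnKC MS) big_split_ord /= [X in _ + X]big1 ?addr0 // => t _.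
  by rewrite /f hM ?(fieldZ lO) ?(field0 lL) ?scaler0 // leq_addr.
have e1 : \sum_(j < T) dpow a omega_field (-1 - j%:Z) (dpow b omega_field (-1 + j%:Z) u)
   = L (- (a.+2)%:Z) (L (- (b.+2)%:Z) u)
     + \sum_(t < M) ((-1) ^+ b * 'C(b + t, b)%:R * 'C(a + b + 1 + t, a)%:R) *: f t.
  have -> : T = (b.+1 + (T - b.+1))%N by lia.
  rewrite (@sum_tail _ _ (fun j => dpow a omega_field (-1 - j%:Z) (dpow b omega_field (-1 + j%:Z) u))).
    congr (_ + _).
      rewrite !dpowE ?subr0 ?addr0 !(binomzN1 charF0) !scale1r /omega_field.
      by congr (L _ (L _ u)); lia.
    rewrite -(cut (T - b.+1)%N (fun t => (-1) ^+ b * 'C(b + t, b)%:R * 'C(a + b + 1 + t, a)%:R)); last by lia.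
    apply: eq_bigr => t _; rewrite !dpowE (fieldZ lO) scalerA binomz_neg.
    rewrite (_ : -1 + (b.+1 + t)%N%:Z = (b + t)%N%:Z); last by lia.
    rewrite binomz_nat (_ : (a + (b.+1 + t) = a + b + 1 + t)%N); last by lia.
    rewrite /f /omega_field; congr (_ *: L _ (L _ u)); [ring | lia | lia].
  move=> j /andP[j0 jb]; rewrite [dpow b _ _ _]dpowE (_ : -1 + j%:Z = (j - 1)%N%:Z); last by lia.
  rewrite binomz_nat bin_small; last by lia.
  by rewrite mulr0 scale0r dpowE (field0 lO) scaler0.
have e2 : \sum_(j < T) dpow b omega_field (-1 - 1 - j%:Z) (dpow a omega_field j%:Z u)
   = \sum_(t < M) ((-1) ^+ a * 'C(a + t, a)%:R * 'C(a + b + 1 + t, b)%:R) *: f t.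
  have -> : T = (a + (T - a))%N by lia.
  rewrite (@sum_head _ _ (fun j => dpow b omega_field (-1 - 1 - j%:Z) (dpow a omega_field j%:Z u))).
    rewrite -(cut (T - a)%N (fun t => (-1) ^+ a * 'C(a + t, a)%:R * 'C(a + b + 1 + t, b)%:R)); last by lia.
    apply: eq_bigr => t _; rewrite !dpowE (fieldZ lO) scalerA binomz_nat.
    rewrite (_ : -1 - 1 - (a + t)%N%:Z = -1 - (a + t).+1%:Z); last by lia.
    rewrite binomz_neg (_ : (b + (a + t).+1 = a + b + 1 + t)%N); last by lia.
    rewrite /f /omega_field; congr (_ *: L _ (L _ u)); [ring | lia | lia].
  move=> j ja; rewrite [dpow a _ _ _]dpowE binomz_nat bin_small //.
  by rewrite mulr0 scale0r dpowE (field0 lO) scaler0.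
rewrite e1 e2 /xop -addrA -big_split; congr (_ + _); apply: eq_bigr => t _.
by rewrite /= -scalerDl.
Qed.
End ModeOfQuadratic.

(** * The tensor square of a free module *)

Section TensorSquare.
Context (F : fieldType) (K : choiceType).
Local Notation X := {malg F[K]}.
Local Notation Y := {malg F[(K * K)%type]}.

(** This and the next three definitions are [tens], [on1], [on2] and [swap2] over an arbitrary
    basis; at [vkey] they are convertible to them. *)
Definition tensor (a b : X) : Y :=
  \sum_(x <- msupp a) \sum_(y <- msupp b) (a@_x * b@_y) *: << (x, y) >>.
Definition tmap1 (f : X -> X) (v : Y) : Y :=
  \sum_(p <- msupp v) v@_p *: tensor (f << p.1 >>) << p.2 >>.
Definition tmap2 (f : X -> X) (v : Y) : Y :=
  \sum_(p <- msupp v) v@_p *: tensor << p.1 >> (f << p.2 >>).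
Definition tswap (v : Y) : Y := \sum_(p <- msupp v) v@_p *: << (p.2, p.1) >>.

Lemma tensorE a b : tensor a b = lext (fun x => lext (fun y => << (x, y) >> : Y) b) a.
Proof.
apply: eq_bigr => x _; rewrite /lext scaler_sumr; apply: eq_bigr => y _.
by rewrite scalerA.
Qed.

Lemma lext_lin_fun (f g : K -> Y) k a :
  lext (fun x => k *: f x + g x) a = k *: lext f a + lext g a.
Proof.
by rewrite /lext scaler_sumr -big_split; apply: eq_bigr => x _ /=; lmod.
Qed.

Lemma tensorPl k a a' b : tensor (k *: a + a') b = k *: tensor a b + tensor a' b.
Proof. by rewrite !tensorE linearP. Qed.

Lemma tensorPr k a b b' : tensor a (k *: b + b') = k *: tensor a b + tensor a b'.
Proof.
rewrite !tensorE; pose h b x := lext (fun y => << (x, y) >> : Y) b.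
rewrite (eq_lext (g := fun x => k *: h b x + h b' x)) ?lext_lin_fun // => x _.
exact: linearP.
Qed.

Lemma tensorU x y : tensor << x >> << y >> = << (x, y) >>.
Proof. by rewrite tensorE !lextU. Qed.

Lemma tmap1_linear f : linear (tmap1 f).
Proof. exact: (lext_is_linear (fun p : K * K => tensor (f << p.1 >>) << p.2 >>)). Qed.
Lemma tmap2_linear f : linear (tmap2 f).
Proof. exact: (lext_is_linear (fun p : K * K => tensor << p.1 >> (f << p.2 >>))). Qed.
Lemma tswap_linear : linear tswap.
Proof. exact: (lext_is_linear (fun p : K * K => << (p.2, p.1) >> : Y)). Qed.

HB.instance Definition _ f := GRing.isLinear.Build F Y Y *:%R (tmap1 f) (tmap1_linear f).
HB.instance Definition _ f := GRing.isLinear.Build F Y Y *:%R (tmap2 f) (tmap2_linear f).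
HB.instance Definition _ := GRing.isLinear.Build F Y Y *:%R tswap tswap_linear.

Lemma tmap1U f p : tmap1 f << p >> = tensor (f << p.1 >>) << p.2 >>.
Proof. exact: (lextU (fun p : K * K => tensor (f << p.1 >>) << p.2 >>)). Qed.
Lemma tmap2U f p : tmap2 f << p >> = tensor << p.1 >> (f << p.2 >>).
Proof. exact: (lextU (fun p : K * K => tensor << p.1 >> (f << p.2 >>))). Qed.
Lemma tswapU p : tswap << p >> = << (p.2, p.1) >>.
Proof. exact: (lextU (fun p : K * K => << (p.2, p.1) >> : Y)). Qed.

Lemma malg_lin_ind (H : choiceType) (P : {malg F[H]} -> Prop) :
  P 0 -> (forall a u v, P u -> P v -> P (a *: u + v)) -> (forall k, P << k >>) -> forall v, P v.
Proof. by move=> h0 hl hk v; rewrite [v]malgEZ; elim/big_rec: _ => // k x _; apply: hl. Qed.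

Lemma tensor_eq2 (M : lmodType F) (f g : X -> X -> M) :
  (forall b, linear (f^~ b)) -> (forall a, linear (f a)) ->
  (forall b, linear (g^~ b)) -> (forall a, linear (g a)) ->
  (forall x y, f << x >> << y >> = g << x >> << y >>) -> forall a b, f a b = g a b.
Proof.
have z (k : X -> M) : linear k -> k 0 = 0.
  by move=> lk; have := lk (-1) 0 0; rewrite scaler0 addr0 scaleN1r addNr.
move=> fl fr gl gr h a b; elim/malg_lin_ind: a => [|k u v hu hv|x].
- by rewrite (z _ (fl b)) (z _ (gl b)).
- by rewrite (fl b) (gl b) hu hv.
elim/malg_lin_ind: b => [|k u v hu hv|y].
- by rewrite (z _ (fr _)) (z _ (gr _)).
- by rewrite (fr _) (gr _) hu hv.
- exact: h.
Qed.

Lemma tmap1_tensor f a b : linear f -> tmap1 f (tensor a b) = tensor (f a) b.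
Proof.
move=> lf; apply: (tensor_eq2 (f := fun a b => tmap1 f (tensor a b)) (g := fun a b => tensor (f a) b)).
- by move=> y k u v; rewrite tensorPl linearP.
- by move=> x k u v; rewrite tensorPr linearP.
- by move=> y k u v; rewrite lf tensorPl.
- by move=> x k u v; rewrite tensorPr.
- by move=> x y; rewrite tensorU tmap1U.
Qed.

Lemma tmap2_tensor f a b : linear f -> tmap2 f (tensor a b) = tensor a (f b).
Proof.
move=> lf; apply: (tensor_eq2 (f := fun a b => tmap2 f (tensor a b)) (g := fun a b => tensor a (f b))).
- by move=> y k u v; rewrite tensorPl linearP.
- by move=> x k u v; rewrite tensorPr linearP.
- by move=> y k u v; rewrite tensorPl.
- by move=> x k u v; rewrite lf tensorPr.
- by move=> x y; rewrite tensorU tmap2U.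
Qed.

Lemma tswap_tensor a b : tswap (tensor a b) = tensor b a.
Proof.
apply: (tensor_eq2 (f := fun a b => tswap (tensor a b)) (g := fun a b => tensor b a)).
- by move=> y k u v; rewrite tensorPl linearP.
- by move=> x k u v; rewrite tensorPr linearP.
- by move=> y k u v; rewrite tensorPr.
- by move=> x k u v; rewrite tensorPl.
- by move=> x y; rewrite !tensorU tswapU.
Qed.

Lemma tensor_ind (P : Y -> Prop) :
  P 0 -> (forall a u v, P u -> P v -> P (a *: u + v)) -> (forall x y, P (tensor << x >> << y >>)) ->
  forall v, P v.
Proof. by move=> h0 hl hk; apply: malg_lin_ind => // -[x y]; rewrite -tensorU. Qed.

Lemma supported_tensor (P Q : pred K) (R : pred (K * K)) a b :
  supported P a -> supported Q b -> (forall x y, P x -> Q y -> R (x, y)) ->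
  supported R (tensor a b).
Proof.
move=> ha hb h; rewrite tensorE; apply: supported_lext ha _ => x Px.
by apply: supported_lext hb _ => y Qy; apply: supportedU; exact: h.
Qed.

End TensorSquare.

(** * The grading of the square and the fields of the two Virasoro vectors *)

Section ConcreteSquare.
Context (F : fieldType) (K : choiceType) (wk : K -> nat).
Local Notation X := {malg F[K]}.
Local Notation Y := {malg F[(K * K)%type]}.
Context (L : int -> X -> X).

Definition weighted (N : int) (v : X) := supported (fun x => (wk x)%:Z == N) v.

Context (lL : forall n, linear (L n)).
Context (wL : forall (N n : int) v, weighted N v -> weighted (N - n) (L n v)).

Definition tweighted (N : int) (v : Y) := supported (fun p => (wk p.1 + wk p.2)%N%:Z == N) v.

Lemma tweighted0 N : tweighted N 0. Proof. exact: supported0. Qed.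
Lemma tweighted_lin N a u v : tweighted N u -> tweighted N v -> tweighted N (a *: u + v).
Proof. by move=> hu hv; apply: supportedD => //; exact: supportedZ. Qed.
Lemma tweighted_neg N v : tweighted N v -> N < 0 -> v = 0.
Proof.
move=> hv hN; apply/malgP => x; rewrite mcoeff0; apply: mcoeff_outdom.
by apply/negP => /hv /eqP; lia.
Qed.

Lemma tweighted_tensor N M a b : weighted N a -> weighted M b -> tweighted (N + M) (tensor a b).
Proof.
by move=> ha hb; apply: supported_tensor ha hb _ => x y /eqP hx /eqP hy /=; apply/eqP; lia.
Qed.

Definition tfield (e : bool) : field Y := fun n => if e then tmap1 (L (n - 1)) else tmap2 (L (n - 1)).

Lemma tfield_linear e : flinear (tfield e).
Proof. by move=> n a u v; rewrite /tfield; case: e; rewrite linearP. Qed.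

Lemma tfield_tensor e n a b : tfield e n (tensor a b) =
  if e then tensor (L (n - 1) a) b else tensor a (L (n - 1) b).
Proof. by rewrite /tfield; case: e; rewrite ?tmap1_tensor ?tmap2_tensor. Qed.

Lemma tweighted_field e (N n : int) v : tweighted N v -> tweighted (N + 2 - n - 1) (tfield e n v).
Proof.
move=> hv; rewrite [v]malgEZ (field_sum (@tfield_linear e)); apply: supported_sum => -[x y] xy _.
rewrite (fieldZ (@tfield_linear e)); apply: supportedZ; rewrite -tensorU tfield_tensor.
have /eqP /= <- := hv _ xy.
have hx z : weighted (wk z) << z >> by apply: supportedU.
case: (e).
  have := tweighted_tensor (@wL _ (n - 1) _ (hx x)) (hx y).
  by rewrite (_ : _ + _ = (wk x + wk y)%N%:Z + 2 - n - 1) //; lia.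
have := tweighted_tensor (hx x) (@wL _ (n - 1) _ (hx y)).
by rewrite (_ : _ + _ = (wk x + wk y)%N%:Z + 2 - n - 1) //; lia.
Qed.

Lemma tfield_truncated e : truncated (tfield e).
Proof.
apply: malg_lin_ind => [|a u v [n1 h1] [n2 h2]|p].
- by exists 0 => n _; rewrite (field0 (@tfield_linear e)).
- exists (Num.max n1 n2) => n; rewrite ge_max => /andP[? ?].
  by rewrite tfield_linear h1 // h2 // scaler0 addr0.
exists (wk p.1 + wk p.2 + 2)%N%:Z => n hn.
have hp : tweighted (wk p.1 + wk p.2)%N << p >> by exact: supportedU.
by apply: (tweighted_neg (@tweighted_field e _ n _ hp)); lia.
Qed.

End ConcreteSquare.

(** * Generation of the invariants, for an abstract tensor square *)

Section Orbifold.
Context (F : fieldType) (charF0 : [pchar F] =i pred0) (c : F) (X Y : lmodType F).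
Context (L : int -> X -> X) (vac : X) (weighted : int -> X -> Prop).
Context (lL : forall n, linear (L n)) (virL : forall m n v, vir_rel c L m n v).
Context (wL : forall (N n : int) v, weighted N v -> weighted (N - n) (L n v)) (wvac : weighted 0 vac).
Context (wneg : forall N v, weighted N v -> N < 0 -> v = 0).
Context (Lvac : forall n : int, -1 <= n -> L n vac = 0).
Context (indL : forall P : X -> Prop, P vac -> (forall a u v, P u -> P v -> P (a *: u + v)) ->
  (forall k v, (2 <= k)%N -> P v -> P (L (- k%:Z) v)) -> P 0 -> forall v, P v).
Context (tensor : X -> X -> Y) (W : int -> Y -> Prop) (J : bool -> field Y) (s : Y -> Y).
Context (tensorPl : forall k a a' b, tensor (k *: a + a') b = k *: tensor a b + tensor a' b).
Context (tensorPr : forall k a b b', tensor a (k *: b + b') = k *: tensor a b + tensor a b').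
Context (Y_ind : forall P : Y -> Prop, P 0 -> (forall a u v, P u -> P v -> P (a *: u + v)) ->
  (forall a b, P (tensor a b)) -> forall v, P v).
Context (W0 : forall N, W N 0) (Wlin : forall N a u v, W N u -> W N v -> W N (a *: u + v))
  (Wneg : forall N v, W N v -> N < 0 -> v = 0)
  (W_tensor : forall N M a b, weighted N a -> weighted M b -> W (N + M) (tensor a b)).
Context (lJ : forall e, flinear (J e)) (tJ : forall e, truncated (J e))
  (W_J : forall e (N n : int) v, W N v -> W (N + 2 - n - 1) (J e n v))
  (J_tensor : forall e n a b, J e n (tensor a b) =
     if e then tensor (L (n - 1) a) b else tensor a (L (n - 1) b)).
Context (ls : linear s) (s_tensor : forall a b, s (tensor a b) = tensor b a).

Lemma tensorDl a a' b : tensor (a + a') b = tensor a b + tensor a' b.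
Proof. by have := tensorPl 1 a a' b; rewrite !scale1r. Qed.
Lemma tensorDr a b b' : tensor a (b + b') = tensor a b + tensor a b'.
Proof. by have := tensorPr 1 a b b'; rewrite !scale1r. Qed.
Lemma tensor0l b : tensor 0 b = 0.
Proof. by apply: (addrI (tensor 0 b)); rewrite -tensorDl !addr0. Qed.
Lemma tensor0r a : tensor a 0 = 0.
Proof. by apply: (addrI (tensor a 0)); rewrite -tensorDr !addr0. Qed.
Lemma tensorZl k a b : tensor (k *: a) b = k *: tensor a b.
Proof. by have := tensorPl k a 0 b; rewrite tensor0l !addr0. Qed.
Lemma tensorZr k a b : tensor a (k *: b) = k *: tensor a b.
Proof. by have := tensorPr k a b 0; rewrite tensor0r !addr0. Qed.

Definition vacvac := tensor vac vac.
Lemma Wvac : W 0 vacvac. Proof. by rewrite -[0]addr0; exact: W_tensor. Qed.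

Lemma indJ (P : Y -> Prop) : P vacvac -> (forall a u v, P u -> P v -> P (a *: u + v)) ->
  (forall e n v, P v -> P (J e n v)) -> forall v, P v.
Proof.
move=> h0 hl hJ.
have P0 : P 0 by have := hl (-1) _ _ h0 h0; rewrite scaleN1r addNr.
apply: (Y_ind P0 hl) => a b; move: a.
apply: indL; last by rewrite tensor0l.
- move: b; apply: indL; last by rewrite tensor0r.
  + exact: h0.
  + by move=> k u v hu hv; rewrite tensorPr; exact: hl.
  + move=> k v k2 /(hJ false (- k%:Z + 1)); rewrite J_tensor /=.
    by rewrite (_ : - k%:Z + 1 - 1 = - k%:Z) //; lia.
- by move=> k u v hu hv; rewrite tensorPl; exact: hl.
- move=> k v k2 /(hJ true (- k%:Z + 1)); rewrite J_tensor /=.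
  by rewrite (_ : - k%:Z + 1 - 1 = - k%:Z) //; lia.
Qed.

Definition T (v : Y) := J true 0 v + J false 0 v.

Lemma lT : linear T.
Proof. by move=> a u v; rewrite /T !lJ; lmod. Qed.

Lemma Tvac : T vacvac = 0.
Proof. by rewrite /T /vacvac !J_tensor /= Lvac // tensor0l tensor0r addr0. Qed.

Lemma J_comm n m v : J true n (J false m v) = J false m (J true n v).
Proof.
elim/Y_ind: v => [|a u v hu hv|x y]; first by rewrite !(field0 (@lJ _)).
- by rewrite !lJ hu hv.
- by rewrite !J_tensor.
Qed.

Lemma J_vir e n m v : J e n (J e m v) =
  J e m (J e n v) + (n - m)%:~R *: J e (n + m - 1) v + coc c (n - 1) (m - 1) *: v.
Proof.
elim/Y_ind: v => [|a u v hu hv|x y].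
- by rewrite !(field0 (@lJ e)) !scaler0 !addr0.
- by rewrite !lJ hu hv; lmod.
case: e; rewrite !J_tensor /= (virL (n - 1) (m - 1)).
  have -> : n - 1 - (m - 1) = n - m by lia.
  have -> : n - 1 + (m - 1) = n + m - 1 - 1 by lia.
  by rewrite !tensorDl !tensorZl.
have -> : n - 1 - (m - 1) = n - m by lia.
have -> : n - 1 + (m - 1) = n + m - 1 - 1 by lia.
by rewrite !tensorDr !tensorZr.
Qed.

Lemma iter4_dif_coc m n (v : Y) : iter 4 (@dif F Y) (fun m n => coc c (m - 1) (n - 1) *: v) m n = 0.
Proof.
rewrite /= /dif -!scalerBl /coc.
have cond (a b : int) : a + b = m + n + 2 -> (a == - b) = (m + n + 2 == 0) by lia.
case: (eqVneq (m + n + 2) 0) => h.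
  rewrite !ifT; try lia.
  by rewrite [X in X *: _](_ : _ = 0) ?scale0r //; ring.
by rewrite !ifF ?subr0 ?scale0r //; lia.
Qed.

Lemma iter2_dif_lie m n (x : int -> Y) : iter 2 (@dif F Y) (fun m n => (m - n)%:~R *: x (m + n)) m n = 0.
Proof.
rewrite /= /dif.
have E (a b d e : int) : a + b = d + e -> x (a + b) = x (d + e) by move=> ->.
rewrite (E (m + 1 + 1) n m (n + 1 + 1)); last by lia.
rewrite (E (m + 1) (n + 1) m (n + 1 + 1)); last by lia.
by lmod.
Qed.

(** On a line [m + n = const], [dif] is a finite difference. The bracket term is linear in [m] and
    the central term cubic, so the fourth power kills both. *)
Lemma J_local e e' : local (J e) (J e').
Proof.
case: (eqVneq e e') => [<-{e'}|ee'].
  exists 4%N => v m n.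
  rewrite (_ : comm2 (J e) (J e) v = (fun m n => 1 *: ((m - n)%:~R *: J e (m + n - 1) v)
      + coc c (m - 1) (n - 1) *: v)).
    rewrite iter_dif_lin iter4_dif_coc addr0 scale1r.
    exact: (iter_dif_leq _ (fun m n => iter2_dif_lie m n (fun k => J e (k - 1) v))).
  by apply: fext2 => a b; rewrite /comm2 J_vir; lmod.
exists 0%N => v m n; rewrite /= /comm2.
by case: e e' ee' => -[] // _; rewrite J_comm subrr.
Qed.

Lemma J_covariant e : covariant T (J e).
Proof.
move=> n v; rewrite /T; case: e.
  rewrite J_vir -(J_comm n 0) (fieldD (@lJ true)); rewrite (_ : coc c _ _ = 0).
    by rewrite (_ : 0 + n - 1 = n - 1) ?add0r //; lmod.
  by rewrite /coc; case: eqP => // e; ring.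
rewrite J_vir (J_comm 0 n) (fieldD (@lJ false)); rewrite (_ : coc c _ _ = 0).
  by rewrite (_ : 0 + n - 1 = n - 1) ?add0r //; lmod.
by rewrite /coc; case: eqP => // e; ring.
Qed.

(** All modes of [J e] act on one factor, so normally ordered products on the square are computed in
    [X]. *)
Lemma nop_sum_tensor a b e n u v S :
  \sum_(j < S) dpow a (J e) (-1 - j%:Z) (dpow b (J e) (n + j%:Z) (if e then tensor u v else tensor v u))
  + \sum_(j < S) dpow b (J e) (n - 1 - j%:Z) (dpow a (J e) j%:Z (if e then tensor u v else tensor v u))
  = let x := \sum_(j < S) dpow a (omega_field L) (-1 - j%:Z) (dpow b (omega_field L) (n + j%:Z) u)
      + \sum_(j < S) dpow b (omega_field L) (n - 1 - j%:Z) (dpow a (omega_field L) j%:Z u) in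
    if e then tensor x v else tensor v x.
Proof.
have dt k m y : dpow k (J e) m (if e then tensor y v else tensor v y)
   = if e then tensor (dpow k (omega_field L) m y) v else tensor v (dpow k (omega_field L) m y).
  by rewrite !dpowE; case: (e); rewrite J_tensor ?tensorZl ?tensorZr.
have st (f : nat -> X) : \sum_(j < S) (if e then tensor (f j) v else tensor v (f j))
   = if e then tensor (\sum_(j < S) f j) v else tensor v (\sum_(j < S) f j).
  elim: (S) => [|r IH]; first by rewrite !big_ord0 tensor0l tensor0r; case: (e).
  by rewrite !big_ord_recr /= IH; case: (e); rewrite ?tensorDl ?tensorDr.
pose f1 (j : nat) := dpow a (omega_field L) (-1 - j%:Z) (dpow b (omega_field L) (n + j%:Z) u).
pose f2 (j : nat) := dpow b (omega_field L) (n - 1 - j%:Z) (dpow a (omega_field L) j%:Z u).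
rewrite (eq_bigr (fun j : 'I_S => if e then tensor (f1 j) v else tensor v (f1 j))); last first.
  by move=> j _; rewrite !dt.
rewrite (st f1) (eq_bigr (fun j : 'I_S => if e then tensor (f2 j) v else tensor v (f2 j))); last first.
  by move=> j _; rewrite !dt.
by rewrite (st f2) /=; case: (e); rewrite ?tensorDl ?tensorDr.
Qed.

Lemma J_creative e n : 0 <= n -> J e n vacvac = 0.
Proof.
by move=> hn; rewrite /vacvac J_tensor !Lvac; [case: e; rewrite ?tensor0l ?tensor0r|lia..].
Qed.

Local Notation vf := (vfield vacvac T J W).

Lemma vfield_J e : vf 2 (J e).
Proof.
by split; [exact: lJ | exact: tJ | exact: J_covariant | exact: J_creative
  | exact: J_local | exact: W_J].
Qed.

Lemma vfield_dJ k e : vf (2 + k%:Z) (dpow k (J e)).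
Proof. by apply: vfield_dpow; [exact: lT | exact: lJ | exact: W0 | exact: Wlin | exact: vfield_J]. Qed.

Lemma nop_ex a b e : exists C, is_nop (dpow a (J e)) (dpow b (J e)) C.
Proof.
have va := vfield_dJ a e; have vb := vfield_dJ b e.
exact: nop_exists (vf_linear va) (vf_linear vb) (vf_trunc va) (vf_trunc vb).
Qed.

Definition nop a b e : field Y := proj1_sig (constructive_indefinite_description _ (nop_ex a b e)).

Lemma nopP a b e : is_nop (dpow a (J e)) (dpow b (J e)) (nop a b e).
Proof. by rewrite /nop; case: constructive_indefinite_description. Qed.

Lemma local_dJ a e b e' : local (dpow a (J e)) (dpow b (J e')).
Proof.
apply: local_dpow; first exact: vf_linear (vfield_dJ b e').
by apply: local_sym; apply: local_dpow; [exact: lJ | exact: J_local].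
Qed.

Lemma vfield_quad a b e : vf (2 + a%:Z + (2 + b%:Z)) (nop a b e).
Proof.
by apply: (vfield_nop lT lJ W0 Wlin (vfield_dJ a e) (vfield_dJ b e)); [exact: local_dJ | exact: nopP].
Qed.

Lemma local_quad_dJ a b e k e' : local (nop a b e) (dpow k (J e')).
Proof.
have va := vfield_dJ a e; have vb := vfield_dJ b e; have vk := vfield_dJ k e'.
apply: (dong (vf_linear va) (vf_linear vb) (vf_linear vk) (vf_trunc va) (vf_trunc vb) (nopP a b e));
  exact: local_dJ.
Qed.

Lemma local_quad a b e a' b' e' : local (nop a b e) (nop a' b' e').
Proof.
have va := vfield_dJ a e; have vb := vfield_dJ b e; have vk := vfield_quad a' b' e'.
apply: (dong (vf_linear va) (vf_linear vb) (vf_linear vk) (vf_trunc va) (vf_trunc vb) (nopP a b e));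
  first exact: local_dJ; by apply: local_sym; exact: local_quad_dJ.
Qed.

Lemma s_J e n v : s (J e n v) = J (~~ e) n (s v).
Proof.
have lsf : flinear (fun _ : int => s) by move=> _; exact: ls.
elim/Y_ind: v => [|a u v hu hv|x y].
- by rewrite (field0 (@lJ e)) (field0 lsf 0) (field0 (@lJ _)).
- by rewrite lJ !ls hu hv lJ.
- by rewrite J_tensor s_tensor J_tensor; case: e; rewrite s_tensor.
Qed.

Lemma s_dJ k e n v : s (dpow k (J e) n v) = dpow k (J (~~ e)) n (s v).
Proof.
have lsf : flinear (fun _ : int => s) by move=> _; exact: ls.
by rewrite !dpowE (fieldZ lsf 0) s_J.
Qed.

Lemma s_nop a b e n v : s (nop a b e n v) = nop a b (~~ e) n (s v).
Proof.
have lsf : flinear (fun _ : int => s) by move=> _; exact: ls.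
have [S [-> ->]] := eventually_inst (eventuallyI (@nopP a b e n v) (@nopP a b (~~ e) n (s v))).
rewrite (fieldD lsf 0) !(field_sum lsf 0).
by congr (_ + _); apply: eq_bigr => j _; rewrite !s_dJ.
Qed.

Definition omega_sum : field Y := flin 1 (J true) (J false).
Definition quad a b : field Y := flin 1 (nop a b true) (nop a b false).

Lemma fsym_pair (A : bool -> field Y) : (forall e n v, s (A e n v) = A (~~ e) n (s v)) ->
  fsym s (flin 1 (A true) (A false)).
Proof. by move=> h n v; rewrite /flin ls !h scale1r addrC scale1r. Qed.

Lemma s_vacvac : s vacvac = vacvac. Proof. exact: s_tensor. Qed.

Lemma nop_tensor a b e n u v x :
  eventually (fun S =>
    \sum_(j < S) dpow a (omega_field L) (-1 - j%:Z) (dpow b (omega_field L) (n + j%:Z) u)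
    + \sum_(j < S) dpow b (omega_field L) (n - 1 - j%:Z) (dpow a (omega_field L) j%:Z u) = x) ->
  nop a b e n (if e then tensor u v else tensor v u) = if e then tensor x v else tensor v x.
Proof.
move=> hx.
have [S [-> <-]] := eventually_inst (eventuallyI
  (@nopP a b e n (if e then tensor u v else tensor v u)) hx).
exact: nop_sum_tensor.
Qed.

Lemma nop_xop a b e q M u v : weighted q u -> q + 2 <= M%:Z ->
  nop a b e (-1) (if e then tensor u v else tensor v u)
  = if e then tensor (xop L a b M u) v else tensor v (xop L a b M u).
Proof.
move=> hu qM; apply: nop_tensor; apply: xop_nop => // t Mt.
by apply: (wneg (wL (t%:Z - 1) hu)); lia.
Qed.

Lemma xop_vac a b M : xop L a b M vac = word L vac [:: a.+2; b.+2].
Proof.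
rewrite /xop big1 ?addr0 // => t _; rewrite (@Lvac (t%:Z - 1)); last by lia.
by rewrite (field0 lL) scaler0.
Qed.

Definition sym2 (a b : X) := tensor a b + tensor b a.

Lemma sym2C a b : sym2 a b = sym2 b a. Proof. by rewrite /sym2 addrC. Qed.
Lemma sym2P k a b b' : sym2 a (k *: b + b') = k *: sym2 a b + sym2 a b'.
Proof. by rewrite /sym2 tensorPl tensorPr; lmod. Qed.

Lemma sym2D a b b' : sym2 a (b + b') = sym2 a b + sym2 a b'.
Proof. by rewrite /sym2 tensorDl tensorDr; lmod. Qed.

Lemma quad_sym2 a b p q M1 M2 u v : weighted p u -> weighted q v -> p + 2 <= M1%:Z -> q + 2 <= M2%:Z ->
  quad a b (-1) (sym2 u v) = sym2 (xop L a b M1 u) v + sym2 u (xop L a b M2 v).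
Proof.
move=> hu hv h1 h2; rewrite /quad /flin scale1r /sym2.
have vt := vf_linear (vfield_quad a b true); have vff := vf_linear (vfield_quad a b false).
rewrite (fieldD vt) (fieldD vff).
rewrite (@nop_xop a b true p M1 u v hu h1) (@nop_xop a b true q M2 v u hv h2).
rewrite (@nop_xop a b false p M1 u v hu h1) (@nop_xop a b false q M2 v u hv h2).
by lmod.
Qed.

Section Generators.
Context (gens : seq nat) (gens_ge4 : forall k, k \in gens -> (4 <= k)%N).

(** [None] stands for [omega]. As [w_k] comes from [L(-(k-2)) L(-2) 1], its field is [quad a b] with
    [a = k - 4] and [b = 0]. *)
Definition gidx := option {k : nat | k \in gens}.
Definition gfield (x : gidx) : field Y := if x is Some k then quad (val k - 4) 0 else omega_sum.
Definition gweight (x : gidx) : nat := if x is Some k then val k else 2%N.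

Lemma gweight_gt0 x : (0 < gweight x)%N.
Proof. by case: x => [k|] //; exact: leq_trans _ (gens_ge4 (valP k)). Qed.

Lemma gfield_vfield x : vf (gweight x)%:Z (gfield x).
Proof.
case: x => [k|] /=; last by rewrite /omega_sum; apply: (vfield_lin lT lJ Wlin); exact: vfield_J.
have k4 := gens_ge4 (valP k).
have e : 2 + (val k - 4)%N%:Z + (2 + 0%N%:Z) = (val k)%:Z by lia.
by rewrite /quad; apply: (vfield_lin lT lJ Wlin); rewrite -e; exact: vfield_quad.
Qed.

Lemma gfield_sym x : fsym s (gfield x).
Proof. by case: x => [k|]; apply: fsym_pair => e n v; [exact: s_nop | exact: s_J]. Qed.

Lemma gfield_local x y : local (gfield x) (gfield y).
Proof.
have key (A B : bool -> field Y) : (forall e, flinear (A e)) -> (forall e, flinear (B e)) ->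
    (forall e e', local (A e) (B e')) ->
    local (flin 1 (A true) (A false)) (flin 1 (B true) (B false)).
  move=> lA lB h; apply: local_lin.
  - by move=> n a u v; rewrite /flin !lB; lmod.
  - by apply: local_sym; apply: local_lin => //; exact: local_sym.
  - by apply: local_sym; apply: local_lin => //; exact: local_sym.
have lq a b e := vf_linear (vfield_quad a b e).
case: x y => [k|] [l|]; apply: key => // e e'.
- exact: local_quad.
- exact: (local_quad_dJ _ _ _ 0).
- by apply: local_sym; exact: (local_quad_dJ _ _ _ 0).
- exact: J_local.
Qed.

Local Notation span := (gspan vacvac gfield gweight).

(** By covariance [T] acts as a derivation on monomials, replacing one mode [-1-k] by a multiple of
    [-2-k]. *)
Lemma span_T N v : span N v -> span N.+1 (T v).
Proof.
have lTf : flinear (fun _ : int => T) by move=> _; exact: lT.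
elim=> {N v} [|N|N a u v _ hu _ hv|x k N v hv hT].
- by rewrite Tvac; exact: gspan0.
- by rewrite (field0 lTf 0); exact: gspan0.
- by rewrite lT; exact: gspan_lin.
rewrite (vf_cov (gfield_vfield x)) addrC -scaleNr; apply: gspan_lin.
  have := gspan_mode x k.+1 hv; rewrite addnS.
  by rewrite (_ : -1 - k.+1%:Z = -1 - k%:Z - 1) //; lia.
by have := gspan_mode x k hT; rewrite !addSn.
Qed.

Lemma spanD N u v : span N u -> span N v -> span N (u + v).
Proof. by move=> hu hv; rewrite -[u]scale1r; exact: gspan_lin. Qed.
Lemma spanZ N a u : span N u -> span N (a *: u).
Proof. by move=> hu; rewrite -[_ *: _]addr0; apply: gspan_lin => //; exact: gspan0. Qed.
Lemma spanB N u v : span N u -> span N v -> span N (u - v).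
Proof. by move=> hu hv; rewrite -scaleN1r addrC; exact: gspan_lin. Qed.

Context (word_span : forall (N : nat) x (P : X -> Prop), P 0 ->
  (forall a u v, P u -> P v -> P (a *: u + v)) ->
  (forall ks, letters ks -> sumn ks = N -> P (word L vac ks)) -> weighted N%:Z x -> P x).
Context (sym_span : forall (N : nat) v, W N%:Z v -> s v = v -> forall P : Y -> Prop, P 0 ->
  (forall a u v, P u -> P v -> P (a *: u + v)) ->
  (forall (p q : nat) a b, weighted p%:Z a -> weighted q%:Z b -> (p + q)%N = N -> P (sym2 a b)) -> P v).
(** The three ways to reach [X0] in even weight: [w_N] is a generator, one of [valA] and [valB] is
    invertible, or the weight is 10 and [valA] is invertible there. *)
Context (gens_enough : forall N, ~~ odd N -> (4 <= N)%N ->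
  [\/ N \in gens, (12 <= N)%N | N = 10%N /\ c != 256%:R / 47%:R]).

Let word_weighted ks : letters ks -> weighted (sumn ks)%:Z (word L vac ks).
Proof.
elim: ks => //= k ks IH /andP[_ lk]; have := @wL _ (- k%:Z) _ (IH lk).
by rewrite (_ : _ - _ = (k + sumn ks)%N%:Z) //; lia.
Qed.

Section Step.
Context (N : nat) (N_gt0 : (0 < N)%N).
Hypothesis IHN : forall (M : nat) v, (M < N)%N -> W M%:Z v -> s v = v -> span M v.

Let W_sym2 (p q : nat) a b : weighted p%:Z a -> weighted q%:Z b -> W (p + q)%N%:Z (sym2 a b).
Proof.
move=> ha hb; rewrite /sym2 -[X in X + _]scale1r; apply: Wlin; first by rewrite PoszD; exact: W_tensor.
by rewrite addnC PoszD; exact: W_tensor.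
Qed.
Let s_sym2 a b : s (sym2 a b) = sym2 a b.
Proof.
have lsf : flinear (fun _ : int => s) by move=> _; exact: ls.
by rewrite /sym2 (fieldD lsf 0) !s_tensor addrC.
Qed.
Let IHsym (p q : nat) a b : weighted p%:Z a -> weighted q%:Z b -> (p + q < N)%N -> span (p + q) (sym2 a b).
Proof. by move=> ha hb h; apply: IHN => //; exact: W_sym2. Qed.

(** This sum is a creation mode of [omega] applied to [sym2 a b], which has weight below [N] and is
    generated by hypothesis. *)
Lemma span_move (p q k : nat) a b : weighted p%:Z a -> weighted q%:Z b -> (2 <= k)%N -> (p + q + k)%N = N ->
  span N (sym2 (L (- k%:Z) a) b + sym2 a (L (- k%:Z) b)).
Proof.
move=> ha hb k2 e; have pq : (p + q < N)%N by lia.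
have := gspan_mode (None : gidx) (k - 2) (IHsym ha hb pq).
rewrite (_ : (p + q + gweight None + (k - 2))%N = N); last by rewrite /=; lia.
rewrite /= /omega_sum /flin /sym2 scale1r !(fieldD (@lJ _)) !J_tensor /=.
rewrite (_ : -1 - (k - 2)%N%:Z - 1 = - k%:Z); last by lia.
set k' := L (- k%:Z).
rewrite (_ : tensor (k' a) b + tensor (k' b) a + (tensor a (k' b) + tensor b (k' a)) =
  tensor (k' a) b + tensor b (k' a) + (tensor a (k' b) + tensor (k' b) a)) //.
by lmod.
Qed.

(* Up to the image of the modes of [omega], letters move from one factor to the other by
   the antipode. *)
Lemma span_word ks (q : nat) b : letters ks -> weighted q%:Z b -> (sumn ks + q)%N = N ->
  span N (sym2 (word L vac ks) b
    - (-1) ^+ size ks *: sym2 vac (foldr (fun k v => L (- k%:Z) v) b (rev ks))).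
Proof.
elim: ks q b => [|k ks IH] q b /=.
  by move=> _ _ _; rewrite expr0 scale1r subrr; exact: gspan0.
move=> /andP[k2 lk] hb e.
have hb' : weighted (q + k)%N%:Z (L (- k%:Z) b).
  by have := @wL _ (- k%:Z) _ hb; rewrite (_ : _ - _ = (q + k)%N%:Z) //; lia.
have h1 : span N (sym2 (L (- k%:Z) (word L vac ks)) b + sym2 (word L vac ks) (L (- k%:Z) b)).
  by apply: (span_move (word_weighted lk) hb k2); lia.
have h2 := IH (q + k)%N _ lk hb'; rewrite rev_cons foldr_rcons.
have {}h2 := h2 ltac:(lia).
have := spanB h1 h2; rewrite exprS.
set x := sym2 _ _; set y := sym2 _ _; set z := sym2 _ _.
by rewrite (_ : _ - _ = x - (-1 * (-1) ^+ size ks) *: z) //; lmod.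
Qed.

Definition Zspan x := span N (sym2 vac x).

Lemma Zspan_lin a u v : Zspan u -> Zspan v -> Zspan (a *: u + v).
Proof. by rewrite /Zspan sym2P; exact: gspan_lin. Qed.
Lemma Zspan0 : Zspan 0.
Proof. by rewrite /Zspan /sym2 tensor0l tensor0r addr0; exact: gspan0. Qed.

Lemma Zspan_trans ks : letters ks -> (sumn ks).+1 = N -> Zspan (L (-1) (word L vac ks)).
Proof.
move=> lk e; have h := word_weighted lk.
have h0 : weighted 0%N%:Z vac by [].
have := IHsym h0 h; rewrite add0n => /(_ ltac:(lia)) /span_T; rewrite e.
rewrite /T /sym2 !(fieldD (@lJ _)) !J_tensor /= sub0r Lvac // tensor0l tensor0r add0r addr0.
by rewrite /Zspan /sym2 addrC.
Qed.

Lemma Zspan_anti ks : letters ks -> sumn ks = N ->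
  Zspan (word L vac ks - (-1) ^+ size ks *: word L vac (rev ks)).
Proof.
move=> lk e; have h0 : weighted 0%N%:Z vac by [].
have := span_word lk h0; rewrite addn0 => /(_ e); rewrite sym2C /Zspan.
set v := word L vac (rev ks); set k := _ ^+ _; set u := word L vac ks.
by rewrite (_ : u - k *: v = - k *: v + u) ?sym2P; [rewrite scaleNr addrC | lmod].
Qed.

(** Apply [quad a b] in mode [-1] to the symmetrization of [word ks]. On the factor of the word it
    acts as [xop]; on the vacuum it creates [L(-2-a)L(-2-b)1], whose two letters the antipode moves
    over in reversed order with sign 1. Positive weight of the word keeps the field below weight
    [N]. *)
Lemma Zspan_prod a b M ks : letters ks -> (a + b + 4 + sumn ks)%N = N -> (0 < sumn ks)%N ->
  (sumn ks + 2 <= M)%N ->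
  Zspan (xop L a b M (word L vac ks) + L (- (b.+2)%:Z) (L (- (a.+2)%:Z) (word L vac ks))).
Proof.
move=> lk e s0 sM; have hw := word_weighted lk.
have sM' : (sumn ks)%:Z + 2 <= M%:Z by rewrite -[2]/(2%N%:Z) -PoszD lez_nat.
have h0 : weighted 0%N%:Z vac by [].
have qs : fsym s (quad a b) by apply: fsym_pair => ? ? ?; exact: s_nop.
have qv : vf (a + b + 4)%N (quad a b).
  have e' : 2 + a%:Z + (2 + b%:Z) = (a + b + 4)%N by lia.
  by rewrite /quad; apply: (vfield_lin lT lJ Wlin); rewrite -e'; exact: vfield_quad.
have hh : (0 < a + b + 4 < N)%N by lia.
have := generated_mode charF0 lT Tvac lJ tJ indJ W0 Wlin Wneg Wvac ls s_vacvac gweight_gt0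
   gfield_vfield gfield_sym gfield_local IHN hh qv qs.
move=> /(_ (sumn ks) 0%N (sym2 vac (word L vac ks))).
rewrite addn0 => /(_ e); have := W_sym2 h0 hw; rewrite add0n => Wv /(_ Wv (s_sym2 _ _)).
rewrite subr0 (@quad_sym2 a b 0 (sumn ks)%:Z 2 M vac _ h0 hw isT sM').
rewrite xop_vac.
have lab : letters [:: a.+2; b.+2] by [].
have := span_word lab hw; rewrite /= addn0 (_ : (a.+2 + b.+2 + sumn ks)%N = N); last by lia.
move=> /(_ erefl); rewrite expr2 mulrNN mulr1 scale1r => h1 h2.
have := spanB h2 h1; rewrite /Zspan.
rewrite sym2D.
set x := sym2 _ _; set y := sym2 _ _; set z := sym2 _ _.
by rewrite (_ : x + y - (x - z) = y + z) //; lmod.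
Qed.

Lemma Zspan_X0 : (4 <= N)%N && ~~ odd N -> Zspan (X0 L vac N).
Proof.
move=> /andP[N4 eN]; case: (gens_enough eN N4) => [hN|N12|[N10 hc]].
- have := gspan_mode (Some (exist _ N hN) : gidx) 0 (gspan_vac vacvac gfield gweight).
  rewrite add0n addn0 /= subr0.
  (* The vacuum is symmetrized so that [quad_sym2] computes the vector [w_N]. *)
  have ev2 : vacvac = (2%:R)^-1 *: sym2 vac vac.
    rewrite /sym2 /vacvac -mulr2n -scaler_nat scalerA mulVf ?scale1r //.
    by rewrite (natF_neq0 charF0).
  have vq := vf_linear (gfield_vfield (Some (exist _ N hN))).
  rewrite /= in vq; rewrite [X in quad _ _ _ X]ev2 (fieldZ vq) => /(@spanZ _ 2%:R _).
  rewrite scalerA divff ?scale1r; last first.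
    by rewrite (natF_neq0 charF0).
  have h0 : weighted 0%N%:Z vac by [].
  rewrite (@quad_sym2 _ _ 0 0 2 2 vac vac h0 h0) //.
  have -> : xop L (N - 4) 0 2 vac = X0 L vac N.
    by rewrite xop_vac /X0; congr (word _ _ [:: _; _]); lia.
  rewrite sym2C -mulr2n -scaler_nat => /(@spanZ _ (2%:R)^-1 _); rewrite scalerA mulVf ?scale1r //.
  by rewrite (natF_neq0 charF0).
- exact: (Z_X0_12 charF0 lL virL Lvac Zspan_lin Zspan0 Zspan_trans Zspan_anti Zspan_prod).
- exact: (Z_X0_10 charF0 lL virL Lvac Zspan_lin Zspan0 Zspan_trans Zspan_anti Zspan_prod).
Qed.

(** With [a] a word, [span_word] moves all of it onto [b]; what remains is the symmetrization of one
    vector of weight [N], covered by [Z_words]. *)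
Lemma span_step v : W N%:Z v -> s v = v -> span N v.
Proof.
move=> Wv sv; apply: (sym_span Wv sv); [exact: gspan0 | by move=> *; exact: gspan_lin|].
move=> p q a b ha hb e.
have Zall x : weighted N%:Z x -> Zspan x.
  apply: (word_span Zspan0 Zspan_lin) => ks lk wk.
  exact: (Z_words charF0 lL virL Lvac Zspan_lin Zspan0 Zspan_trans Zspan_anti Zspan_prod
     N_gt0 Zspan_X0 lk (leqnn _) wk).
move: ha; apply: (@word_span p a (fun a => span N (sym2 a b))).
- by rewrite sym2C /sym2 tensor0l tensor0r addr0; exact: gspan0.
- by move=> k u u' hu hu'; rewrite sym2C sym2P ![sym2 b _]sym2C; exact: gspan_lin.
move=> ks lk wk; rewrite -wk in e; have h := span_word lk hb e.
rewrite -[sym2 _ b](subrK ((-1) ^+ size ks *: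
   sym2 vac (foldr (fun k v => L (- k%:Z) v) b (rev ks)))).
apply: spanD h _; apply: spanZ; apply: Zall.
rewrite -e -sumn_rev; elim: (rev ks) => [|k l IH] /=; first by rewrite add0n.
by have := @wL _ (- k%:Z) _ IH; rewrite (_ : _ - _ = (k + sumn l + q)%N%:Z) //; lia.
Qed.
End Step.

Theorem orbifold_span (N : nat) v : W N%:Z v -> s v = v -> span N v.
Proof.
elim/ltn_ind: N v => N IH v Wv sv.
case: (posnP N) => [N0|N0]; last exact: (span_step N0 (fun M u h => IH M h u) Wv sv).
apply: (sym_span Wv sv); [exact: gspan0 | by move=> *; exact: gspan_lin|].
move=> p q a b ha hb e; rewrite N0 in e *.
have [p0 q0] : p = 0%N /\ q = 0%N by lia.
rewrite p0 in ha; rewrite q0 in hb.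
have nil ks : letters ks -> sumn ks = 0%N -> ks = [::].
  by case: ks => //= k ks /andP[]; lia.
move: ha; apply: (@word_span 0 a (fun a => span 0 (sym2 a b))).
- by rewrite sym2C /sym2 tensor0l tensor0r addr0; exact: gspan0.
- by move=> k u u' hu hu'; rewrite sym2C sym2P ![sym2 b _]sym2C; exact: gspan_lin.
move=> ks lk /(nil ks lk) -> /=.
move: hb; apply: (@word_span 0 b (fun b => span 0 (sym2 vac b))).
- by rewrite /sym2 tensor0l tensor0r addr0; exact: gspan0.
- by move=> k u u' hu hu'; rewrite sym2P; exact: gspan_lin.
move=> ks' lk' /(nil ks' lk') -> /=.
rewrite /sym2 -/vacvac; apply: spanD; exact: gspan_vac.
Qed.

(** Formulated for any realization [D] of the normally ordered products, so that the modes of the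
    definitions can replace the chosen [nop]; two realizations agree because partial sums have one
    limit. *)
Theorem orbifold_closure (D : nat -> bool -> field Y) :
  (forall k e, k \in gens -> is_nop (dpow (k - 4) (J e)) (dpow 0 (J e)) (D k e)) ->
  forall P : Y -> Prop, P vacvac -> (forall a u v, P u -> P v -> P (a *: u + v)) ->
  (forall (i : nat) v, P v -> P (J true (-1 - i%:Z) v + J false (-1 - i%:Z) v)) ->
  (forall k (i : nat) v, k \in gens -> P v -> P (D k true (-1 - i%:Z) v + D k false (-1 - i%:Z) v)) ->
  forall (N : nat) v, W N%:Z v -> s v = v -> P v.
Proof.
move=> hD P Pvac Plin PJ PD N v Wv sv; elim: (orbifold_span Wv sv) => {N v Wv sv} //.
- move=> _; have := Plin (-1) _ _ Pvac Pvac; by rewrite scaleN1r addNr.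
- by move=> _ a u v _ hu _ hv; exact: Plin.
move=> x k N v _ hv; case: x => [[j hj]|] /=; rewrite /quad /omega_sum /flin scale1r; last exact: PJ.
have nopD e n u : nop (j - 4) 0 e n u = D j e n u.
  have [S [-> ->]] := eventually_inst (eventuallyI (@nopP (j - 4) 0 e n u) (hD j e hj n u)).
  by [].
by rewrite !nopD; exact: PD.
Qed.
End Generators.
End Orbifold.

(** * The free module on a basis of words *)

Section FreeOrbifold.
Context (F : fieldType) (charF0 : [pchar F] =i pred0) (c : F) (K : choiceType) (wk : K -> nat).
Local Notation X := {malg F[K]}.
Local Notation Y := {malg F[(K * K)%type]}.
Context (L : int -> X -> X) (vac : X).
Context (lL : forall n, linear (L n)) (virL : forall m n v, vir_rel c L m n v).
Context (wL : forall (N n : int) v, weighted wk N v -> weighted wk (N - n) (L n v)).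
Context (wvac : weighted wk 0 vac) (Lvac : forall n : int, -1 <= n -> L n vac = 0).
Context (basis_word : forall x : K,
  exists ks, [/\ letters ks, sumn ks = wk x & << x >> = word L vac ks]).

Let ind (P : X -> Prop) : P vac -> (forall a u v, P u -> P v -> P (a *: u + v)) ->
  (forall k v, (2 <= k)%N -> P v -> P (L (- k%:Z) v)) -> P 0 -> forall v, P v.
Proof.
move=> h0 hl hL hz; apply: malg_lin_ind => // x.
have [ks [lk _ ->]] := basis_word x; elim: ks lk => //= k ks IH /andP[k2 lk].
by apply: (hL) => //; exact: IH.
Qed.

Let word_span (N : nat) x (P : X -> Prop) : P 0 ->
  (forall a u v, P u -> P v -> P (a *: u + v)) ->
  (forall ks, letters ks -> sumn ks = N -> P (word L vac ks)) -> weighted wk N%:Z x -> P x.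
Proof.
move=> h0 hl hw hx; rewrite [x]malgEZ big_seq; elim/big_rec: _ => // k y ky hy.
apply: (hl) => //; have [ks [lk sk ->]] := basis_word k; apply: hw => //.
by rewrite sk; have /eqP [] := hx _ ky.
Qed.

Lemma half_half (v : Y) : v = 2%:R^-1 *: (v + v).
Proof. by rewrite -mulr2n -scaler_nat scalerA mulVf ?scale1r // (natF_neq0 charF0). Qed.

(** An invariant is half the sum of itself and its swap, hence a combination of symmetrized basis
    tensors. *)
Lemma tswap_span (v : Y) (P : Y -> Prop) : tswap v = v -> P 0 ->
  (forall a u v, P u -> P v -> P (a *: u + v)) ->
  (forall p, p \in msupp v -> P (tensor << p.1 >> << p.2 >> + tensor << p.2 >> << p.1 >>)) -> P v.
Proof.
move=> sv h0 hl h; rewrite [v]half_half -[X in P X]addr0; apply: (hl) => //.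
have -> : v + v = \sum_(p <- msupp v) v@_p *: (tensor << p.1 >> << p.2 >> + tensor << p.2 >> << p.1 >>).
  rewrite -{2}sv [v in LHS]malgEZ linear_sum -big_split; apply: eq_bigr => -[x y] _ /=.
  by rewrite linearZ /= tswapU !tensorU -scalerDr.
rewrite big_seq; elim/big_rec: _ => // p u pv hu; apply: (hl) => //; exact: h.
Qed.

Let sym_span (N : nat) v : tweighted wk N%:Z v -> tswap v = v -> forall P : Y -> Prop, P 0 ->
  (forall a u v, P u -> P v -> P (a *: u + v)) ->
  (forall (p q : nat) a b, weighted wk p%:Z a -> weighted wk q%:Z b -> (p + q)%N = N ->
     P (sym2 (@tensor F K) a b)) -> P v.
Proof.
move=> hv sv P h0 hl h; apply: (tswap_span sv h0 hl) => p pv.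
apply: (h (wk p.1) (wk p.2)); try exact: supportedU.
by have /eqP [] := hv _ pv.
Qed.

Lemma flinear_dpow (V : lmodType F) (A : field V) k : flinear A -> flinear (dpow k A).
Proof. by move=> lA n a u v; rewrite !dpowE lA; lmod. Qed.

Definition tmap (e : bool) (f : X -> X) : Y -> Y := if e then tmap1 f else tmap2 f.

Lemma tmap_linear e f : linear (tmap e f).
Proof. by rewrite /tmap; case: e; [exact: tmap1_linear | exact: tmap2_linear]. Qed.

(** The hypothesis concerns basis vectors only, since the cutoff in [vmode] depends on its argument
    and linearity is not apparent there; [tmap1] and [tmap2] extend linearly from the basis. *)
Lemma tmap_nop (a b : nat) (D : int -> X -> X) :
  (forall n x, eventually (fun S =>
    \sum_(j < S) dpow a (omega_field L) (-1 - j%:Z) (dpow b (omega_field L) (n + j%:Z) << x >>)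
    + \sum_(j < S) dpow b (omega_field L) (n - 1 - j%:Z) (dpow a (omega_field L) j%:Z << x >>)
    = D n << x >>)) ->
  forall e, is_nop (dpow a (tfield L e)) (dpow b (tfield L e)) (fun n => tmap e (D n)).
Proof.
move=> hD e n.
have lA := flinear_dpow a (tfield_linear L e); have lB := flinear_dpow b (tfield_linear L e).
apply: malg_lin_ind => [|k u v hu hv|[x y]].
- apply: eventually_all => S; rewrite (field0 (A := fun _ => tmap e (D n)) (fun _ => tmap_linear _ _) 0).
  by rewrite !big1 ?addr0 // => j _; rewrite ?(field0 lA) ?(field0 lB) ?(field0 lA).
- apply: eventuallyW (eventuallyI hu hv) => S [e1 e2]; rewrite tmap_linear e1 e2.
  pose A := dpow a (tfield L e); pose B := dpow b (tfield L e).
  rewrite (@sum_lin _ _ S k (fun j => A (-1 - j%:Z) (B (n + j%:Z) (k *: u + v)))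
    (fun j => A (-1 - j%:Z) (B (n + j%:Z) u)) (fun j => A (-1 - j%:Z) (B (n + j%:Z) v))).
    rewrite (@sum_lin _ _ S k (fun j => B (n - 1 - j%:Z) (A j%:Z (k *: u + v)))
      (fun j => B (n - 1 - j%:Z) (A j%:Z u)) (fun j => B (n - 1 - j%:Z) (A j%:Z v))).
      by rewrite scalerDr addrACA.
    by move=> j; rewrite /A /B lA lB.
  by move=> j; rewrite /A /B lB lA.
apply: eventuallyW (hD n (if e then x else y)) => S.
have E := nop_sum_tensor (@tensorPl F K) (@tensorPr F K) (tfield_tensor lL) a b e n
  << if e then x else y >> << if e then y else x >> S.
move=> h; rewrite /= in E; rewrite h in E.
have T : (if e then tensor << if e then x else y >> << if e then y else x >>
          else tensor << if e then y else x >> << if e then x else y >>) = << (x, y) >> :> Y.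
  by rewrite -tensorU; case: (e).
rewrite T in E; rewrite E /tmap; case: (e).
  exact: tmap1U.
exact: tmap2U.
Qed.

Theorem free_orbifold (gens : seq nat) (D : nat -> int -> X -> X) (P : Y -> Prop) :
  (forall k, k \in gens -> (4 <= k)%N) ->
  (forall N, ~~ odd N -> (4 <= N)%N ->
     [\/ N \in gens, (12 <= N)%N | N = 10%N /\ c != 256%:R / 47%:R]) ->
  (forall k, k \in gens -> forall n x, eventually (fun S =>
    \sum_(j < S) dpow (k - 4) (omega_field L) (-1 - j%:Z) (dpow 0 (omega_field L) (n + j%:Z) << x >>)
    + \sum_(j < S) dpow 0 (omega_field L) (n - 1 - j%:Z) (dpow (k - 4) (omega_field L) j%:Z << x >>)
    = D k n << x >>)) ->
  P (tensor vac vac) -> (forall a u v, P u -> P v -> P (a *: u + v)) ->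
  (forall (i : nat) v, P v -> P (tmap1 (L (-1 - i%:Z - 1)) v + tmap2 (L (-1 - i%:Z - 1)) v)) ->
  (forall k (i : nat) v, k \in gens -> P v ->
     P (tmap1 (D k (-1 - i%:Z)) v + tmap2 (D k (-1 - i%:Z)) v)) ->
  forall v, tswap v = v -> P v.
Proof.
move=> ge4 enough hD Pvac Plin PJ PD v sv.
have P0 : P 0 by have := Plin (-1) _ _ Pvac Pvac; rewrite scaleN1r addNr.
apply: (tswap_span sv P0 Plin) => p pv.
have hb x : weighted wk (wk x) (<< x >> : X) by apply: supportedU.
have Wp : tweighted wk (wk p.1 + wk p.2)%N (tensor << p.1 >> << p.2 >> + tensor << p.2 >> << p.1 >> : Y).
  have h1 := tweighted_tensor (hb p.1) (hb p.2).
  have h2 := tweighted_tensor (hb p.2) (hb p.1).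
  rewrite addrC -PoszD in h2; rewrite -PoszD in h1.
  by have := @tweighted_lin F K wk _ 1 _ _ h1 h2; rewrite scale1r.
have sp : tswap (tensor << p.1 >> << p.2 >> + tensor << p.2 >> << p.1 >>)
        = tensor << p.1 >> << p.2 >> + tensor << p.2 >> << p.1 >> :> Y.
  by rewrite linearD /= !tswap_tensor addrC.
have Yind (Q : Y -> Prop) : Q 0 -> (forall a u v, Q u -> Q v -> Q (a *: u + v)) ->
    (forall a b, Q (tensor a b)) -> forall v, Q v.
  by move=> q0 ql qt; apply: tensor_ind.
have wneg N (x : X) : weighted wk N x -> N < 0 -> x = 0.
  move=> hx hN; apply/malgP => k; rewrite mcoeff0; apply: mcoeff_outdom.
  by apply/negP => /hx /eqP; lia.
have nopD k e : k \in gens ->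
    is_nop (dpow (k - 4) (tfield L e)) (dpow 0 (tfield L e)) (fun n => tmap e (D k n)).
  by move=> kg; apply: tmap_nop; exact: hD.
exact: (orbifold_closure charF0 lL virL wL wvac wneg Lvac ind (@tensorPl F K) (@tensorPr F K) Yind
  (@tweighted0 F K wk) (@tweighted_lin F K wk) (@tweighted_neg F K wk) (@tweighted_tensor F K wk)
  (@tfield_linear F K L) (tfield_truncated lL wL) (@tweighted_field F K wk L lL wL)
  (tfield_tensor lL) (@tswap_linear F K) (@tswap_tensor F K) ge4 word_span sym_span enough
  (D := fun k e n => tmap e (D k n)) nopD Pvac Plin PJ PD Wp sp).
Qed.

End FreeOrbifold.

Lemma sum_ord_trunc (X : zmodType) (f : nat -> X) (T S : nat) : (T <= S)%N ->
  (forall j, (T <= j)%N -> f j = 0) -> \sum_(j < S) f j = \sum_(j < T) f j.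
Proof.
move=> TS h; rewrite (big_ord_widen S f TS) [RHS]big_mkcond /=; apply: eq_bigr => j _.
by case: ltnP => // /h.
Qed.

(** The normally ordered product of [A] with the identity field is [A]: exactly one term survives,
    in the second sum for [n >= 0] and in the first for [n < 0]. *)
Lemma nop_id (F : fieldType) (X : lmodType F) (A : field X) (T : nat) (n : int) v :
  flinear A -> (`|n| + 2 <= T)%N ->
  \sum_(j < T) A (-1 - j%:Z) (if n + j%:Z == -1 then v else 0)
  + \sum_(j < T) (if n - 1 - j%:Z == -1 then A j%:Z v else 0) = A n v.
Proof.
move=> lA hT; case: n hT => [m|m] hT.
  rewrite [X in X + _]big1 ?add0r => [|j _]; last by rewrite (_ : (_ == _) = false) ?(field0 lA) //; lia.
  have mT : (m < T)%N by lia.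
  rewrite (bigD1 (Ordinal mT)) //= ifT; last by lia.
  rewrite big1 ?addr0 // => j hj; rewrite ifF //; apply: contraNF hj => /eqP e.
  by apply/eqP/val_inj => /=; lia.
have mT : (m < T)%N by lia.
rewrite [X in _ + X]big1 ?addr0 => [|j _]; last by rewrite (_ : (_ == _) = false) //; lia.
rewrite (bigD1 (Ordinal mT)) //= ifT; last by lia.
rewrite big1 ?addr0 => [|j hj].
  by rewrite (_ : -1 - m%:Z = Negz m) //; lia.
rewrite ifF ?(field0 lA) //; apply: contraNF hj => /eqP e.
by apply/eqP/val_inj => /=; lia.
Qed.

Lemma eq_tmap (F : fieldType) (K : choiceType) (f g : {malg F[K]} -> {malg F[K]}) v :
  (forall x, f << x >> = g << x >>) -> tmap1 f v + tmap2 f v = tmap1 g v + tmap2 g v.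
Proof.
move=> h; apply: (f_equal2 +%R).
  by apply: eq_bigr => p _; rewrite h.
by apply: eq_bigr => p _; rewrite h.
Qed.

Lemma combination_lin (F : fieldType) (X : lmodType F) (T : Type) (g : T -> X) a
    (r s : seq (F * T)) :
  a *: (\sum_(m <- r) m.1 *: g m.2) + \sum_(m <- s) m.1 *: g m.2
  = \sum_(m <- [seq (a * m.1, m.2) | m <- r] ++ s) m.1 *: g m.2.
Proof.
rewrite big_cat big_map scaler_sumr; congr (_ + _); apply: eq_bigr => m _.
by rewrite scalerA.
Qed.

(** * Comparison with the modes and monomials of the definitions *)

Section Concrete.
Context (F : fieldType) (c : F).
Local Notation O := (omega_field (Lop c)).

Lemma umode_mk s n v : valid_key s -> umode c (mk F s) n v = vmode c s n v.
Proof.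
move=> vs; rewrite (mkS F vs).
have -> : umode c << Sub s vs >> n v = lext (fun x : vkey => vmode c (val x) n v) << Sub s vs >> by [].
by rewrite lextU SubK.
Qed.

Lemma AmodeE m p v : Amode c m p v = dpow m O p v.
Proof. by rewrite dpowE. Qed.

Lemma O_linear m : flinear (dpow m O).
Proof. apply: flinear_dpow => n; exact: Lop_is_linear. Qed.

Lemma vmode_omega n v : vmode c [:: 2%N] n v = dpow 0 O n v.
Proof.
have -> : vmode c [:: 2%N] n v =
    \sum_(j < wt1 v + sumn [::] + 0 + `|n| + 2) Amode c 0 (-1 - j%:Z) (if n + j%:Z == -1 then v else 0)
  + \sum_(j < wt1 v + sumn [::] + 0 + `|n| + 2) (if n - 1 - j%:Z == -1 then Amode c 0 j%:Z v else 0) by [].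
rewrite -(@nop_id _ _ _ (wt1 v + sumn [::] + 0 + `|n| + 2) n v (O_linear 0)); last by lia.
congr (_ + _); apply: eq_bigr => j _; rewrite !AmodeE //.
Qed.

(** The cutoff built into [vmode] is large enough: beyond it the inner modes would lower the weight
    of the basis vector below 0. *)
Lemma vmode_quad k n x : eventually (fun S =>
  \sum_(j < S) dpow k O (-1 - j%:Z) (dpow 0 O (n + j%:Z) << x >>)
  + \sum_(j < S) dpow 0 O (n - 1 - j%:Z) (dpow k O j%:Z << x >>)
  = vmode c [:: k.+2; 2%N] n << x >>).
Proof.
pose T l := (wt1 (<< x >> : V1 F) + 2 + (l - 2) + `|n| + 2)%N.
have E l : vmode c [:: l; 2%N] n << x >> =
    \sum_(j < T l) Amode c (l - 2) (-1 - j%:Z) (vmode c [:: 2%N] (n + j%:Z) << x >>)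
  + \sum_(j < T l) vmode c [:: 2%N] (n - 1 - j%:Z) (Amode c (l - 2) j%:Z << x >>) by [].
rewrite {}E (_ : (k.+2 - 2)%N = k); last by rewrite subSS subn1.
have wtx : wt1 (<< x >> : V1 F) = sumn (val x) by rewrite /wt1 msuppU oner_eq0 big_seq_fset1.
have hx : hw1 (sumn (val x))%:Z (<< x >> : V1 F) by apply: supportedU.
have van m (p : int) : (sumn (val x))%:Z + m%:Z + 2 <= p -> dpow m O p << x >> = 0.
  move=> hp; rewrite dpowE /omega_field (hw1_neg (@hw1_Lop _ c _ _ _ hx)) ?scaler0 //; lia.
exists (T k.+2) => S TS.
have kT j : (T k.+2 <= j)%N -> (sumn (val x) + 2 + k + `|n| + 2 <= j)%N.
  by rewrite /T wtx subSS subn1.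
rewrite (sum_ord_trunc (f := fun j => dpow k O (-1 - j%:Z) (dpow 0 O (n + j%:Z) << x >>)) TS); last first.
  by move=> j /kT hj; rewrite van ?(field0 (O_linear k)) //; lia.
rewrite (sum_ord_trunc (f := fun j => dpow 0 O (n - 1 - j%:Z) (dpow k O j%:Z << x >>)) TS); last first.
  by move=> j /kT hj; rewrite van ?(field0 (O_linear 0)) //; lia.
by congr (_ + _); apply: eq_bigr => j _; rewrite AmodeE vmode_omega.
Qed.

Lemma uomegaE : uomega c = mk F [:: 2%N].
Proof. exact: (@Lop_top F c 2 [::]). Qed.

Lemma uwE k : (4 <= k)%N -> uw c k = mk F [:: (k - 2)%N; 2%N].
Proof.
move=> k4; rewrite /uw -/(uomega c) uomegaE (_ : 2 - k%:Z = - (k - 2)%N%:Z); last by lia.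
by apply: Lop_top; rewrite valid_cons /=; apply/and3P; split=> //; lia.
Qed.

Lemma umode_w k n x : (4 <= k)%N -> eventually (fun S =>
  \sum_(j < S) dpow (k - 4) O (-1 - j%:Z) (dpow 0 O (n + j%:Z) << x >>)
  + \sum_(j < S) dpow 0 O (n - 1 - j%:Z) (dpow (k - 4) O j%:Z << x >>)
  = umode c (uw c k) n << x >>).
Proof.
move=> k4; rewrite uwE // umode_mk; last by rewrite valid_cons /=; apply/and3P; split=> //; lia.
by rewrite (_ : (k - 2)%N = (k - 4).+2); [exact: vmode_quad | lia].
Qed.

Lemma gmodeE u n v : gmode c u n v = @tmap1 F vkey (umode c u n) v + @tmap2 F vkey (umode c u n) v.
Proof. by []. Qed.

Lemma gmode_is_linear u n : linear (gmode c u n).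
Proof.
move=> a x y; rewrite !gmodeE (tmap1_linear _ a x y) (tmap2_linear _ a x y).
by rewrite scalerDr addrACA.
Qed.

Lemma gmode_omega n v :
  gmode c (uomega c) n v = @tmap1 F vkey (Lop c (n - 1)) v + @tmap2 F vkey (Lop c (n - 1)) v.
Proof.
have h x : umode c (uomega c) n << x >> = Lop c (n - 1) << x >>.
  by rewrite uomegaE umode_mk // vmode_omega.
rewrite gmodeE; exact: (@eq_tmap F vkey _ _ v h).
Qed.

Lemma basis_word (x : vkey) :
  exists ks, [/\ letters ks, sumn ks = sumn (val x) & << x >> = word (Lop c) (mk F [::]) ks].
Proof.
exists (val x); split=> //; first by have /andP[] := valP x.
rewrite -mkE; elim: (val x) (valP x) => [|k s IH] // hv.
by rewrite -(Lop_top c hv) IH //; move: hv; rewrite valid_cons => /and3P[].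
Qed.

Lemma nomono_cons u i s :
  nomono c ((u, i) :: s) = i`!%:R *: gmode c u (-1 - i%:Z) (nomono c s).
Proof. by []. Qed.

Lemma strongly_generated_by (charF0 : [pchar F] =i pred0) (gens : seq nat) :
  (forall k, k \in gens -> (4 <= k)%N) ->
  (forall N, ~~ odd N -> (4 <= N)%N ->
     [\/ N \in gens, (12 <= N)%N | N = 10%N /\ c != 256%:R / 47%:R]) ->
  strongly_generated c (uomega c :: map (uw c) gens).
Proof.
move=> ge4 enough v sv.
set G := uomega c :: _.
pose ok := all (fun m : F * seq (V1 F * nat) => all (fun p => p.1 \in G) m.2).
pose P (v : V2 F) := exists ms, ok ms /\ v = \sum_(m <- ms) m.1 *: nomono c m.2.
have mode u (i : nat) y : u \in G -> P y -> P (gmode c u (-1 - i%:Z) y).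
  (* [nomono] multiplies the mode [-1-i] by [i!], so the coefficients are divided by it. *)
  move=> uG [ms [oms ->]]; exists [seq (m.1 / i`!%:R, (u, i) :: m.2) | m <- ms]; split.
    by rewrite /ok all_map; apply: sub_all oms => m /= ->; rewrite uG.
  have i0 : (i`!%:R : F) != 0.
    by case: (i`!) (fact_gt0 i) => // n _; rewrite (natF_neq0 charF0).
  have lg : flinear (gmode c u) by move=> n; exact: gmode_is_linear.
  rewrite (field_sum lg) big_map; apply: eq_bigr => m _.
  rewrite (fieldZ lg) -[RHS]/((m.1 / i`!%:R) *: nomono c ((u, i) :: m.2)) nomono_cons scalerA divfK //.
apply: (free_orbifold charF0 (@Lop_is_linear F c) (@Lop_vir F c) (wk := fun x => sumn (val x))
  (@hw1_Lop F c) _ (@Lop_vac F c) basis_word (gens := gens) (D := fun k => umode c (uw c k)) ge4 enough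
  (P := P) _ _ _ _ _ sv).
- exact: (@supported_mk F (fun s => (sumn s)%:Z == 0) [::] isT).
- by move=> k kg n x; apply: umode_w; exact: ge4.
- by exists [:: (1, [::])]; rewrite big_seq1 scale1r.
- move=> a x y [mx [ox ->]] [my [oy ->]].
  exists ([seq (a * m.1, m.2) | m <- mx] ++ my); split.
    rewrite /ok all_cat; apply/andP; split; last exact: oy.
    by rewrite all_map; exact: sub_all ox.
  exact: combination_lin.
- move=> i y Py; rewrite -gmode_omega; apply: mode Py; exact: mem_head.
- move=> k i y kg Py; rewrite -gmodeE; apply: mode Py.
  by rewrite inE; apply/orP; right; apply: map_f.
Qed.
End Concrete.

Theorem theorem3p1 (F : fieldType) (charF0 : [pchar F] =i pred0) (c : F) :
  (c != 256%:R / 47%:R ->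
     strongly_generated c [:: uomega c; uw c 4; uw c 6; uw c 8]) /\
  (c = 256%:R / 47%:R ->
     strongly_generated c [:: uomega c; uw c 4; uw c 6; uw c 8; uw c 10]).
Proof.
split=> hc.
- apply: (strongly_generated_by charF0 (gens := [:: 4; 6; 8]%N)) => [k|N oN N4].
    by rewrite !inE => /or3P[] /eqP->.
  case: (ltnP N 12) => [N12|]; last by constructor 2.
  (* Weight 10 is the only even weight from 4 to 11 without a generator; here the hypothesis on [c]
     enters. *)
  case: (eqVneq N 10%N) => [->|N10]; first by constructor 3.
  by constructor 1; rewrite !inE; lia.
- apply: (strongly_generated_by charF0 (gens := [:: 4; 6; 8; 10]%N)) => [k|N oN N4].
    by rewrite !inE => /or4P[] /eqP->.
  case: (ltnP N 12) => [N12|]; last by constructor 2.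
  by constructor 1; rewrite !inE; lia.
Qed.
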